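(* Let $d\ge 2$ and $m\in\mathbb{N}$. Suppose $\{\mathbf{V}_n:n\in\mathbb{N}_0\}$ is a sequence of independent $m$-variate random vectors with $\mathsf{E}[\mathbf{V}_n]=\mathbf{0}$ and $\operatorname{cov}(\mathbf{V}_n,\mathbf{V}_n)=a_n^2\mathsf{I}_m$; $\mathbf{U}$ is a random element uniformly distributed on $\mathbb{M}^d$, independent of $\{\mathbf{V}_n\}$; and $\{\mathsf{B}_n:n\in\mathbb{N}_0\}$ is a sequence of $m\times m$ symmetric nonnegative-definite matrices such that $\sum_{n=0}^\infty \mathsf{B}_nP_n^{(\alpha,\beta)}(1)$ converges (entrywise). Then the series \[ \mathbf{Z}(\mathbf{x})=\sum_{n=0}^\infty \mathsf{B}_n^{1/2}\mathbf{V}_nP_n^{(\alpha,\beta)}(\cos\rho(\mathbf{x},\mathbf{U})),\qquad \mathbf{x}\in\mathbb{M}^d, \] converges in mean square for each $\mathbf{x}$ and defines a centred $m$-variate isotropic random field on $\mathbb{M}^d$ with covariance matrix function \[ \operatorname{cov}(\mathbf{Z}(\mathbf{x}_1),\mathbf{Z}(\mathbf{x}_2))=\sum_{n=0}^\infty \mathsf{B}_nP_n^{(\alpha,\beta)}(\cos\rho(\mathbf{x}_1,\mathbf{x}_2)),\qquad \mathbf{x}_1,\mathbf{x}_2\in\mathbb{M}^d. \] Moreover, distinct terms of the series are uncorrelated: for $i\neq j$ and all $\mathbf{x}_1,\mathbf{x}_2\in\mathbb{M}^d$, $\operatorname{cov}\big(\mathsf{B}_i^{1/2}\mathbf{V}_iP_i^{(\alpha,\beta)}(\cos\rho(\mathbf{x}_1,\mathbf{U})),\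 \mathsf{B}_j^{1/2}\mathbf{V}_jP_j^{(\alpha,\beta)}(\cos\rho(\mathbf{x}_2,\mathbf{U}))\big)=\mathbf{0}$.
   Context: A compact connected two-point homogeneous space $\mathbb{M}^d$ of real dimension $d$ is one of: the sphere $\mathbb{S}^d$, the real projective space $\mathbb{P}^d(\mathbb{R})$, the complex projective space $\mathbb{P}^d(\mathbb{C})$ ($d$ even, $d\ge4$), the quaternionic projective space $\mathbb{P}^d(\mathbb{H})$ ($d=8,12,\dots$), or the octonionic projective plane $\mathbb{P}^{16}(\mathbb{O})$. Each is a Riemannian manifold all of whose geodesics are closed; the metric is normalized so that every closed geodesic has length $2\pi$ (as for the unit sphere $\mathbb{S}^d\subset\mathbb{R}^{d+1}$ with $\rho(\mathbf{x}_1,\mathbf{x}_2)=\arccos(\mathbf{x}_1^\top\mathbf{x}_2)$). $\rho$ denotes the induced geodesic distance, $\mu$ the canonical Riemannian volume measure, $\omega_d=\mu(\mathbb{M}^d)$. The parameters $(\alpha,\beta)$ are: for $\mathbb{S}^d$, $\alpha=\beta=\frac{d-2}{2}$; for $\mathbb{P}^d(\mathbb{R})$, $\alpha=\frac{d-2}{2}$, $\beta=-\frac12$; for $\mathbb{P}^d(\mathbb{C})$, $\alpha=\frac{d-2}{2}$, $\beta=0$; for $\mathbb{P}^d(\mathbb{H})$, $\alpha=\frac{d-2}{2}$, $\beta=1$; for $\mathbb{P}^{16}(\mathbb{O})$, $\alpha=7$, $\beta=3$. $P_n^{(\alpha,\beta)}$ is the Jacobi polynomial of degree $n$ in the standard normalization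 $P_n^{(\alpha,\beta)}(1)=\frac{\Gamma(n+\alpha+1)}{\Gamma(n+1)\Gamma(\alpha+1)}$. The constants are $a_n=\left(\frac{\Gamma(\beta+1)(2n+\alpha+\beta+1)\Gamma(n+\alpha+\beta+1)}{\Gamma(\alpha+\beta+2)\Gamma(n+\beta+1)}\right)^{1/2}$. A random element $\mathbf{U}$ of $\mathbb{M}^d$ is uniformly distributed if its law is invariant under all isometries of $\mathbb{M}^d$; equivalently its law is $\mu/\omega_d$. An $m$-variate random field on $\mathbb{M}^d$ is isotropic if its mean is constant and its covariance matrix $\operatorname{cov}(\mathbf{Z}(\mathbf{x}_1),\mathbf{Z}(\mathbf{x}_2))=\mathsf{E}[(\mathbf{Z}(\mathbf{x}_1)-\mathsf{E}\mathbf{Z}(\mathbf{x}_1))(\mathbf{Z}(\mathbf{x}_2)-\mathsf{E}\mathbf{Z}(\mathbf{x}_2))^\top]$ depends only on $\rho(\mathbf{x}_1,\mathbf{x}_2)$. For a symmetric nonnegative-definite matrix $\mathsf{B}=\mathsf{S}\mathsf{D}\mathsf{S}^{-1}$ ($\mathsf{S}$ orthogonal, $\mathsf{D}$ diagonal), $\mathsf{B}^{1/2}=\mathsf{S}\mathsf{D}^{1/2}\mathsf{S}^{-1}$. A series of matrices converges if each entry converges. *)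

(* Defs.v *)
From HB Require Import structures.
From mathcomp Require Import all_boot all_order all_algebra.
From mathcomp Require Import all_classical all_reals all_analysis.
Set Implicit Arguments. Unset Strict Implicit. Unset Printing Implicit Defensive.
Import Order.TTheory GRing.Theory Num.Theory.
Import numFieldNormedType.Exports.
Local Open Scope ring_scope.
Local Open Scope classical_set_scope.

Definition Gamma {R : realType} (x : R) : R :=
  fine (\int[@lebesgue_measure R]_(t in [set t : R | (0 < t)%R])
          ((powR t (x - 1) * expR (- t))%R)%:E)%E.

Definition gbinom {R : realType} (a : R) (k : nat) : R :=
  (\prod_(i < k) (a - i%:R)) / (k`!)%:R.

(* Jacobi polynomial P_n^(al,be)(x) (standard normalization,
   P_n^(al,be)(1) = binom(n+al, n)). *)
Definition jacobiP {R : realType} (n : nat) (al be x : R) : R :=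
  \sum_(s < n.+1)
     gbinom (n%:R + al) (n - s) * gbinom (n%:R + be) s
     * ((x - 1) / 2) ^+ s * ((x + 1) / 2) ^+ (n - s).

Definition a_const {R : realType} (al be : R) (n : nat) : R :=
  Num.sqrt ((Gamma (be + 1) * (2 * n%:R + al + be + 1) * Gamma (n%:R + al + be + 1))
            / (Gamma (al + be + 2) * Gamma (n%:R + be + 1))).

(* Cayley--Dickson algebras: CD 0 = R, CD 1 = C, CD 2 = H, CD 3 = O    *)

Fixpoint CD (R : Type) (j : nat) : Type :=
  match j with 0 => R | j'.+1 => (CD R j' * CD R j')%type end.

Fixpoint cd_zero {R : realType} (j : nat) : CD R j :=
  match j return CD R j with 0 => 0 | j'.+1 => (cd_zero j', cd_zero j') end.

Fixpoint cd_add {R : realType} (j : nat) : CD R j -> CD R j -> CD R j :=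
  match j return CD R j -> CD R j -> CD R j with
  | 0 => fun a b => a + b
  | j'.+1 => fun a b => (cd_add a.1 b.1, cd_add a.2 b.2)
  end.

Fixpoint cd_opp {R : realType} (j : nat) : CD R j -> CD R j :=
  match j return CD R j -> CD R j with
  | 0 => fun a => - a
  | j'.+1 => fun a => (cd_opp a.1, cd_opp a.2)
  end.

Fixpoint cd_conj {R : realType} (j : nat) : CD R j -> CD R j :=
  match j return CD R j -> CD R j with
  | 0 => fun a => a
  | j'.+1 => fun a => (cd_conj a.1, cd_opp a.2)
  end.

Fixpoint cd_mul {R : realType} (j : nat) : CD R j -> CD R j -> CD R j :=
  match j return CD R j -> CD R j -> CD R j with
  | 0 => fun a b => a * b
  | j'.+1 => fun a b =>
      (cd_add (cd_mul a.1 b.1) (cd_opp (cd_mul (cd_conj b.2) a.2)),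
       cd_add (cd_mul b.2 a.1) (cd_mul a.2 (cd_conj b.1)))
  end.

Fixpoint cd_re {R : realType} (j : nat) : CD R j -> R :=
  match j return CD R j -> R with
  | 0 => fun a => a
  | j'.+1 => fun a => cd_re a.1
  end.

Definition sph_pt (R : realType) (d : nat) : Type :=
  {x : 'I_d.+1 -> R | \sum_i x i ^+ 2 = 1}.

Definition sph_rho {R : realType} {d : nat} (x y : sph_pt R d) : R :=
  acos (\sum_i proj1_sig x i * proj1_sig y i).

(* Projective space P^(j-level)( (n+1) x (n+1) ): the rank-one Hermitian
   idempotents (P^* = P, P P = P, tr P = 1) with entries in CD j;
   for CD 3 (octonions) and n = 2 this is the Freudenthal model of the
   Cayley plane (primitive idempotents of the Albert algebra). *)
Definition proj_mx (R : Type) (j n : nat) : Type := 'I_n.+1 -> 'I_n.+1 -> CD R j.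

Definition is_proj_pt {R : realType} {j n : nat} (P : proj_mx R j n) : Prop :=
  [/\ (forall i k, P k i = cd_conj (P i k)),
      (forall i k, \big[@cd_add R j/cd_zero j]_(l < n.+1) cd_mul (P i l) (P l k) = P i k)
    & \sum_i cd_re (P i i) = 1].

Definition proj_pt (R : realType) (j n : nat) : Type :=
  {P : proj_mx R j n | is_proj_pt P}.

(* Re tr(P Q) *)
Definition proj_inner {R : realType} {j n : nat} (P Q : proj_mx R j n) : R :=
  \sum_i \sum_k cd_re (cd_mul (P i k) (cd_conj (Q i k))).

(* geodesic distance, normalized so that closed geodesics have length 2 pi:
   cos(rho/2)^2 = Re tr(PQ), i.e. rho = arccos(2 Re tr(PQ) - 1). *)
Definition proj_rho {R : realType} {j n : nat} (P Q : proj_pt R j n) : R :=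
  acos (2 * proj_inner (proj1_sig P) (proj1_sig Q) - 1).

Inductive tph_kind := KS | KR | KC | KH | KO.

Definition valid_dim (K : tph_kind) (d : nat) : bool :=
  match K with
  | KS => (2 <= d)%N
  | KR => (2 <= d)%N
  | KC => (4 <= d)%N && ~~ odd d
  | KH => (8 <= d)%N && (4 %| d)%N
  | KO => d == 16%N
  end.

Definition tph_point (R : realType) (K : tph_kind) (d : nat) : Type :=
  match K with
  | KS => sph_pt R d
  | KR => proj_pt R 0 d
  | KC => proj_pt R 1 (d %/ 2)
  | KH => proj_pt R 2 (d %/ 4)
  | KO => proj_pt R 3 (d %/ 8)
  end.

Definition rho {R : realType} {K : tph_kind} {d : nat} :
  tph_point R K d -> tph_point R K d -> R :=
  match K as K0 return tph_point R K0 d -> tph_point R K0 d -> R with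
  | KS => @sph_rho R d
  | KR => @proj_rho R 0 d
  | KC => @proj_rho R 1 (d %/ 2)
  | KH => @proj_rho R 2 (d %/ 4)
  | KO => @proj_rho R 3 (d %/ 8)
  end.

Definition alpha {R : realType} (K : tph_kind) (d : nat) : R :=
  match K with KO => 7 | _ => (d%:R - 2) / 2 end.

Definition beta {R : realType} (K : tph_kind) (d : nat) : R :=
  match K with
  | KS => (d%:R - 2) / 2
  | KR => - (1 / 2)
  | KC => 0
  | KH => 1
  | KO => 3
  end.

Definition isometry {M : Type} {R : realType} (dist : M -> M -> R) (g : M -> M) : Prop :=
  bijective g /\ forall x y, dist (g x) (g y) = dist x y.

Definition ball_sets {M : Type} {R : realType} (dist : M -> M -> R) : set (set M) :=
  [set A | exists x r, A = [set y | dist x y < r]].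

Definition borel_sets {M : Type} {R : realType} (dist : M -> M -> R) : set (set M) :=
  <<s ball_sets dist >>.

Definition Expe {R : realType} {dT : measure_display} {T : measurableType dT}
  (P : probability T R) (f : T -> R) : R := fine (\int[P]_w (f w)%:E)%E.

Definition rvec_L2 {R : realType} {dT : measure_display} {T : measurableType dT}
  (P : probability T R) {m : nat} (X : T -> 'cV[R]_m) : Prop :=
  forall i, measurable_fun setT (fun w => X w i 0)
            /\ P.-integrable setT (fun w => ((X w i 0) ^+ 2)%:E).

Definition Evec {R : realType} {dT : measure_display} {T : measurableType dT}
  (P : probability T R) {m : nat} (X : T -> 'cV[R]_m) : 'cV[R]_m :=
  \col_i Expe P (fun w => X w i 0).

Definition covmx {R : realType} {dT : measure_display} {T : measurableType dT}
  (P : probability T R) {m : nat} (X Y : T -> 'cV[R]_m) : 'M[R]_m :=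
  \matrix_(i, j) Expe P (fun w => (X w i 0 - Expe P (fun w => X w i 0))
                                  * (Y w j 0 - Expe P (fun w => Y w j 0))).

Definition sigma_rvec {R : realType} {dT : measure_display} {T : measurableType dT}
  {m : nat} (X : T -> 'cV[R]_m) : set (set T) :=
  <<s [set A | exists i B, measurable B /\ A = (fun w => X w i 0) @^-1` B] >>.

Definition random_element {M : Type} {R : realType} {dT : measure_display}
  {T : measurableType dT} (dist : M -> M -> R) (U : T -> M) : Prop :=
  forall A, borel_sets dist A -> measurable (U @^-1` A).

Definition sigma_el {M : Type} {R : realType} {T : Type}
  (dist : M -> M -> R) (U : T -> M) : set (set T) :=
  [set U @^-1` A | A in borel_sets dist].

Definition uniform_el {M : Type} {R : realType} {dT : measure_display}
  {T : measurableType dT} (P : probability T R) (dist : M -> M -> R) (U : T -> M) : Prop :=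
  forall g, isometry dist g ->
    forall A, borel_sets dist A -> P (U @^-1` A) = P ((g \o U) @^-1` A).

Definition indep_family {R : realType} {dT : measure_display} {T : measurableType dT}
  (P : probability T R) {I : eqType} (F : I -> set (set T)) : Prop :=
  forall J : seq I, uniq J -> forall A : I -> set T,
    (forall j, j \in J -> F j (A j)) ->
    P (\bigcap_(j in [set` J]) A j) = (\prod_(j <- J) P (A j))%E.

Definition indep2 {R : realType} {dT : measure_display} {T : measurableType dT}
  (P : probability T R) (F G : set (set T)) : Prop :=
  forall A B, F A -> G B -> P (A `&` B) = (P A * P B)%E.

Definition sym_nnd {R : realType} {m : nat} (B : 'M[R]_m) : Prop :=
  B^T = B /\ forall v : 'cV[R]_m, 0 <= (v^T *m B *m v) 0 0.

Definition sqrt_decomp {R : realType} {m : nat} (B : 'M[R]_m) (p : 'M[R]_m * 'M[R]_m) : Prop :=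
  [/\ p.1 *m p.1^T = 1%:M, is_diag_mx p.2 & B = p.1 *m p.2 *m invmx p.1].

Definition msqrt {R : realType} {m : nat} (B : 'M[R]_m) : 'M[R]_m :=
  let p := xget (0, 0) (sqrt_decomp B) in
  p.1 *m map_mx Num.sqrt p.2 *m invmx p.1.

(* Main.v *)
(* Write t(x, y) = (1 + cos rho(x, y)) / 2, a squared modulus of a Hermitian product in homogeneous
   coordinates. Invariance of the law of U under enough explicit isometries (reflections, phases,
   triality maps in the octonionic case) determines every joint moment E[t(x, U)^i t(y, U)^k], by
   comparing coefficients in rotation identities. The moments are those of a Beta-type law, and
   finite-difference orthogonality of Jacobi polynomials against them gives the reproducing formula
   E[P_n(cos rho(x, U)) P_n(cos rho(y, U))] = a_n^-2 P_n(cos rho(x, y)). No integration over the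
   space is needed.

   Independence of U and the V_n then makes the terms orthogonal, with covariance
   B_n P_n(cos rho(x, y)). The squared L^2 distance of two partial sums at x is a difference of
   partial sums of the convergent series of diagonal entries of B_n P_n(1), so the series converges
   by completeness of L^2, and covariances pass to the limit by Cauchy-Schwarz. *)
Require Import Defs.
From HB Require Import structures.
From mathcomp Require Import all_boot all_order all_algebra.
From mathcomp Require Import all_classical all_reals all_analysis.
From mathcomp Require Import ring lra zify measurable_realfun.
From mathcomp Require complex.
Import Defs.
Set Implicit Arguments. Unset Strict Implicit. Unset Printing Implicit Defensive.
Import Order.TTheory GRing.Theory Num.Theory.
Import numFieldNormedType.Exports.
Local Open Scope ring_scope.
Local Open Scope classical_set_scope.

(** * Rising factorials *)

Section RisingFactorial.
Variable R : comNzRingType.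
Implicit Types (x y : R) (n k : nat).

Definition rising x n : R := \prod_(i < n) (x + i%:R).
Definition falling x n : R := \prod_(i < n) (x - i%:R).

Lemma rising0 x : rising x 0 = 1.
Proof. by rewrite /rising big_ord0. Qed.

Lemma risingSr x n : rising x n.+1 = rising x n * (x + n%:R).
Proof. by rewrite /rising big_ord_recr. Qed.

Lemma risingSl x n : rising x n.+1 = x * rising (x + 1) n.
Proof.
rewrite /rising big_ord_recl addr0; congr (_ * _).
by apply: eq_bigr => i _; rewrite -addrA nat1r.
Qed.

Lemma risingD x m n : rising x (m + n) = rising x m * rising (x + m%:R) n.
Proof.
elim: n => [|n IHn]; first by rewrite addn0 rising0 mulr1.
by rewrite addnS !risingSr IHn natrD addrA mulrA.
Qed.

Lemma falling0 x : falling x 0 = 1.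
Proof. by rewrite /falling big_ord0. Qed.

Lemma fallingSr x n : falling x n.+1 = falling x n * (x - n%:R).
Proof. by rewrite /falling big_ord_recr. Qed.

Lemma fallingSl x n : falling x n.+1 = x * falling (x - 1) n.
Proof.
rewrite /falling big_ord_recl subr0; congr (_ * _).
by apply: eq_bigr => i _; rewrite -addrA -opprD nat1r.
Qed.

Lemma falling_rising x n : falling (x + n%:R - 1) n = rising x n.
Proof.
elim: n => [|n IHn]; first by rewrite falling0 rising0.
rewrite fallingSl risingSr mulrC -IHn; congr (falling _ _ * _); rewrite -natr1; ring.
Qed.

Lemma falling_nat n k : falling n%:R k = (n ^_ k)%:R.
Proof.
elim: k => [|k IHk]; first by rewrite falling0.
rewrite fallingSr IHk ffactnSr natrM.
have [le_kn|lt_nk] := leqP k n; first by rewrite natrB.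
by rewrite ffact_small// !mul0r.
Qed.

Lemma sum_binS (f : nat -> R) n :
  \sum_(l < n.+2) 'C(n.+1, l)%:R * f l =
  \sum_(l < n.+1) 'C(n, l)%:R * f l + \sum_(l < n.+1) 'C(n, l)%:R * f l.+1.
Proof.
rewrite big_ord_recl bin0 mul1r.
under eq_bigr => l _ do rewrite lift0 binS natrD mulrDl.
rewrite big_split /= addrA; congr (_ + _).
rewrite big_ord_recr /= bin_small // mul0r addr0.
by rewrite [in RHS]big_ord_recl bin0 mul1r.
Qed.

Lemma chu_vandermonde (s y : R) n :
  \sum_(l < n.+1) 'C(n, l)%:R * (falling y l * rising (s + l%:R) (n - l)) =
  rising (s + y) n.
Proof.
elim: n s y => [|n IHn] s y; first by rewrite big_ord1 falling0 !rising0 bin0 !mulr1.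
rewrite (sum_binS (fun l => falling y l * rising (s + l%:R) (n.+1 - l))).
have -> : \sum_(l < n.+1) 'C(n, l)%:R * (falling y l * rising (s + l%:R) (n.+1 - l)) =
    (s + n%:R) * rising (s + y) n.
  rewrite -IHn mulr_sumr; apply: eq_bigr => l _.
  have le_ln : (l <= n)%N by rewrite -ltnS.
  by rewrite subSn// risingSr (natrB _ le_ln); ring.
have -> : \sum_(l < n.+1) 'C(n, l)%:R * (falling y l.+1 * rising (s + l.+1%:R) (n.+1 - l.+1)) =
    y * rising (s + y) n.
  have -> : s + y = (s + 1) + (y - 1) by ring.
  rewrite -IHn mulr_sumr; apply: eq_bigr => l _.
  by rewrite fallingSl subSS -nat1r addrA; ring.
by rewrite risingSr; ring.
Qed.

Lemma rising_diff y k : rising (y + 1) k.+1 - rising y k.+1 = k.+1%:R * rising (y + 1) k.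
Proof. by rewrite risingSr risingSl -natr1; ring. Qed.

Lemma finite_difference_rising y n k :
  \sum_(s < n.+1) 'C(n, s)%:R * ((-1) ^+ s * rising (y + (n - s)%:R) k) =
  if (k < n)%N then 0 else (k ^_ n)%:R * rising (y + n%:R) (k - n).
Proof.
elim: n y k => [|n IHn] y k; first by rewrite big_ord1 ffactn0 bin0 expr0 !mul1r subn0.
rewrite (sum_binS (fun s => (-1) ^+ s * rising (y + (n.+1 - s)%:R) k)).
transitivity (\sum_(l < n.+1) 'C(n, l)%:R * ((-1) ^+ l *
    (rising (y + (n - l)%:R + 1) k - rising (y + (n - l)%:R) k))).
  rewrite -big_split; apply: eq_bigr => l _ /=.
  by rewrite (subSn (ltnSE (ltn_ord l))) -natr1 addrA subSS exprS; ring.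
case: k => [|k]; first by rewrite big1// => l _; rewrite !rising0 subrr !mulr0.
transitivity (k.+1%:R *
    \sum_(l < n.+1) 'C(n, l)%:R * ((-1) ^+ l * rising (y + 1 + (n - l)%:R) k)).
  rewrite mulr_sumr; apply: eq_bigr => l _.
  by rewrite rising_diff (addrAC y); ring.
rewrite IHn ltnS subSS; case: ifP => _; first by rewrite mulr0.
by rewrite mulrA -natrM ffactSS -natr1; congr (_ * rising _ _); ring.
Qed.

End RisingFactorial.

Lemma rising_gt0 (R : numDomainType) (x : R) n : 0 < x -> 0 < rising x n.
Proof.
by move=> x_gt0; apply: prodr_gt0 => i _; rewrite ltr_pwDl.
Qed.

Lemma rising_neq0 (R : numDomainType) (x : R) n : 0 < x -> rising x n != 0.
Proof. by move=> x_gt0; rewrite gt_eqF// rising_gt0. Qed.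

Lemma natr_fact_neq0 (R : numDomainType) n : n`!%:R != 0 :> R.
Proof. by rewrite pnatr_eq0 -lt0n fact_gt0. Qed.

(** * Jacobi polynomials *)

Lemma poly_sum_coef (R : nzRingType) (p : {poly R}) n : (size p <= n)%N ->
  \sum_(i < n) p`_i *: 'X^i = p.
Proof. by move=> le_pn; rewrite -poly_def; exact: take_poly_id. Qed.

Lemma coef_sum_scaleXn (R : nzRingType) (a : nat -> R) n i : (i < n)%N ->
  (\sum_(k < n) a k *: 'X^k)`_i = a i.
Proof. by move=> lt_in; rewrite -poly_def coef_poly lt_in. Qed.

Section MomentFunctional.
Variables (R : nzRingType) (mom : nat -> R).

Definition moment_functional (f : {poly R}) : R := \sum_(i < size f) f`_i * mom i.

Lemma moment_functionalE (f : {poly R}) n : (size f <= n)%N ->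
  moment_functional f = \sum_(i < n) f`_i * mom i.
Proof.
move=> le_fn; rewrite /moment_functional (big_ord_widen n (fun i => f`_i * mom i))//.
rewrite big_mkcond; apply: eq_bigr => i _; case: ltnP => // le_fi.
by rewrite nth_default// mul0r.
Qed.

Lemma moment_functional_is_linear : scalar moment_functional.
Proof.
move=> a f g.
have size_lin : (size (a *: f + g)%R <= maxn (size f) (size g))%N.
  rewrite (leq_trans (size_polyD _ _))// geq_max leq_maxr andbT.
  by rewrite (leq_trans (size_scale_leq _ _))// leq_maxl.
rewrite (moment_functionalE size_lin) (moment_functionalE (leq_maxl (size f) (size g))).
rewrite (moment_functionalE (leq_maxr (size f) (size g))) mulr_sumr -big_split /=.
by apply: eq_bigr => i _; rewrite coefD coefZ mulrDl mulrA.
Qed.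

HB.instance Definition _ := GRing.isLinear.Build R {poly R} R *%R moment_functional
  moment_functional_is_linear.

Lemma moment_functionalXn n : moment_functional 'X^n = mom n.
Proof.
rewrite /moment_functional size_polyXn (bigD1 ord_max)//= coefXn eqxx mul1r big1 ?addr0//.
move=> i; rewrite -val_eqE /= => /negbTE neq_in.
by rewrite coefXn neq_in mul0r.
Qed.

End MomentFunctional.

Section Xn1subXn.
Variable R : idomainType.

Lemma exp_1subX j : (1 - 'X) ^+ j = (-1) ^+ j *: ('X - 1%:P) ^+ j :> {poly R}.
Proof. by rewrite -mul_polyC rmorphXn rmorphN rmorph1 -exprMn mulN1r opprB. Qed.

Lemma size_XsubC1_Xn k j : (j <= k)%N ->
  size (('X - 1%:P) ^+ j * 'X^(k - j) : {poly R}) = k.+1.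
Proof.
move=> le_jk; rewrite size_Mmonic ?monicXn ?expf_neq0 ?polyXsubC_eq0//.
by rewrite size_exp_XsubC size_polyXn; lia.
Qed.

Lemma coef_XsubC1_Xn n j : (j <= n)%N -> (('X - 1%:P) ^+ j * 'X^(n - j) : {poly R})`_n = 1.
Proof.
move=> le_jn; rewrite coefMXn ltnNge leq_subr /= subKn//.
have := monic_exp j (monicXsubC (1 : R)).
by rewrite monicE /lead_coef size_exp_XsubC /= => /eqP.
Qed.

Lemma Xn_1subXn k j : 'X^(k - j) * (1 - 'X) ^+ j =
  (-1) ^+ j *: (('X - 1%:P) ^+ j * 'X^(k - j)) :> {poly R}.
Proof. by rewrite exp_1subX -scalerAr mulrC. Qed.

Lemma size_Xn_1subXn k j : (j <= k)%N ->
  size ('X^(k - j) * (1 - 'X) ^+ j : {poly R}) = k.+1.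
Proof. by move=> le_jk; rewrite Xn_1subXn size_scale ?signr_eq0// size_XsubC1_Xn. Qed.

Lemma coef_Xn_1subXn n j : (j <= n)%N ->
  ('X^(n - j) * (1 - 'X) ^+ j : {poly R})`_n = (-1) ^+ j.
Proof. by move=> le_jn; rewrite Xn_1subXn coefZ coef_XsubC1_Xn// mulr1. Qed.

End Xn1subXn.

Section Jacobi.
Variables (R : realType) (al be : R).
Local Notation A := (al + 1).
Local Notation B := (be + 1).
Local Notation AB := (al + be + 2).

Definition jacobi_poly (n : nat) : {poly R} :=
  \sum_(s < n.+1) (gbinom (n%:R + al) (n - s) * gbinom (n%:R + be) s) *:
     (('X - 1%:P) ^+ s * 'X^(n - s)).

Lemma jacobiP_horner n (r : R) : jacobiP n al be (2 * r - 1) = (jacobi_poly n).[r].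
Proof.
rewrite /jacobiP horner_sum; apply: eq_bigr => s _.
rewrite hornerZ hornerM !horner_exp !hornerE.
by congr (_ * _ ^+ _ * _ ^+ _); field.
Qed.

Lemma size_jacobi_poly n : (size (jacobi_poly n) <= n.+1)%N.
Proof.
apply: (leq_trans (size_sum _ _ _)); apply/bigmax_leqP => s _.
by apply: (leq_trans (size_scale_leq _ _)); rewrite size_XsubC1_Xn// -ltnS.
Qed.

Lemma gbinom_rising (x : R) n s : (s <= n)%N ->
  gbinom (n%:R + x) (n - s) = rising (x + 1 + s%:R) (n - s) / (n - s)`!%:R.
Proof.
move=> le_sn; rewrite /gbinom -/(falling _ _) -falling_rising natrB//.
by congr (falling _ _ / _); ring.
Qed.

Lemma jacobi_coef n s : (s <= n)%N ->
  gbinom (n%:R + al) (n - s) * gbinom (n%:R + be) s =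
  'C(n, s)%:R * (rising (A + s%:R) (n - s) * rising (B + (n - s)%:R) s) / n`!%:R.
Proof.
move=> le_sn; rewrite (gbinom_rising _ le_sn).
have := gbinom_rising be (leq_subr s n); rewrite subKn// => ->.
have bin_neq0 : 'C(n, s)%:R != 0 :> R by rewrite pnatr_eq0 -lt0n bin_gt0.
have := bin_fact le_sn => /(congr1 (fun k => k%:R : R)); rewrite !natrM => <-.
by field; rewrite bin_neq0 !natr_fact_neq0.
Qed.

Lemma jacobi_polyE n : jacobi_poly n = n`!%:R^-1 *:
  \sum_(s < n.+1) ('C(n, s)%:R * (rising (A + s%:R) (n - s) * rising (B + (n - s)%:R) s)) *:
     (('X - 1%:P) ^+ s * 'X^(n - s)).
Proof.
rewrite scaler_sumr; apply: eq_bigr => s _.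
by rewrite (jacobi_coef (ltnSE (ltn_ord s))) scalerA mulrC.
Qed.

Lemma jacobi_lead n : (jacobi_poly n)`_n = rising (n%:R + al + be + 1) n / n`!%:R.
Proof.
rewrite jacobi_polyE coefZ coef_sum mulrC; congr (_ / _).
have -> : n%:R + al + be + 1 = A + (n%:R + be) by ring.
rewrite -chu_vandermonde; apply: eq_bigr => s _.
have le_sn : (s <= n)%N by rewrite -ltnS.
rewrite coefZ coef_XsubC1_Xn// mulr1; congr (_ * _); rewrite mulrC; congr (_ * _).
by rewrite -falling_rising natrB//; congr falling; ring.
Qed.

Hypotheses (A_gt0 : 0 < A) (AB_gt0 : 0 < AB).

Definition beta_moment := moment_functional (fun i => rising B i / rising AB i).

HB.instance Definition _ := GRing.Linear.on beta_moment.

Lemma beta_momentXn_1subXn i j :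
  beta_moment ('X^i * (1 - 'X) ^+ j) = rising B i * rising A j / rising AB (i + j).
Proof.
elim: j i => [|j IHj] i.
  by rewrite expr0 mulr1 /beta_moment moment_functionalXn rising0 mulr1 addn0.
have -> : 'X^i * (1 - 'X) ^+ j.+1 =
   'X^i * (1 - 'X) ^+ j - 'X^(i.+1) * (1 - 'X) ^+ j :> {poly R} by rewrite !exprS; ring.
rewrite linearB /= !IHj addSn addnS !risingSr.
have ABij_neq0 : AB + (i + j)%:R != 0 by rewrite gt_eqF// ltr_wpDr.
by rewrite natrD; field; rewrite -natrD ABij_neq0 rising_neq0.
Qed.

Lemma beta_moment_jacobiXn n k : beta_moment (jacobi_poly n * 'X^k) =
  if (k < n)%N then 0 else
  rising A n * rising B n / n`!%:R / rising AB (n + k) *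
    ((k ^_ n)%:R * rising (B + n%:R) (k - n)).
Proof.
rewrite -[X in if _ then X else _](mulr0 (rising A n * rising B n / n`!%:R / rising AB (n + k))).
rewrite -(fun_if (fun x => _ * x)) -finite_difference_rising.
rewrite jacobi_polyE -scalerAl linearZ /= mulr_suml linear_sum !mulr_sumr /=.
apply: eq_bigr => s _; have le_sn : (s <= n)%N by rewrite -ltnS.
rewrite -scalerAl linearZ /=.
have -> : ('X - 1%:P) ^+ s * 'X^(n - s) * 'X^k =
   (-1) ^+ s *: ('X^(n - s + k) * (1 - 'X) ^+ s) :> {poly R}.
  by rewrite exp_1subX -scalerAr scalerA -exprMn mulrNN mulr1 expr1n scale1r exprD; ring.
rewrite linearZ /= beta_momentXn_1subXn.
have -> : (n - s + k + s = n + k)%N by lia.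
have <- : rising A s * rising (A + s%:R) (n - s) = rising A n by rewrite -risingD subnKC.
have <- : rising B (n - s) * rising (B + (n - s)%:R) s = rising B n by rewrite -risingD subnK.
by rewrite [rising B (n - s + k)]risingD; ring.
Qed.

Lemma beta_moment_jacobi n (g : {poly R}) : (size g <= n.+1)%N ->
  beta_moment (jacobi_poly n * g) = g`_n * (rising A n * rising B n / rising AB (n + n)).
Proof.
move=> /poly_sum_coef gE; rewrite -[in LHS]gE mulr_sumr linear_sum /= big_ord_recr /= big1 ?add0r.
  rewrite -scalerAr linearZ /= beta_moment_jacobiXn ltnn subnn rising0 mulr1 ffactnn.
  by congr (_ * _); field; rewrite natr_fact_neq0 rising_neq0.
by move=> l _; rewrite -scalerAr linearZ /= beta_moment_jacobiXn ltn_ord mulr0.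
Qed.

(* For uniform [u], with [c = t(x, y)], this is the conditional expectation of [t(y, u)^k] given
   [t(x, u)], and [beta_moment] is the law of [t(x, u)]. *)
Definition cond_moment (c : R) (k : nat) : {poly R} :=
  \sum_(j < k.+1) ('C(k, j)%:R * c ^+ (k - j) * (1 - c) ^+ j *
     (rising (B + (k - j)%:R) j / rising A j)) *: ('X^(k - j) * (1 - 'X) ^+ j).

Lemma size_cond_moment c k : (size (cond_moment c k) <= k.+1)%N.
Proof.
apply: (leq_trans (size_sum _ _ _)); apply/bigmax_leqP => j _.
by apply: (leq_trans (size_scale_leq _ _)); rewrite size_Xn_1subXn// -ltnS.
Qed.

Lemma coef_cond_moment c n : rising A n * (cond_moment c n)`_n = n`!%:R * (jacobi_poly n).[c].
Proof.
rewrite jacobi_polyE hornerZ mulVKf ?natr_fact_neq0// coef_sum horner_sum mulr_sumr.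
apply: eq_bigr => j _; have le_jn : (j <= n)%N by rewrite -ltnS.
rewrite coefZ coef_Xn_1subXn// hornerZ hornerM !horner_exp hornerXsubC hornerX.
have <- : rising A j * rising (A + j%:R) (n - j) = rising A n by rewrite -risingD subnKC.
rewrite -[c - 1]opprB [(- (1 - c)) ^+ j]exprNn.
by field; rewrite rising_neq0.
Qed.

Definition jacobi_const n : R := rising (n%:R + al + be + 1) n * rising B n / rising AB (n + n).

Lemma jacobi_reproducing (c : R) n :
  \sum_(k < n.+1) (jacobi_poly n)`_k *
     \sum_(i < n.+1) (jacobi_poly n)`_i * beta_moment ('X^i * cond_moment c k) =
  jacobi_const n * (jacobi_poly n).[c].
Proof.
transitivity (\sum_(k < n.+1) (jacobi_poly n)`_k *
    ((cond_moment c k)`_n * (rising A n * rising B n / rising AB (n + n)))).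
  apply: eq_bigr => k _; rewrite -beta_moment_jacobi; last first.
    by rewrite (leq_trans (size_cond_moment c k)).
  rewrite -[X in _ = _ * beta_moment (X * _)](poly_sum_coef (size_jacobi_poly n)).
  rewrite mulr_suml linear_sum; congr (_ * _).
  by apply: eq_bigr => i _; rewrite -scalerAl linearZ.
rewrite big_ord_recr /= big1 ?add0r => [|k _]; last first.
  by rewrite [X in _ * (X * _)]nth_default ?mul0r ?mulr0// (leq_trans (size_cond_moment _ _)).
have -> : (cond_moment c n)`_n = n`!%:R * (jacobi_poly n).[c] / rising A n.
  by rewrite -coef_cond_moment mulrC mulKf// rising_neq0.
rewrite jacobi_lead /jacobi_const.
by field; rewrite natr_fact_neq0 !rising_neq0.
Qed.

End Jacobi.

(** * The Gamma function *)

Section GammaFunction.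
Context {R : realType}.
Notation mu := (@lebesgue_measure R).
Implicit Types (x a b t : R) (n : nat).

Definition gamma_integrand x t : R := powR t (x - 1) * expR (- t).

Definition egamma x : \bar R :=
  (\int[mu]_(t in [set t : R | (0 < t)%R]) (gamma_integrand x t)%:E)%E.

Lemma gamma_integrand_ge0 x t : 0 <= gamma_integrand x t.
Proof. by rewrite mulr_ge0 ?powR_ge0 ?expR_ge0. Qed.

Lemma measurable_gamma_integrand x (D : set R) :
  measurable_fun D (EFin \o gamma_integrand x).
Proof.
apply/measurable_EFinP; apply: measurable_funTS; apply: measurable_funM.
  exact: measurable_powR.
by apply: measurableT_comp; [exact: measurable_expR|exact: oppr_measurable].
Qed.

Lemma egamma_ge0 x : (0 <= egamma x)%E.
Proof. by apply: integral_ge0 => t _; rewrite lee_fin gamma_integrand_ge0. Qed.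

Lemma is_derive_oppr_expRN t : is_derive t 1 (fun t => - expR (- t) : R) (expR (- t)).
Proof. by apply: is_derive_eq; rewrite mulrN1 opprK. Qed.

Lemma continuous_powR x t : 0 < t -> {for t, continuous (@powR R ^~ x)}.
Proof.
move=> t_gt0; apply: differentiable_continuous; apply/derivable1_diffP.
by apply: derivable_powR; rewrite in_itv/= andbT.
Qed.

Lemma continuous_expRN t : {for t, continuous (fun t => expR (- t) : R)}.
Proof. by apply: differentiable_continuous; apply/derivable1_diffP. Qed.

Lemma gamma_by_parts x a b : 0 <= x -> 0 < a -> a < b ->
  (\int[mu]_(t in `[a, b]) (powR t x * expR (- t))%:E =
   (powR a x * expR (- a) - powR b x * expR (- b))%:E +
   \int[mu]_(t in `[a, b]) (x * gamma_integrand x t)%:E)%E.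
Proof.
move=> x_ge0 a_gt0 ltab; have b_gt0 : 0 < b by exact: lt_trans ltab.
have itv_gt0 t : t \in `]a, b[%R -> 0 < t.
  by rewrite in_itv/= => /andP[+ _]; exact: lt_trans.
rewrite (@integration_by_parts R (@powR R ^~ x) (fun t => - expR (- t))
   (fun t => x * powR t (x - 1)) (fun t => expR (- t)))//.
- congr (_ + _)%E; first by congr EFin; ring.
  rewrite -[RHS]oppeK; congr (- _)%E; rewrite -integral_ge0N; last first.
    by move=> t _; rewrite lee_fin mulr_ge0// gamma_integrand_ge0.
  by apply: eq_integral => t _; rewrite -EFinN /gamma_integrand; congr EFin; ring.
- apply: continuous_in_subspaceT => t /set_mem /=; rewrite in_itv/= => /andP[leat _].
  by apply: cvgM; [exact: cvg_cst|apply: continuous_powR; exact: lt_le_trans leat].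
- split.
  + by move=> t /itv_gt0 t_gt0; apply: derivable_powR; rewrite in_itv/= andbT.
  + by apply/cvg_at_right_filter; apply: continuous_powR.
  + by apply/cvg_at_left_filter; apply: continuous_powR.
- by move=> t /itv_gt0 t_gt0; rewrite powR_derive1// in_itv/= andbT.
- by apply: continuous_in_subspaceT => t _; exact: continuous_expRN.
- split.
  + by move=> t _; have derN := is_derive_oppr_expRN t; exact: ex_derive.
  + by apply/cvg_at_right_filter; apply: cvgN; exact: continuous_expRN.
  + by apply/cvg_at_left_filter; apply: cvgN; exact: continuous_expRN.
- by move=> t _; have derN := is_derive_oppr_expRN t; rewrite derive1E; exact: derive_val.
Qed.

Definition exhausting_itv n : set R := `[n.+1%:R^-1, n.+2%:R].

Lemma invS_ltSS n : n.+1%:R^-1 < n.+2%:R :> R.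
Proof. by rewrite (@le_lt_trans _ _ 1) ?ltr1n// invf_le1// ler1n. Qed.

Lemma bigcup_exhausting_itv : \bigcup_n exhausting_itv n = [set t : R | 0 < t].
Proof.
apply/seteqP; split => [t [n _]|t /= t_gt0].
  by rewrite /exhausting_itv /= in_itv/= => /andP[+ _]; apply: lt_le_trans; rewrite invr_gt0.
exists (maxn (Num.truncn t) (Num.truncn t^-1)) => //; rewrite /exhausting_itv /= in_itv/=.
have ge_truncn k (y : R) : (Num.truncn y <= k)%N -> y <= k.+1%:R.
  by move=> le_yk; apply: ltW; rewrite -Num.Theory.truncn_le_nat.
apply/andP; split.
  by rewrite invf_ple ?posrE//; apply: ge_truncn; exact: leq_maxr.
apply: le_trans (ge_truncn _ _ (leqnn _)) _.
by rewrite ler_nat; apply: leq_trans (leqnSn _); rewrite ltnS leq_maxl.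
Qed.

Lemma nondecreasing_exhausting_itv : nondecreasing_seq exhausting_itv.
Proof.
move=> m n le_mn; rewrite subsetEset => t.
rewrite /exhausting_itv /= !in_itv/= => /andP[ge_t le_t]; apply/andP; split.
  by apply: le_trans ge_t; rewrite lef_pV2 ?posrE// ler_nat.
by apply: (le_trans le_t); rewrite ler_nat.
Qed.

Lemma egamma_cvg x :
  (\int[mu]_(t in exhausting_itv n) (gamma_integrand x t)%:E)%E @[n --> \oo] --> egamma x.
Proof.
rewrite /egamma -bigcup_exhausting_itv; apply: ge0_nondecreasing_set_cvg_integral.
- exact: nondecreasing_exhausting_itv.
- by move=> n; exact: measurable_itv.
- by move=> n; exact: measurable_gamma_integrand.
- by move=> n t _; rewrite lee_fin gamma_integrand_ge0.
Qed.

Lemma exprn_expRN_le k (y : R) : 0 < y -> y ^+ k * expR (- y) <= k.+1`!%:R / y.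
Proof.
move=> y_gt0; have fact_gt0 : 0 < k.+1`!%:R :> R by rewrite ltr0n fact_gt0.
rewrite expRN ler_pdivrMr ?expR_gt0// mulrAC ler_pdivlMr// -exprSr mulrC -ler_pdivrMr//.
by apply: le_trans (expR_ge1Dxn k (ltW y_gt0)); rewrite lerDr.
Qed.

Lemma cvg_powR_expRN x : powR n.+2%:R x * expR (- n.+2%:R) @[n --> \oo] --> (0 : R).
Proof.
pose k := (Num.truncn x).+1.
have le_xk : x <= k%:R by apply: ltW; exact: Num.Theory.truncnS_gt.
apply: (@squeeze_cvgr _ _ _ _ (cst 0) (fun n => k.+1`!%:R * harmonic n)).
- apply: nearW => n; rewrite mulr_ge0 ?powR_ge0 ?expR_ge0//=.
  apply: (@le_trans _ _ (n.+2%:R ^+ k * expR (- n.+2%:R))).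
    by rewrite ler_wpM2r ?expR_ge0// -powR_mulrn// ler_powR// ler1n.
  apply: le_trans (exprn_expRN_le k _) _ => //.
  by rewrite ler_wpM2l ?ler0n//= lef_pV2 ?posrE// ler_nat.
- exact: cvg_cst.
- by have := cvgM (cvg_cst (k.+1`!%:R : R)) (@cvg_harmonic R); rewrite mulr0; apply.
Qed.

Lemma cvg_powR_expRN0 x : 0 < x ->
  powR n.+1%:R^-1 x * expR (- n.+1%:R^-1) @[n --> \oo] --> (0 : R).
Proof.
move=> x_gt0.
apply: (@squeeze_cvgr _ _ _ _ (cst 0) (fun n => powR n.+1%:R^-1 x)).
- apply: nearW => n; rewrite mulr_ge0 ?powR_ge0 ?expR_ge0//=.
  by rewrite ler_piMr ?powR_ge0// -expR0 ler_expR oppr_le0 invr_ge0.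
- by apply: cvg_cst.
- have := powR_cvg0 x_gt0; move/cvg_at_rightP; apply.
  by split=> [n|]; [rewrite invr_gt0|exact: cvg_harmonic].
Qed.

Lemma egammaD1 x : 0 < x -> egamma (x + 1) = (x%:E * egamma x)%E.
Proof.
move=> x_gt0; apply: cvg_unique (@egamma_cvg (x + 1)) _; first exact: ereal_hausdorff.
have -> : (fun n => \int[mu]_(t in exhausting_itv n) (gamma_integrand (x + 1) t)%:E)%E =
    (fun n => (powR n.+1%:R^-1 x * expR (- n.+1%:R^-1) -
               powR n.+2%:R x * expR (- n.+2%:R))%:E) \+
    (fun n => x%:E * \int[mu]_(t in exhausting_itv n) (gamma_integrand x t)%:E)%E.
  apply/funext => n; under eq_integral do rewrite /gamma_integrand addrK.
  rewrite gamma_by_parts ?invr_gt0 ?ltW ?invS_ltSS//=; congr (_ + _)%E.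
  under eq_integral do rewrite EFinM.
  rewrite ge0_integralZl_EFin ?ltW//; last exact: measurable_gamma_integrand.
  by move=> t _; rewrite lee_fin gamma_integrand_ge0.
rewrite -[(_ * _)%E]add0e; apply: cvgeD.
- apply: ge0_adde_def; rewrite inE//.
  by apply: mule_ge0; [rewrite lee_fin ltW|exact: egamma_ge0].
- apply/cvg_EFin; first by apply: nearW.
  rewrite /comp /= -[0 in X in _ --> X](subr0 (0 : R)).
  by apply: cvgB; [exact: cvg_powR_expRN0 | exact: cvg_powR_expRN].
- by apply: cvgeZl => //; exact: egamma_cvg.
Qed.

Lemma egamma1_le1 : (egamma 1 <= 1)%E.
Proof.
apply: (cvge_le _ (@egamma_cvg 1)); apply: nearW => n.
have := gamma_by_parts (lexx 0) (_ : 0 < n.+1%:R^-1) (invS_ltSS n).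
rewrite invr_gt0 ltr0n => /(_ isT).
rewrite [X in (_ + X)%E]integral0_eq; last by move=> t _; rewrite mul0r.
rewrite adde0 !powRr0 !mul1r /exhausting_itv /gamma_integrand subrr => ->.
by rewrite lee_fin lerBlDr ler_wpDr ?expR_ge0// -expR0 ler_expR oppr_le0 invr_ge0.
Qed.

Lemma egamma_natS_lty n : (egamma n.+1%:R < +oo)%E.
Proof.
elim: n => [|n IHn]; first exact: le_lt_trans egamma1_le1 (ltry _).
by rewrite -natr1 egammaD1// lte_mul_pinfty//; exact: egamma_ge0.
Qed.

Lemma measurable_gt0 : measurable [set t : R | 0 < t].
Proof.
have -> : [set t : R | 0 < t] = `]0, +oo[ by apply/seteqP; split=> t /=; rewrite in_itv/= andbT.
exact: measurable_itv.
Qed.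

Lemma egamma_le x y : 1 <= x -> x <= y -> (egamma x <= egamma 1 + egamma y)%E.
Proof.
move=> le1x lexy; have mpos := measurable_gt0.
have ge0 z t : [set t : R | 0 < t] t -> (0 <= (gamma_integrand z t)%:E)%E.
  by move=> _; rewrite lee_fin gamma_integrand_ge0.
rewrite /egamma -ge0_integralD//; do ?[exact: ge0|exact: measurable_gamma_integrand].
apply: ge0_le_integral => //.
- exact: ge0.
- exact: measurable_gamma_integrand.
- by apply: emeasurable_funD; exact: measurable_gamma_integrand.
move=> t /= t_gt0; rewrite -EFinD lee_fin /gamma_integrand -mulrDl ler_wpM2r ?expR_ge0//.
rewrite subrr powRr0; have [le_t1|le_1t] := leP t 1.
  rewrite ler_wpDr ?powR_ge0// -[leRHS](powRr0 t).
  by apply: ger_powR; [rewrite t_gt0 le_t1|rewrite subr_ge0].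
by rewrite ler_wpDl//; apply: ler_powR; [exact: ltW|rewrite lerD2r].
Qed.

Lemma egamma_lty x : 0 < x -> (egamma x < +oo)%E.
Proof.
move=> x_gt0; suff : (egamma (x + 1) < +oo)%E.
  rewrite egammaD1//; have := egamma_ge0 x; case: (egamma x) => [r _ _|//|//].
    by rewrite ltry.
  by rewrite gt0_muley ?lte_fin.
pose k := Num.truncn (x + 1); have le_xk : x + 1 <= k.+1%:R.
  by apply: ltW; exact: Num.Theory.truncnS_gt.
have le_1x : 1 <= x + 1 by rewrite lerDr ltW.
apply: le_lt_trans (egamma_le le_1x le_xk) _.
by apply: lte_add_pinfty; [exact: (egamma_natS_lty 0)|exact: egamma_natS_lty].
Qed.

Lemma egamma_gt0 x : 0 < x -> (0 < egamma x)%E.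
Proof.
move=> x_gt0; suff : (0 < egamma (x + 1))%E by rewrite egammaD1// pmule_rgt0// lte_fin.
apply: (@lt_le_trans _ _ (\int[mu]_(t in `[1%R, 2%R]) (expR (- 2))%:E)%E).
  rewrite integral_cst//= lebesgue_measure_itv/= lte_fin ltr1n/= -EFinB -EFinM lte_fin.
  by rewrite mulr_gt0 ?expR_gt0// subr_gt0 ltr1n.
apply: (@le_trans _ _ (\int[mu]_(t in `[1%R, 2%R]) (gamma_integrand (x + 1) t)%:E)%E).
  apply: ge0_le_integral => //; first exact: measurable_gamma_integrand.
  move=> t; rewrite /= in_itv/= => /andP[le_1t le_t2]; rewrite lee_fin /gamma_integrand addrK.
  rewrite -[leLHS]mul1r ler_pM// ?expR_ge0//; last by rewrite ler_expR lerN2.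
  by rewrite -[leLHS](powRr0 t); apply: ler_powR => //; exact: ltW.
apply: ge0_subset_integral => //.
- exact: measurable_gt0.
- exact: measurable_gamma_integrand.
- by move=> t _; rewrite lee_fin gamma_integrand_ge0.
- by move=> t /=; rewrite in_itv/= => /andP[le_1t _]; exact: lt_le_trans le_1t.
Qed.

Lemma Gamma_gt0 x : 0 < x -> 0 < Gamma x.
Proof. by move=> x_gt0; rewrite fine_gt0// egamma_gt0// egamma_lty. Qed.

Lemma GammaD1 x : 0 < x -> Gamma (x + 1) = x * Gamma x.
Proof.
move=> x_gt0; rewrite /Gamma -/(egamma (x + 1)) -/(egamma x) egammaD1// fineM//.
by rewrite ge0_fin_numE ?egamma_lty// egamma_ge0.
Qed.

Lemma Gamma_rising x n : 0 < x -> Gamma (x + n%:R) = rising x n * Gamma x.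
Proof.
move=> x_gt0; elim: n => [|n IHn]; first by rewrite addr0 rising0 mul1r.
have xn_gt0 : 0 < x + n%:R by rewrite ltr_pwDl.
by rewrite -natr1 addrA (GammaD1 xn_gt0) IHn risingSr mulrA [_ * rising x n]mulrC.
Qed.

End GammaFunction.

Lemma rising_duplication (R : numFieldType) (s : R) n : 0 < s ->
  s + (n + n)%:R = s * rising (s + 1) (n + n) / (rising s n * rising (s + n%:R) n).
Proof.
move=> s_gt0; rewrite -risingSl risingSr risingD mulrAC mulfV ?mul1r//.
by rewrite mulf_neq0 ?rising_neq0// ltr_wpDr.
Qed.

Lemma a_const_sqr (R : realType) (al be : R) n : 0 < be + 1 -> 0 < al + be + 1 ->
  a_const al be n ^+ 2 * jacobi_const al be n = 1.
Proof.
rewrite /a_const /jacobi_const => be_gt0.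
have -> : n%:R + al + be + 1 = al + be + 1 + n%:R by ring.
have -> : al + be + 2 = al + be + 1 + 1 by ring.
have -> : n%:R + be + 1 = be + 1 + n%:R by ring.
have -> : 2 * n%:R + al + be + 1 = al + be + 1 + (n + n)%:R by rewrite natrD; ring.
move: (al + be + 1) (be + 1) be_gt0 => s B B_gt0 s_gt0.
have s1_gt0 : 0 < s + 1 by rewrite ltr_wpDr.
have sn_gt0 : 0 < s + n%:R by rewrite ltr_wpDr.
rewrite !Gamma_rising// GammaD1//.
move: (Gamma B) (Gamma s) (Gamma_gt0 B_gt0) (Gamma_gt0 s_gt0) => GB Gs GB_gt0 Gs_gt0.
rewrite sqr_sqrtr; last first.
  by rewrite divr_ge0 ?mulr_ge0 ?ltW ?rising_gt0// ltr_wpDr.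
rewrite rising_duplication//; field.
by rewrite !gt_eqF ?rising_gt0.
Qed.

(** * Reflections and the spectral theorem *)

Section DotProduct.
Variables (R : comNzRingType) (n : nat).
Implicit Types u v w : 'cV[R]_n.

Definition dot u v : R := \sum_i u i 0 * v i 0.

Lemma dotE u v : u^T *m v = (dot u v)%:M.
Proof.
by apply/matrixP => i j; rewrite !ord1 !mxE; apply: eq_bigr => k _; rewrite mxE.
Qed.

Lemma dotC u v : dot u v = dot v u.
Proof. by apply: eq_bigr => i _; rewrite mulrC. Qed.

Lemma dotDl u v w : dot (u + v) w = dot u w + dot v w.
Proof. by rewrite /dot -big_split; apply: eq_bigr => i _; rewrite !mxE mulrDl. Qed.

Lemma dotZl a u w : dot (a *: u) w = a * dot u w.
Proof. by rewrite /dot mulr_sumr; apply: eq_bigr => i _; rewrite !mxE mulrA. Qed.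

Lemma dotNl u w : dot (- u) w = - dot u w.
Proof. by rewrite -scaleN1r dotZl mulN1r. Qed.

Lemma dotBl u v w : dot (u - v) w = dot u w - dot v w.
Proof. by rewrite dotDl dotNl. Qed.

Lemma dotBr u v w : dot w (u - v) = dot w u - dot w v.
Proof. by rewrite dotC dotBl !(dotC w). Qed.

Lemma dot_delta i v : dot (delta_mx i 0) v = v i 0.
Proof.
rewrite /dot (bigD1 i)//= !mxE !eqxx mul1r big1 ?addr0// => k /negbTE neq_ki.
by rewrite mxE neq_ki mul0r.
Qed.

Lemma dot_delta_self i : dot (delta_mx i 0) (delta_mx i 0) = 1.
Proof. by rewrite dot_delta mxE !eqxx. Qed.

Definition reflection_mx (Q : 'M[R]_n) : Prop := Q^T = Q /\ Q *m Q = 1%:M.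

Lemma reflection_dot Q u v : reflection_mx Q -> dot (Q *m u) (Q *m v) = dot u v.
Proof.
move=> [QT QQ]; have : (dot (Q *m u) (Q *m v))%:M = (dot u v)%:M :> 'M[R]_1.
  by rewrite -!dotE trmx_mul QT mulmxA -(mulmxA u^T) QQ mulmx1.
by move/matrixP/(_ 0 0); rewrite !mxE eqxx.
Qed.

End DotProduct.

Section PlaneVector.
Context {R : comNzRingType} {n : nat}.
Implicit Types (a b : R) (w : 'cV[R]_n.+2).

Definition plane_vec a b : 'cV[R]_n.+2 :=
  a *: delta_mx ord0 0 + b *: delta_mx (lift ord0 ord0) 0.

Lemma plane_vecE a b i : plane_vec a b i 0 = a * (i == ord0)%:R + b * (i == lift ord0 ord0)%:R.
Proof. by rewrite !mxE !eqxx !andbT. Qed.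

Lemma dot_plane_vec a b w : dot (plane_vec a b) w = a * w ord0 0 + b * w (lift ord0 ord0) 0.
Proof. by rewrite dotDl !dotZl !dot_delta. Qed.

Lemma plane_vec_dot a b : a ^+ 2 + b ^+ 2 = 1 -> dot (plane_vec a b) (plane_vec a b) = 1.
Proof.
by move=> ab1; rewrite dot_plane_vec !plane_vecE /= !mulr1 !mulr0 addr0 add0r -!expr2.
Qed.

End PlaneVector.

Lemma invmx_orthogonal (R : comUnitRingType) n (S : 'M[R]_n) : S *m S^T = 1%:M -> invmx S = S^T.
Proof.
by move=> SST; have [S_unit _] := mulmx1_unit SST; rewrite -[invmx S]mulmx1 -SST mulKmx.
Qed.

Section Householder.
Variables (R : realFieldType) (n : nat).
Implicit Types u v : 'cV[R]_n.

Lemma dot_ge0 u : 0 <= dot u u.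
Proof. by apply: sumr_ge0 => i _; rewrite -expr2 sqr_ge0. Qed.

Lemma dot_eq0 u : dot u u = 0 -> u = 0.
Proof.
move=> u0; apply/matrixP => i j; rewrite ord1 mxE.
have ge0 k : true -> 0 <= u k 0 * u k 0 by rewrite -expr2 sqr_ge0.
by have /eqP := psumr_eq0P ge0 u0 (i:=i) isT; rewrite mulf_eq0 orbb => /eqP.
Qed.

(* The Householder reflection in the bisecting hyperplane of [u] and [v]. *)
Lemma exists_reflection u v : dot u u = dot v v ->
  exists Q : 'M[R]_n, [/\ reflection_mx Q, Q *m u = v
    & forall x, dot (u - v) x = 0 -> Q *m x = x].
Proof.
move=> uv; have [w0|/eqP w0] := eqVneq (u - v) 0.
  exists 1%:M; split => [|//|x _]; rewrite ?mul1mx//; first by split; rewrite ?trmx1 ?mul1mx.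
  by apply/eqP; rewrite -subr_eq0 w0.
set w := u - v in w0 *; set s := dot w w.
have s0 : s != 0 by apply/eqP => /dot_eq0.
pose Q := 1%:M - (2 / s) *: (w *m w^T).
have Qx x : Q *m x = x - (2 / s * dot w x) *: w.
  by rewrite mulmxBl mul1mx -scalemxAl -mulmxA dotE -scalemx1 -scalemxAr mulmx1 scalerA.
have QQ : Q *m Q = 1%:M.
  have wwT_sqr : w *m w^T *m (w *m w^T) = s *: (w *m w^T).
    by rewrite mulmxA -(mulmxA w) dotE -/s -scalemx1 -scalemxAr mulmx1 -scalemxAl.
  rewrite /Q mulmxBl mul1mx mulmxBr mulmx1 -scalemxAl -scalemxAr scalerA wwT_sqr scalerA.
  have -> : 2 / s * (2 / s) * s = 2 / s + 2 / s by field.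
  by rewrite scalerDl opprB addrK subrK.
exists Q; split; [split => //|rewrite Qx|by move=> x wx; rewrite Qx wx mulr0 scale0r subr0].
  by rewrite linearB linearZ /= trmx1 trmx_mul trmxK.
suff -> : 2 / s * dot w u = 1 by rewrite scale1r /w opprB addrC subrK.
have sE : s = 2 * dot w u by rewrite /s dotBr !dotBl uv (dotC v u); ring.
by rewrite mulrAC -sE mulfV.
Qed.

End Householder.

Section RealSpectral.
Variable R : realType.

Import complex.

Lemma symmetric_complex_eigenvalue n (A : 'M[R]_n.+1) : A^T = A ->
  exists a : R, eigenvalue (map_mx (real_complex R) A) (a%:C)%C.
Proof.
move=> AT; pose AC : 'M[R[i]]_n.+1 := map_mx (real_complex R) A.
have AC_real : AC \is a realmx.
  by apply/mxOverP => i j; rewrite mxE; apply/complex_realP; exists (A i j).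
have AC_sym : AC \is symmetricmx.
  apply/is_hermitianmxP; rewrite expr0 scale1r; apply/matrixP => i j.
  by rewrite !mxE -[in LHS]AT mxE.
have AC_herm := realsym_hermsym AC_sym AC_real.
have /orthomx_spectralP ACE := hermitian_normalmx AC_herm.
have /mxOverP/(_ 0 0)/RRe_real aE := hermitian_spectral_diag_real AC_herm.
exists (complex.Re (spectral_diag AC 0 0)).
apply/eigenvalueP; exists (row 0 (spectralmx AC)).
  have : spectralmx AC *m AC = diag_mx (spectral_diag AC) *m spectralmx AC.
    by rewrite [in X in _ *m X]ACE !mulmxA mulmxV ?spectral_unit// mul1mx.
  move/(congr1 (row 0)); rewrite row_mul => ->.
  by rewrite row_mul row_diag_mx -scalemxAl -rowE aE.
apply/eqP => row0; have := spectral_unit AC.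
rewrite -row_free_unit => /row_freeP[S SK].
have := congr1 (row 0) SK; rewrite row_mul row0 mul0mx => /matrixP/(_ 0 0).
by rewrite !mxE eqxx => /esym/eqP; rewrite oner_eq0.
Qed.

Lemma symmetric_unit_eigenvector n (A : 'M[R]_n.+1) : A^T = A ->
  exists2 v : 'cV[R]_n.+1, dot v v = 1 & exists a, A *m v = a *: v.
Proof.
move=> AT; have [a] := symmetric_complex_eigenvalue AT.
rewrite eigenvalue_root_char -map_char_poly fmorph_root -eigenvalue_root_char.
move=> /eigenvalueP[v vA v0]; pose u := v^T.
have uu_neq0 : dot u u != 0.
  by apply: contra v0 => /eqP/dot_eq0 u0; rewrite -(trmxK v) -/u u0 trmx0.
have uu_ge0 := dot_ge0 u.
have Au : A *m u = a *: u by rewrite -[A]trmxK -trmx_mul AT vA linearZ.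
exists ((Num.sqrt (dot u u))^-1 *: u).
  by rewrite dotZl dotC dotZl mulrA -expr2 exprVn sqr_sqrtr// mulVf.
by exists a; rewrite -scalemxAr Au !scalerA mulrC.
Qed.

Lemma symmetric_deflation n (A : 'M[R]_(1 + n)) : A^T = A ->
  exists (Q : 'M[R]_(1 + n)) (a : R) (A' : 'M[R]_n),
    [/\ reflection_mx Q, A'^T = A' & A = Q *m block_mx a%:M 0 0 A' *m Q].
Proof.
move=> AT; have [v v1 [a Av]] := symmetric_unit_eigenvector AT.
pose e : 'cV[R]_(1 + n) := delta_mx 0 0; have e1 : dot e e = 1 by exact: dot_delta_self.
have [Q [Qrefl Qe _]] := @exists_reflection R (1 + n) e v (etrans e1 (esym v1)).
have [QT QQ] := Qrefl; pose A' : 'M[R]_(1 + n) := Q *m A *m Q.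
have A'T : A'^T = A' by rewrite !trmx_mul QT AT mulmxA.
have A'e : A' *m e = a *: e.
  rewrite /A' -!mulmxA Qe Av -scalemxAr; congr (_ *: _).
  by rewrite -Qe mulmxA QQ mul1mx.
have A'0 i : A' i 0 = a * (i == 0)%:R.
  by have /matrixP/(_ i 0) := A'e; rewrite -colE !mxE eqxx andbT.
have lshift0 : lshift n (0 : 'I_1) = 0 by apply: val_inj.
exists Q, a, (drsubmx A'); split => //; first by rewrite trmx_drsub A'T.
rewrite (_ : block_mx _ _ _ _ = A'); first by rewrite /A' !mulmxA QQ mul1mx -mulmxA QQ mulmx1.
rewrite -[RHS]submxK; congr block_mx; apply/matrixP => i j; rewrite ?ord1.
- by rewrite [RHS]mxE [RHS]mxE lshift0 A'0 !mxE eqxx mulr1.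
- by rewrite -[in RHS]A'T [RHS]mxE [RHS]mxE [RHS]mxE lshift0 A'0 !mxE mulr0.
- by rewrite [RHS]mxE [RHS]mxE lshift0 A'0 !mxE mulr0.
Qed.

Lemma symmetric_sqrt_decomp n (A : 'M[R]_n) : A^T = A -> exists p, sqrt_decomp A p.
Proof.
elim: n A => [|n IHn] A AT.
  exists (1%:M, A); split => /=; first by rewrite trmx1 mulmx1.
  - by apply/is_diag_mxP => -[].
  - by apply/matrixP => -[].
have [Q [a [A' [[QT QQ] A'T ->]]]] := symmetric_deflation AT.
have [[S D] /= [SST Ddiag ->]] := IHn A' A'T.
pose S' : 'M[R]_(1 + n) := block_mx 1%:M 0 0 S.
pose D' : 'M[R]_(1 + n) := block_mx a%:M 0 0 D.
have S'S'T : S' *m S'^T = 1%:M.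
  rewrite /S' tr_block_mx mulmx_block trmx1 !trmx0 !mulmx0 !mul0mx mulmx1 !addr0 add0r SST.
  by rewrite -scalar_mx_block.
have QS'_orth : Q *m S' *m (Q *m S')^T = 1%:M.
  by rewrite trmx_mul QT mulmxA -(mulmxA Q) S'S'T mulmx1 QQ.
have D'diag : is_diag_mx D' by rewrite /D' is_diag_block_mx// !eqxx scalar_mx_is_diag.
have S'D'S'T : block_mx a%:M 0 0 (S *m D *m S^T) = S' *m D' *m S'^T.
  rewrite /S' /D' tr_block_mx !mulmx_block trmx1 !trmx0.
  by rewrite ?(mulmx0, mul0mx, mulmx1, mul1mx, addr0, add0r).
exists (Q *m S', D'); split => //.
by rewrite (invmx_orthogonal QS'_orth) (invmx_orthogonal SST) S'D'S'T trmx_mul QT !mulmxA.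
Qed.

Lemma sqrt_diag_mx n (D : 'M[R]_n) : is_diag_mx D -> (forall i, 0 <= D i i) ->
  map_mx Num.sqrt D *m (map_mx Num.sqrt D)^T = D.
Proof.
move=> /diag_mxP[d ->] d_ge0.
have -> : map_mx Num.sqrt (diag_mx d) = diag_mx (map_mx Num.sqrt d).
  by apply/matrixP => i j; rewrite !mxE; case: (i == j); rewrite ?mulr1n// !mulr0n sqrtr0.
rewrite tr_diag_mx mulmx_diag; congr diag_mx; apply/rowP => i.
by have := d_ge0 i; rewrite !mxE eqxx mulr1n -expr2 => /sqr_sqrtr.
Qed.

Lemma msqrt_mul_trmx n (B : 'M[R]_n) : sym_nnd B -> msqrt B *m (msqrt B)^T = B.
Proof.
move=> [BT Bnn]; rewrite /msqrt.
have [p /(xgetI (0, 0))] := symmetric_sqrt_decomp BT.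
case: xget => S D /= [SST Ddiag BE].
rewrite (invmx_orthogonal SST) in BE *; have STS := mulmx1C SST.
have D_ge0 i : 0 <= D i i.
  have := Bnn (S *m delta_mx i 0); rewrite BE trmx_mul !mulmxA -(mulmxA _ S^T) STS mulmx1.
  by rewrite -(mulmxA _ S^T S) STS mulmx1 trmx_delta -rowE -colE !mxE.
rewrite !trmx_mul trmxK !mulmxA -(mulmxA _ S^T S) STS mulmx1.
by rewrite -(mulmxA S) sqrt_diag_mx// -BE.
Qed.

End RealSpectral.

(** * Expectations *)

(* Closure lemmas such as [rpredD] for [Lfun P p] ask for [1 <= p]. *)
#[local] Hint Extern 0 (is_true (@Order.le _ _ (EFin _) _)) => exact: lee1n : core.

Section BoundedMeasurable.
Context {R : realType} {d : measure_display} {T : measurableType d}.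
Implicit Types f g : T -> R.

Definition bounded_mfun f := measurable_fun setT f /\ exists M, forall w, `|f w| <= M.

Lemma bounded_mfun_cst c : bounded_mfun (fun=> c).
Proof. by split; [exact: measurable_cst | exists `|c|]. Qed.

Lemma bounded_mfunD f g : bounded_mfun f -> bounded_mfun g -> bounded_mfun (fun w => f w + g w).
Proof.
move=> [mf [M fM]] [mg [N gN]]; split; first exact: measurable_funD.
by exists (M + N) => w; rewrite (le_trans (ler_normD _ _))// lerD.
Qed.

Lemma bounded_mfunM f g : bounded_mfun f -> bounded_mfun g -> bounded_mfun (fun w => f w * g w).
Proof.
move=> [mf [M fM]] [mg [N gN]]; split; first exact: measurable_funM.
by exists (M * N) => w; rewrite normrM ler_pM.
Qed.

Lemma bounded_mfunZ c f : bounded_mfun f -> bounded_mfun (fun w => c * f w).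
Proof. by move=> ?; apply: bounded_mfunM => //; exact: bounded_mfun_cst. Qed.

Lemma bounded_mfunB f g : bounded_mfun f -> bounded_mfun g -> bounded_mfun (fun w => f w - g w).
Proof.
move=> bf /(bounded_mfunZ (-1)) bg; have := bounded_mfunD bf bg.
by under [X in bounded_mfun X]eq_fun do rewrite mulN1r.
Qed.

Lemma bounded_mfun_sum I (s : seq I) (F : I -> T -> R) : (forall i, bounded_mfun (F i)) ->
  bounded_mfun (fun w => \sum_(i <- s) F i w).
Proof.
move=> bF; elim: s => [|i s IHs].
  by under [X in bounded_mfun X]eq_fun do rewrite big_nil; exact: bounded_mfun_cst.
by under [X in bounded_mfun X]eq_fun do rewrite big_cons; exact: bounded_mfunD.
Qed.

Lemma bounded_mfunX n f : bounded_mfun f -> bounded_mfun (fun w => f w ^+ n).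
Proof.
move=> bf; elim: n => [|n IHn].
  by under [X in bounded_mfun X]eq_fun do rewrite expr0; exact: bounded_mfun_cst.
by under [X in bounded_mfun X]eq_fun do rewrite exprS; exact: bounded_mfunM.
Qed.

Lemma bounded_mfun_horner (q : {poly R}) f : bounded_mfun f -> bounded_mfun (fun w => q.[f w]).
Proof.
move=> bf; under [X in bounded_mfun X]eq_fun do rewrite horner_coef.
by apply: bounded_mfun_sum => i; apply: bounded_mfunZ; exact: bounded_mfunX.
Qed.

End BoundedMeasurable.

Lemma bounded_mfun_comp (R : realType) d (T : measurableType d) d' (T' : measurableType d')
    (phi : T' -> T) (f : T -> R) :
  measurable_fun setT phi -> bounded_mfun f -> bounded_mfun (f \o phi).
Proof.
by move=> mphi [mf [M fM]]; split; [exact: measurableT_comp|exists M => w; exact: fM].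
Qed.

Section Lfun.
Context {R : realType} {dT : measure_display} {T : measurableType dT}.
Variable P : probability T R.
Implicit Types f g : T -> R.

Lemma Lfun_measurable p f : f \in Lfun P p -> measurable_fun setT f.
Proof. by rewrite inE => /andP[/[!inE]]. Qed.

Lemma Lfun_sum p I (s : seq I) (F : I -> T -> R) : (1 <= p)%E -> (forall i, F i \in Lfun P p) ->
  (fun w => \sum_(i <- s) F i w) \in Lfun P p.
Proof. by move=> le1p LF; rewrite -fct_sumE; apply: rpred_sum. Qed.

Lemma Lfun1_le f g : measurable_fun setT f -> g \in Lfun P 1 ->
  (forall w, `|f w| <= `|g w|) -> f \in Lfun P 1.
Proof.
move=> mf /Lfun1_integrable ig fg; apply/Lfun1_integrable; apply: le_integrable ig => //.
  exact/measurable_EFinP.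
by move=> w _ /=; rewrite lee_fin.
Qed.

Lemma Lfun2P f : f \in Lfun P 2%:E <->
  measurable_fun setT f /\ P.-integrable setT (fun w => (f w ^+ 2)%:E).
Proof.
split=> [Lf|[mf /integrableP[_ f2_lty]]].
  by split; [exact: Lfun_measurable Lf|exact: Lfun2_integrable_sqr].
rewrite inE; apply/andP; split; rewrite inE//=.
rewrite /finite_norm unlock poweR_lty//; apply: le_lt_trans f2_lty.
under [leLHS]eq_integral do rewrite /= powR_mulrn ?normr_ge0// -normrX.
by [].
Qed.

Lemma Lfun2_Lfun1 f : f \in Lfun P 2%:E -> f \in Lfun P 1.
Proof. by apply: Lfun_subset12; exact: fin_num_measure. Qed.

Lemma Lfun2_sqr f : f \in Lfun P 2%:E -> (fun w => f w ^+ 2) \in Lfun P 1.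
Proof. by move=> Lf; apply/Lfun1_integrable; exact: Lfun2_integrable_sqr. Qed.

Lemma bounded_mfun_Lfun1 f : bounded_mfun f -> f \in Lfun P 1.
Proof.
move=> [mf [M fM]]; apply: (Lfun1_le mf (Lfun_cst P M 1)) => w.
by rewrite (le_trans (fM w))// ler_norm.
Qed.

Lemma bounded_mfunM_Lfun1 f g : bounded_mfun f -> g \in Lfun P 1 ->
  (fun w => f w * g w) \in Lfun P 1.
Proof.
move=> [mf [M fM]] Lg; apply: (Lfun1_le _ (rpredZ M (Lfun_norm Lg))) => //.
  by apply: measurable_funM => //; exact: Lfun_measurable Lg.
by move=> w; rewrite /= !normrM normr_id ler_pM// (le_trans (fM w))// ler_norm.
Qed.

Lemma bounded_mfunM_Lfun2 f g : bounded_mfun f -> g \in Lfun P 2%:E ->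
  (fun w => f w * g w) \in Lfun P 2%:E.
Proof.
move=> bf Lg; apply/Lfun2P; split.
  by apply: measurable_funM; [case: bf|exact: Lfun_measurable Lg].
have /Lfun1_integrable := bounded_mfunM_Lfun1 (bounded_mfunX 2 bf) (Lfun2_sqr Lg).
by apply: eq_integrable => // w _ /=; rewrite exprMn.
Qed.

End Lfun.

Section Expectation.
Context {R : realType} {dT : measure_display} {T : measurableType dT}.
Variable P : probability T R.
Implicit Types f g : T -> R.

Lemma EFin_Expe f : f \in Lfun P 1 -> (Expe P f)%:E = (\int[P]_w (f w)%:E)%E.
Proof. by move=> Lf; rewrite fineK// integrable_fin_num//; exact/Lfun1_integrable. Qed.

Lemma eq_Expe f g : f =1 g -> Expe P f = Expe P g.
Proof. by move=> /funext ->. Qed.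

Lemma Expe_cst c : Expe P (fun=> c) = c.
Proof. by rewrite /Expe integral_cst//= probability_setT mule1. Qed.

Lemma ExpeD f g : f \in Lfun P 1 -> g \in Lfun P 1 ->
  Expe P (fun w => f w + g w) = Expe P f + Expe P g.
Proof. by move=> /Lfun1_integrable ? /Lfun1_integrable ?; exact: RintegralD. Qed.

Lemma ExpeB f g : f \in Lfun P 1 -> g \in Lfun P 1 ->
  Expe P (fun w => f w - g w) = Expe P f - Expe P g.
Proof. by move=> /Lfun1_integrable ? /Lfun1_integrable ?; exact: RintegralB. Qed.

Lemma ExpeZ c f : f \in Lfun P 1 -> Expe P (fun w => c * f w) = c * Expe P f.
Proof. by move=> /Lfun1_integrable ?; exact: RintegralZl. Qed.

Lemma Expe_sum I (s : seq I) (F : I -> T -> R) : (forall i, F i \in Lfun P 1) ->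
  Expe P (fun w => \sum_(i <- s) F i w) = \sum_(i <- s) Expe P (F i).
Proof.
move=> LF; elim: s => [|i s IHs].
  by rewrite big_nil -[RHS](Expe_cst 0); apply: eq_Expe => w; rewrite big_nil.
rewrite big_cons -IHs -ExpeD//; last exact: Lfun_sum.
by apply: eq_Expe => w; rewrite big_cons.
Qed.

Lemma Expe_ge0 f : (forall w, 0 <= f w) -> 0 <= Expe P f.
Proof. by move=> f_ge0; exact: Rintegral_ge0. Qed.

Lemma Expe_horner2 (p q : {poly R}) f g m n : bounded_mfun f -> bounded_mfun g ->
  (size p <= m)%N -> (size q <= n)%N ->
  Expe P (fun w => p.[f w] * q.[g w]) =
  \sum_(k < n) q`_k * \sum_(i < m) p`_i * Expe P (fun w => f w ^+ i * g w ^+ k).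
Proof.
move=> bf bg le_pm le_qn.
have Lfg i k : (fun w => f w ^+ i * g w ^+ k) \in Lfun P 1.
  by apply: bounded_mfun_Lfun1; apply: bounded_mfunM; exact: bounded_mfunX.
have Lsum k : (fun w => \sum_(i < m) p`_i * (f w ^+ i * g w ^+ k)) \in Lfun P 1.
  by apply: Lfun_sum => // i; apply: rpredZ.
transitivity (Expe P (fun w => \sum_(k < n) q`_k * \sum_(i < m) p`_i * (f w ^+ i * g w ^+ k))).
  apply: eq_Expe => w; rewrite (horner_coef_wide _ le_pm) (horner_coef_wide _ le_qn).
  rewrite mulrC mulr_suml; apply: eq_bigr => k _; rewrite -mulrA; congr (_ * _).
  by rewrite mulr_sumr; apply: eq_bigr => i _; ring.
rewrite Expe_sum => [|k]; last by apply: rpredZ.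
apply: eq_bigr => k _; rewrite ExpeZ//; congr (_ * _).
rewrite Expe_sum => [|i]; last by apply: rpredZ.
by apply: eq_bigr => i _; rewrite ExpeZ.
Qed.

Lemma Expe_distribution d' (T' : measurableType d') (X : {RV P >-> T'}) (f : T' -> R) :
  bounded_mfun f -> Expe (distribution P X) f = Expe P (f \o X).
Proof.
move=> bf; have mf : measurable_fun setT (EFin \o f) by apply/measurable_EFinP; case: bf.
rewrite /Expe (integral_distribution mf)//.
by apply/Lfun1_integrable/bounded_mfun_Lfun1; exact: bounded_mfun_comp.
Qed.

Lemma Expe_same_law d' (T' : measurableType d') (X Y : {RV P >-> T'}) (f : T' -> R) :
  (forall B, measurable B -> P (X @^-1` B) = P (Y @^-1` B)) ->
  bounded_mfun f -> Expe P (f \o X) = Expe P (f \o Y).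
Proof.
move=> lawXY bf; rewrite -!Expe_distribution//; congr fine.
by apply: eq_measure_integral => A mA _; exact: lawXY.
Qed.

End Expectation.

Section Independence.
Context {R : realType} {dT : measure_display} {T : measurableType dT}.
Variable P : probability T R.

Definition indep_fun (f g : T -> R) := forall A B, measurable A -> measurable B ->
  P (f @^-1` A `&` g @^-1` B) = (P (f @^-1` A) * P (g @^-1` B))%E.

Definition rv_pair (X Y : {RV P >-> R}) : {RV P >-> (R * R)%type} :=
  mfun_Sub (mem_set (measurable_fun_pair (measurable_funPT X) (measurable_funPT Y))).

Lemma indep_distribution_pair (X Y : {RV P >-> R}) A : indep_fun X Y -> measurable A ->
  distribution P (rv_pair X Y) A = (distribution P X \x distribution P Y)%E A.
Proof.
move=> indepXY mA; apply/esym.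
exact: (@product_measure_unique _ _ _ _ R (distribution P X) (distribution P Y)
  (distribution P (rv_pair X Y)) indepXY).
Qed.

Lemma indep_integral_pair (X Y : {RV P >-> R}) (m : R * R -> \bar R) : indep_fun X Y ->
  measurable_fun setT m -> (forall z, 0 <= m z)%E ->
  (\int[P]_w m (X w, Y w) = \int[P]_w \int[P]_w' m (X w, Y w'))%E.
Proof.
move=> indepXY mm m_ge0; rewrite -(ge0_integral_distribution (rv_pair X Y) mm m_ge0).
transitivity (\int[distribution P X \x distribution P Y]_z m z)%E.
  by apply: eq_measure_integral => A mA _; exact: indep_distribution_pair.
rewrite fubini_tonelli1// ge0_integral_distribution//.
- apply: eq_integral => w _; rewrite /= /fubini_F.
  rewrite (@ge0_integral_distribution _ _ _ _ _ P Y (fun y => m (X w, y)))//.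
  exact: measurableT_comp mm (pair1_measurable _).
- exact: measurable_fun_fubini_tonelli_F.
- by move=> x; exact: integral_ge0.
Qed.

Section Product.
Variables f g : T -> R.
Hypotheses (Lf : f \in Lfun P 1) (Lg : g \in Lfun P 1) (indep_fg : indep_fun f g).

Let X : {RV P >-> R} := mfun_Sub (mem_set (Lfun_measurable Lf)).
Let Y : {RV P >-> R} := mfun_Sub (mem_set (Lfun_measurable Lg)).

Let measurable_mul : measurable_fun setT (fun z : R * R => (z.1 * z.2)%:E).
Proof.
by apply/measurable_EFinP; exact: measurable_funM.
Qed.

Lemma indep_mul_Lfun1 : (fun w => f w * g w) \in Lfun P 1.
Proof.
apply/Lfun1_integrable/integrableP; split.
  apply/measurable_EFinP; apply: measurable_funM.
    exact: Lfun_measurable Lf.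
  exact: Lfun_measurable Lg.
have absm : measurable_fun setT (fun z : R * R => `|(z.1 * z.2)%:E|%E).
  exact: measurableT_comp.
rewrite (@indep_integral_pair X Y _ indep_fg absm (fun=> abse_ge0 _)).
have normL1 h : h \in Lfun P 1 -> (\int[P]_w `|h w|%:E = (Expe P (fun w => `|h w|))%:E)%E.
  by move=> /Lfun_norm Lh; rewrite EFin_Expe.
rewrite (_ : integral _ _ _ = (Expe P (fun w => `|f w|) * Expe P (fun w => `|g w|))%:E) ?ltry//.
transitivity (\int[P]_w ((Expe P (fun w => `|g w|))%:E * `|f w|%:E))%E.
  apply: eq_integral => w _; rewrite muleC -normL1// -ge0_integralZl_EFin//.
    by apply: eq_integral => w' _; rewrite /= normrM.
  by apply/measurable_EFinP; apply: measurableT_comp => //; exact: Lfun_measurable Lg.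
rewrite ge0_integralZl_EFin//; first by rewrite normL1// -EFinM mulrC.
  by apply/measurable_EFinP; apply: measurableT_comp => //; exact: Lfun_measurable Lf.
by apply: Expe_ge0.
Qed.

Lemma Expe_indep_mul : Expe P (fun w => f w * g w) = Expe P f * Expe P g.
Proof.
have /Lfun1_integrable intf := Lf; have /Lfun1_integrable intg := Lg.
have /Lfun1_integrable intfg := indep_mul_Lfun1.
have mid : measurable_fun setT (@EFin R) by exact/measurable_EFinP.
have int_idY : (distribution P Y).-integrable setT (@EFin R).
  exact: (@integrable_pushforward _ _ _ _ _ Y (measurable_funPT Y) P setT (@EFin R) mid intg).
have int_idX : (distribution P X).-integrable setT (@EFin R).
  exact: (@integrable_pushforward _ _ _ _ _ X (measurable_funPT X) P setT (@EFin R) mid intf).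
have prodE h : (\int[distribution P X \x distribution P Y]_z h z =
    \int[distribution P (rv_pair X Y)]_z h z)%E.
  by apply: eq_measure_integral => A mA _; apply/esym; exact: indep_distribution_pair.
have int_prod : (distribution P X \x distribution P Y)%E.-integrable setT
    (fun z : R * R => (z.1 * z.2)%:E).
  have /integrableP[_ pair_lty] := @integrable_pushforward _ _ _ _ _ (rv_pair X Y)
    (measurable_funPT _) P setT _ measurable_mul intfg measurableT.
  by apply/integrableP; split; rewrite ?prodE.
apply: EFin_inj; rewrite EFinM EFin_Expe; last exact: indep_mul_Lfun1.
rewrite -(integral_distribution (X := rv_pair X Y) measurable_mul)// -prodE.
rewrite -integral12_prod_meas1//.
transitivity (\int[distribution P X]_x ((Expe P g)%:E * x%:E))%E.
  apply: eq_integral => x _; rewrite /fubini_F /=.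
  under eq_integral do rewrite EFinM.
  rewrite integralZl ?int_idY// (integral_distribution (X := Y) mid)// muleC.
  by rewrite -(EFin_Expe Lg).
rewrite integralZl ?int_idX// (integral_distribution (X := X) mid)// muleC.
by rewrite -(EFin_Expe Lf).
Qed.

End Product.
End Independence.

Section SquareIntegrable.
Context {R : realType} {dT : measure_display} {T : measurableType dT}.
Variable P : probability T R.
Implicit Types f g : T -> R.

Definition norm2 f : R := Expe P (fun w => f w ^+ 2).

Lemma norm2_ge0 f : 0 <= norm2 f.
Proof. by apply: Expe_ge0 => w; exact: sqr_ge0. Qed.

Lemma integral_norm2 f : f \in Lfun P 2%:E -> (\int[P]_w ((f w) ^+ 2)%:E)%E = (norm2 f)%:E.
Proof. by move=> Lf; rewrite /norm2 EFin_Expe//; exact: Lfun2_sqr. Qed.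

Lemma Lnorm2E f : f \in Lfun P 2%:E -> 'N[P]_2%:E[EFin \o f]%E = (Num.sqrt (norm2 f))%:E.
Proof.
move=> Lf; rewrite unlock /Lnorm (_ : integral _ _ _ = (norm2 f)%:E).
  by rewrite /= powR12_sqrt// norm2_ge0.
rewrite -integral_norm2//; apply: eq_integral => w _ /=.
by rewrite powR_mulrn ?normr_ge0// real_normK// num_real.
Qed.

Lemma cauchy_schwarz f g : f \in Lfun P 2%:E -> g \in Lfun P 2%:E ->
  Expe P (fun w => f w * g w) ^+ 2 <= norm2 f * norm2 g.
Proof.
move=> Lf Lg; have Lfg := Lfun2_mul_Lfun1 Lf Lg.
have half2 : 2^-1 + 2^-1 = 1 :> R by rewrite [RHS]splitr !div1r.
have := hoelder P (Lfun_measurable Lf) (Lfun_measurable Lg) (ltr0Sn R 1) (ltr0Sn R 1) half2.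
rewrite Lnorm1 !Lnorm2E// -(EFin_Expe (Lfun_norm Lfg)) -EFinM lee_fin -sqrtrM ?norm2_ge0//.
move=> normfg_le; rewrite -real_normK ?num_real// -[leRHS]sqr_sqrtr ?mulr_ge0 ?norm2_ge0//.
rewrite ler_pXn2r ?nnegrE ?sqrtr_ge0 ?normr_ge0//; apply: le_trans normfg_le.
by apply: le_normr_Rintegral => //; exact/Lfun1_integrable.
Qed.

Lemma cvg0_sqr_le (u v : nat -> R) : (forall n, u n ^+ 2 <= v n) ->
  v @ \oo --> (0 : R) -> u @ \oo --> (0 : R).
Proof.
move=> le_uv v0; apply/norm_cvg0P.
apply: (@squeeze_cvgr _ _ _ _ (cst 0) (Num.sqrt \o v)).
- by apply: nearW => n; rewrite normr_ge0/= -sqrtr_sqr ler_wsqrtr.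
- exact: cvg_cst.
- by rewrite -(sqrtr0 R); apply: continuous_cvg => //; exact: sqrt_continuous.
Qed.

Lemma cvg_Expe_mul (f g : nat -> T -> R) f' g' :
  (forall n, f n \in Lfun P 2%:E) -> (forall n, g n \in Lfun P 2%:E) ->
  f' \in Lfun P 2%:E -> g' \in Lfun P 2%:E ->
  norm2 (fun w => f n w - f' w) @[n --> \oo] --> (0 : R) ->
  norm2 (fun w => g n w - g' w) @[n --> \oo] --> (0 : R) ->
  Expe P (fun w => f n w * g n w) @[n --> \oo] --> Expe P (fun w => f' w * g' w).
Proof.
move=> Lf Lg Lf' Lg' cvgf cvgg.
have LfB n : (fun w => f n w - f' w) \in Lfun P 2%:E by apply: rpredB.
have LgB n : (fun w => g n w - g' w) \in Lfun P 2%:E by apply: rpredB.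
have cvgBB : Expe P (fun w => (f n w - f' w) * (g n w - g' w)) @[n --> \oo] --> (0 : R).
  apply: cvg0_sqr_le (fun n => cauchy_schwarz (LfB n) (LgB n)) _.
  by have := cvgM cvgf cvgg; rewrite mulr0; apply.
have cvgBl : Expe P (fun w => (f n w - f' w) * g' w) @[n --> \oo] --> (0 : R).
  apply: cvg0_sqr_le (fun n => cauchy_schwarz (LfB n) Lg') _.
  by have := cvgM cvgf (cvg_cst (norm2 g')); rewrite mul0r; apply.
have cvgBr : Expe P (fun w => f' w * (g n w - g' w)) @[n --> \oo] --> (0 : R).
  apply: cvg0_sqr_le (fun n => cauchy_schwarz Lf' (LgB n)) _.
  by have := cvgM (cvg_cst (norm2 f')) cvgg; rewrite mulr0; apply.
rewrite -[X in _ --> X]add0r -[X in _ --> X + _]add0r -[X in _ --> X + _ + _]add0r.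
under eq_fun => n.
  rewrite (_ : Expe P _ = Expe P (fun w => (f n w - f' w) * (g n w - g' w)) +
    Expe P (fun w => (f n w - f' w) * g' w) + Expe P (fun w => f' w * (g n w - g' w)) +
    Expe P (fun w => f' w * g' w)).
    over.
  rewrite -!ExpeD; do ?[exact: Lfun2_mul_Lfun1 | apply: rpredD => //].
  by apply: eq_Expe => w; ring.
by apply: cvgD (cvg_cst _); apply: cvgD => //; apply: cvgD.
Qed.

(* The increments are summable almost everywhere, since their integrals are. *)
Lemma summable_increments_cvg_ae (g : nat -> T -> R) :
  (forall i, measurable_fun setT (g i)) ->
  (\sum_(0 <= i <oo) \int[P]_w `|g i.+1 w - g i w|%:E < +oo)%E ->
  {ae P, forall w, cvgn (g ^~ w)}.
Proof.
move=> mg sum_lty; pose H w := (\sum_(0 <= i <oo) `|g i.+1 w - g i w|%:E)%E.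
have inc_ge0 i w : (0 <= `|g i.+1 w - g i w|%:E)%E by rewrite lee_fin.
have minc i : measurable_fun setT (fun w => `|g i.+1 w - g i w|%:E).
  by apply/measurable_EFinP; apply: measurableT_comp => //; exact: measurable_funB.
have intH : P.-integrable setT H.
  apply/integrableP; split.
    by apply: (@ge0_emeasurable_sum _ _ _ _ _ xpredT).
  under eq_integral => w _ do rewrite gee0_abs ?nneseries_ge0//.
  by rewrite integral_nneseries.
have := integrable_ae measurableT intH; apply: filterS => w /(_ Logic.I) Hw_fin.
have : cvgn (series (telescope (g ^~ w))).
  apply: normed_cvg; apply: nondecreasing_is_cvgn.
    by apply/nondecreasing_seqP => n /=; rewrite [leRHS]seriesSr lerDl normr_ge0.
  exists (fine (H w)) => _ [n _ <-]; rewrite -lee_fin fineK// /series /= -sumEFin.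
  by apply: nneseries_lim_ge => *; exact: inc_ge0.
rewrite telescopeK => cvgB.
have -> : g ^~ w = (fun n => (g n w - g 0 w) + g 0 w) by apply/funext => n; rewrite subrK.
exact: is_cvgD cvgB (is_cvg_cst _).
Qed.

Lemma ae_cvgn_measurable_limit (g : nat -> T -> R) : (forall i, measurable_fun setT (g i)) ->
  {ae P, forall w, cvgn (g ^~ w)} ->
  exists2 l : T -> R, measurable_fun setT l & {ae P, forall w, g i w @[i --> \oo] --> l w}.
Proof.
move=> mg cvgg; exists (fun w => fine (limn_esup (fun i => (g i w)%:E))).
  apply: measurableT_comp => //.
  by apply: measurable_fun_limn_esup => i; exact/measurable_EFinP.
apply: filterS cvgg => w cvgw; set l := limn (g ^~ w) in cvgw.
have cvgE : (g i w)%:E @[i --> \oo] --> l%:E by apply: cvg_EFin; [exact: nearW|].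
by rewrite (cvg_limn_einf_sup cvgE).2.
Qed.

Lemma fatou_norm2 (g : nat -> T -> R) f (l : T -> R) (e : R) :
  (forall i, g i \in Lfun P 2%:E) -> f \in Lfun P 2%:E -> measurable_fun setT l ->
  {ae P, forall w, g i w @[i --> \oo] --> l w} ->
  (\forall i \near \oo, norm2 (fun w => f w - g i w) <= e) ->
  (fun w => f w - l w) \in Lfun P 2%:E /\ norm2 (fun w => f w - l w) <= e.
Proof.
move=> Lg Lf ml cvgg [N _ le_e].
have mfl : measurable_fun setT (fun w => ((f w - l w) ^+ 2)%:E).
  apply/measurable_EFinP; apply: measurable_funX; apply: measurable_funB => //.
  exact: Lfun_measurable Lf.
pose u i w := ((f w - g (i + N)%N w) ^+ 2)%:E.
have LfB i : (fun w => f w - g i w) \in Lfun P 2%:E by apply: rpredB.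
have mu i : measurable_fun setT (u i).
  by apply/measurable_EFinP; apply: measurable_funX; exact: Lfun_measurable (LfB _).
have int_le : (\int[P]_w ((f w - l w) ^+ 2)%:E <= e%:E)%E.
  rewrite (@ae_eq_integral _ _ _ _ _ (fun w => limn_einf (u ^~ w)))//; last first.
  - apply: filterS cvgg => w cvgw _; apply/esym.
    have cvgu : u ^~ w @ \oo --> ((f w - l w) ^+ 2)%:E.
      have cvgB : f w - g (i + N)%N w @[i --> \oo] --> f w - l w.
        by apply: cvgB; [exact: cvg_cst|move: cvgw; rewrite -(cvg_shiftn N)].
      by apply: cvg_EFin; [exact: nearW|exact: (cvgM cvgB cvgB)].
    by rewrite (cvg_limn_einf_sup cvgu).1.
  - apply: measurableT_comp => //.
    by apply: measurable_fun_limn_esup => i; exact: measurableT_comp.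
  apply: le_trans (fatou P measurableT mu _) _; first by move=> i w _; rewrite lee_fin sqr_ge0.
  rewrite limn_einf_lim; apply: lime_le; first exact: is_cvg_einfs.
  apply: nearW => n; apply: (@le_trans _ _ (\int[P]_w u n w)%E).
    by apply: ereal_inf_lbound; exists n => /=.
  by rewrite integral_norm2// lee_fin le_e//= leq_addl.
have Lfl : (fun w => f w - l w) \in Lfun P 2%:E.
  apply/Lfun2P; split; first by apply: measurable_funB => //; exact: Lfun_measurable Lf.
  apply/integrableP; split => //.
  under eq_integral => w _ do rewrite gee0_abs ?lee_fin ?sqr_ge0//.
  exact: le_lt_trans int_le (ltry _).
by split=> //; rewrite -lee_fin -integral_norm2.
Qed.

Lemma Expe_norm_le f (c : R) : 0 <= c -> f \in Lfun P 2%:E -> norm2 f <= c ^+ 2 ->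
  Expe P (fun w => `|f w|) <= c.
Proof.
move=> c_ge0 Lf le_c2; have LN : (fun w => `|f w|) \in Lfun P 2%:E.
  apply/Lfun2P; split; first by apply: measurableT_comp => //; exact: Lfun_measurable Lf.
  have /Lfun1_integrable := Lfun2_sqr Lf.
  by apply: eq_integrable => // w _ /=; rewrite real_normK ?num_real.
have := cauchy_schwarz LN (Lfun_cst P 1 2).
rewrite (eq_Expe P (fun w => mulr1 `|f w|)).
have -> : norm2 (cst 1) = 1.
  by rewrite /norm2 -[RHS](Expe_cst P 1); apply: eq_Expe => w; rewrite expr1n.
have -> : norm2 (fun w => `|f w|) = norm2 f by apply: eq_Expe => w; rewrite real_normK ?num_real.
rewrite mulr1 => /le_trans/(_ le_c2); rewrite ler_sqr// nnegrE.
by apply: Expe_ge0.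
Qed.

Lemma fast_subsequence (e : nat -> R) : e @ \oo --> (0 : R) ->
  exists k : nat -> nat, [/\ {homo k : i j / (i <= j)%N}, (forall i, i <= k i)%N
    & forall i, e (k i) <= (2 ^+ i)^-1 ^+ 2].
Proof.
move=> cvge.
have /choice[rank rankP] : forall i, exists r, forall m, (r <= m)%N -> e m <= (2 ^+ i)^-1 ^+ 2.
  move=> i; have d_gt0 : 0 < (2 ^+ i : R)^-1 ^+ 2 by rewrite exprn_gt0// invr_gt0 exprn_gt0.
  move/cvgr0Pnorm_le : cvge => /(_ _ d_gt0)[r _ rP]; exists r => m le_rm.
  exact: le_trans (ler_norm _) (rP m le_rm).
pose k i := (\sum_(j < i.+1) (rank j).+1)%N.
have kS i : k i.+1 = (k i + (rank i.+1).+1)%N by rewrite /k (big_ord_recr i.+1).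
exists k; split.
- by apply: homo_leq => [//|i j l|i]; [exact: leq_trans|rewrite kS leq_addr].
- elim=> [//|i IHi]; rewrite kS addnS ltnS; exact: leq_trans IHi (leq_addr _ _).
- move=> i; apply: rankP; rewrite /k big_ord_recr /=.
  exact: leq_trans (leqnSn _) (leq_addl _ _).
Qed.

Lemma Lfun2_complete (f : nat -> T -> R) (e : nat -> R) :
  (forall n, f n \in Lfun P 2%:E) -> e @ \oo --> (0 : R) ->
  (forall m n, (m <= n)%N -> norm2 (fun w => f m w - f n w) <= e m) ->
  exists2 g, g \in Lfun P 2%:E & norm2 (fun w => f n w - g w) @[n --> \oo] --> (0 : R).
Proof.
move=> Lf cvge cauchy; have [k [k_homo k_ge k_fast]] := fast_subsequence cvge.
have Lsub i : f (k i) \in Lfun P 2%:E by exact: Lf.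
have mf i : measurable_fun setT (f (k i)) by exact: Lfun_measurable (Lf _).
have LfB m n : (fun w => f m w - f n w) \in Lfun P 2%:E by apply: rpredB.
have increments i : (\int[P]_w `|f (k i.+1) w - f (k i) w|%:E <= (2 / (2 ^ i.+1)%:R)%:E)%E.
  rewrite -EFin_Expe ?Lfun_norm//; last by apply: Lfun2_Lfun1.
  rewrite lee_fin natrX exprS invfM mulrA mulfV// mul1r.
  apply: Expe_norm_le => //; apply: le_trans (k_fast i).
  apply: le_trans (cauchy _ _ (k_homo _ _ (leqnSn i))).
  by rewrite le_eqVlt; apply/orP; left; apply/eqP/eq_Expe => w; rewrite -sqrrN opprB.
have /(ae_cvgn_measurable_limit mf)[l ml cvgl] : {ae P, forall w, cvgn (fun i => f (k i) w)}.
  apply: summable_increments_cvg_ae => //.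
  apply: le_lt_trans (ltry 2); apply: le_trans (epsilon_trick0 xpredT _) => //.
  by apply: lee_nneseries => // i _ _; apply: integral_ge0 => w _; rewrite lee_fin.
have near_le m : \forall i \near \oo, norm2 (fun w => f m w - f (k i) w) <= e m.
  by exists m => // i /= le_mi; apply: cauchy; exact: leq_trans le_mi (k_ge i).
have fatou_l m := fatou_norm2 Lsub (Lf m) ml cvgl (near_le m).
exists l.
  have -> : l = (fun w => f 0 w - (f 0 w - l w)) by apply/funext => w; rewrite opprB addrC subrK.
  by apply: rpredB (fatou_l 0).1.
apply: (squeeze_cvgr _ (cvg_cst 0) cvge); apply: nearW => m.
by rewrite norm2_ge0 (fatou_l m).2.
Qed.

End SquareIntegrable.

(** * Moments of isotropic coordinates *)

Lemma eq_horner_poly (R : numDomainType) (p q : {poly R}) : (forall y, p.[y] = q.[y]) -> p = q.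
Proof.
move=> pq; apply/eqP; rewrite -subr_eq0; apply/eqP.
apply: (@roots_geq_poly_eq0 _ _ [seq (i%:R : R) | i <- iota 0 (size (p - q))]).
- by apply/allP => x _; rewrite rootE hornerD hornerN pq subrr.
- by rewrite map_inj_uniq ?iota_uniq// => i j /eqP; rewrite eqr_nat => /eqP.
- by rewrite size_map size_iota.
Qed.

Lemma coef_sum_scaleXdouble (R : nzRingType) (a : nat -> R) n j : (j < n)%N ->
  (\sum_(k < n) a k *: 'X^(k.*2))`_(j.*2) = a j.
Proof.
move=> lt_jn; rewrite coef_sum (bigD1 (Ordinal lt_jn))//= coefZ coefXn eqxx mulr1 big1 ?addr0//.
move=> k; rewrite -val_eqE /= coefZ coefXn (inj_eq double_inj) eq_sym => /negbTE ->.
by rewrite mulr0.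
Qed.

Lemma sum_double (V : nmodType) (f : nat -> V) n :
  \sum_(c < n.*2) f c = \sum_(l < n) (f l.*2 + f l.*2.+1).
Proof.
elim: n => [|n IHn]; first by rewrite !big_ord0.
by rewrite doubleS !big_ord_recr /= IHn addrA.
Qed.

Lemma sum_even (V : nmodType) (f : nat -> V) k :
  (forall c, odd c -> f c = 0) -> (forall c, (k < c)%N -> f c = 0) ->
  \sum_(c < k.+1) f c = \sum_(l < k.+1) f l.*2.
Proof.
move=> f_odd f_gt.
transitivity (\sum_(c < k.+1.*2) f c).
  rewrite (big_ord_widen k.+1.*2 f) ?big_mkcond; last by rewrite -addnn leq_addr.
  by apply: eq_bigr => c _; case: ltnP => // /f_gt ->.
by rewrite sum_double; apply: eq_bigr => l _; rewrite (f_odd l.*2.+1) ?addr0//= odd_double.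
Qed.

Section TrinomialRearrangement.
Variable R : numFieldType.
Implicit Types a b c : R.

Lemma rising_half l : 4 ^+ l * rising (2^-1 : R) l * l`!%:R = (l.*2)`!%:R.
Proof.
elim: l => [|l IHl]; first by rewrite rising0 !mulr1.
by rewrite doubleS !factS !natrM -IHl risingSr exprS -!natr1 -muln2 natrM; field.
Qed.

Lemma trinomial_coef k j l : (l <= j)%N ->
  ('C(k, l.*2) * 'C(k - l.*2, j - l) * (l.*2)`! = 'C(k, j) * 'C(j, l) * (k - j) ^_ l * l`!)%N.
Proof.
move=> le_lj; have [le_jlk|lt_kjl] := leqP (j + l) k; last first.
  have -> : ('C(k, j) * 'C(j, l) * (k - j) ^_ l * l`! = 0)%N.
    have [le_jk|lt_kj] := leqP j k; last by rewrite bin_small.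
    by rewrite ffact_small ?muln0//; lia.
  have [le_2lk|lt_k2l] := leqP l.*2 k; last by rewrite bin_small.
  by rewrite ['C(k - _, _)]bin_small ?muln0 ?mul0n//; lia.
have fact2l : ('C(k, l.*2) * ((l.*2)`! * (k - l.*2)`!) = k`!)%N by apply: bin_fact; lia.
have factjl : ('C(k - l.*2, j - l) * ((j - l)`! * (k - j - l)`!) = (k - l.*2)`!)%N.
  have -> : (k - j - l = k - l.*2 - (j - l))%N by lia.
  by apply: bin_fact; lia.
have factj : ('C(k, j) * (j`! * (k - j)`!) = k`!)%N by apply: bin_fact; lia.
have factl : ('C(j, l) * (l`! * (j - l)`!) = j`!)%N by apply: bin_fact.
have ffactl : ((k - j) ^_ l * (k - j - l)`! = (k - j)`!)%N by apply: ffact_fact; lia.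
apply/eqP; rewrite -(eqn_pmul2r (fact_gt0 (j - l))) -(eqn_pmul2r (fact_gt0 (k - j - l))).
by apply/eqP; transitivity k`!; [rewrite -fact2l -factjl|rewrite -factj -factl -ffactl]; ring.
Qed.

Lemma binomial_shift a b k l : (l.*2 <= k)%N -> (a * b) ^+ l * (a + b) ^+ (k - l.*2) =
  \sum_(j < k.+1) (if (l <= j)%N then 'C(k - l.*2, j - l)%:R else 0) * (a ^+ (k - j) * b ^+ j).
Proof.
move=> le_2lk.
rewrite -(big_mkord xpredT (fun j => (if (l <= j)%N then 'C(k - l.*2, j - l)%:R else 0) *
  (a ^+ (k - j) * b ^+ j))) (@big_cat_nat _ _ _ l)//=; last by lia.
rewrite big_nat big1 ?add0r => [|j /andP[_ lt_jl]]; last by rewrite leqNgt lt_jl mul0r.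
rewrite -[X in index_iota X]add0n big_addn big_mkord exprDn mulr_sumr.
rewrite (big_ord_widen (k.+1 - l) (fun i => (a * b) ^+ l *
  (a ^+ (k - l.*2 - i) * b ^+ i *+ 'C(k - l.*2, i)))); last by lia.
rewrite big_mkcond; apply: eq_bigr => i _; rewrite leq_addl addnK.
case: ltnP => [lt_i|ge_i]; last by rewrite bin_small// mul0r.
have -> : (k - (i + l) = l + (k - l.*2 - i))%N by lia.
by rewrite -mulr_natl exprMn [b ^+ (i + l)]exprD [a ^+ (l + _)]exprD; ring.
Qed.

Lemma trinomial_rearrangement (B : R) a b k : 0 < B ->
  \sum_(l < k.+1) 'C(k, l.*2)%:R * 4 ^+ l * (rising 2^-1 l / rising B l) *
    ((a * b) ^+ l * (a + b) ^+ (k - l.*2)) =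
  \sum_(j < k.+1) 'C(k, j)%:R * (rising (B + (k - j)%:R) j / rising B j) *
    (a ^+ (k - j) * b ^+ j).
Proof.
move=> B_gt0; transitivity (\sum_(l < k.+1) \sum_(j < k.+1)
    'C(k, j)%:R * ('C(j, l)%:R * (falling (k - j)%:R l / rising B l)) * (a ^+ (k - j) * b ^+ j)).
  apply: eq_bigr => l _; have [le_2lk|lt_k2l] := leqP l.*2 k; last first.
    rewrite bin_small// !mul0r big1// => j _; rewrite falling_nat.
    have [le_lj|lt_jl] := leqP l j; last by rewrite ['C(j, l)]bin_small// !(mul0r, mulr0).
    by rewrite ffact_small ?(mul0r, mulr0)//; lia.
  rewrite binomial_shift// mulr_sumr; apply: eq_bigr => j _; rewrite [LHS]mulrA; congr (_ * _).
  case: (leqP l j) => [le_lj|lt_jl]; last first.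
    by rewrite ['C(j, l)]bin_small// !(mul0r, mulr0).
  have := trinomial_coef k le_lj => /(congr1 (fun n : nat => n%:R : R)).
  rewrite !natrM -rising_half falling_nat => tri.
  have tri' : 'C(k, l.*2)%:R * 'C(k - l.*2, j - l)%:R * (4 ^+ l * rising 2^-1 l) =
      'C(k, j)%:R * 'C(j, l)%:R * ((k - j) ^_ l)%:R :> R.
    by apply: (@mulIf R _ (natr_fact_neq0 R l)); rewrite -[RHS]tri; ring.
  transitivity ('C(k, l.*2)%:R * 'C(k - l.*2, j - l)%:R * (4 ^+ l * rising 2^-1 l) /
    rising B l : R); first by ring.
  by rewrite tri'; ring.
rewrite exchange_big /=; apply: eq_bigr => j _; have le_jk : (j <= k)%N by rewrite -ltnS.
rewrite -mulr_suml -mulr_sumr; congr (_ * _ * _).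
rewrite -chu_vandermonde mulr_suml (big_ord_widen k.+1 (fun l => 'C(j, l)%:R *
  (falling (k - j)%:R l * rising (B + l%:R) (j - l)) / rising B j))//.
rewrite [RHS]big_mkcond; apply: eq_bigr => l _; case: ltnP => [lt_lj|lt_jl].
  have le_lj : (l <= j)%N by rewrite -ltnS.
  have <- : rising B l * rising (B + l%:R) (j - l) = rising B j by rewrite -risingD subnKC.
  by field; rewrite !rising_neq0// ltr_wpDr.
by rewrite bin_small// mul0r.
Qed.

End TrinomialRearrangement.

Lemma sum_indicator (R : pzRingType) (I : finType) (i0 : I) (F : I -> R) :
  \sum_i (i == i0)%:R * F i = F i0.
Proof.
rewrite (bigD1 i0)//= eqxx mul1r big1 ?addr0// => i /negbTE ->.
by rewrite mul0r.
Qed.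

Section IsotropicCoordinates.
Context {R : realType} {dT : measure_display} {T : measurableType dT}.
Variables (P : probability T R) (I : finType) (i0 : I) (nvert : R).
(* In homogeneous coordinates [(u_0, ..., u_n)] of the random point, [p] and [q] are [|u_0|^2] and
   [|u_1|^2], the [zeta m] are the real components of [u_0 u_1^*], and [nvert] is [n]. *)
Variables (p q : T -> R) (zeta : I -> T -> R).
Local Notation z := (zeta i0).
Hypotheses (bp : bounded_mfun p) (bq : bounded_mfun q) (bzeta : forall m, bounded_mfun (zeta m)).
Hypothesis nvert_gt0 : 0 < nvert.
Hypothesis pqE : forall w, p w * q w = \sum_m zeta m w ^+ 2.
Hypothesis zeta_rot : forall (phi : R -> R -> R) (a : I -> R) l,
  bounded_mfun (fun w => phi (p w) (q w)) -> \sum_m a m ^+ 2 = 1 ->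
  Expe P (fun w => (\sum_m a m * zeta m w) ^+ l * phi (p w) (q w)) =
  Expe P (fun w => z w ^+ l * phi (p w) (q w)).
Hypothesis p_rot : forall (x y : R) k, x ^+ 2 + y ^+ 2 = 1 ->
  Expe P (fun w => (x ^+ 2 * p w + y ^+ 2 * q w + 2 * x * y * z w) ^+ k) =
  Expe P (fun w => p w ^+ k).
Hypothesis p_sum : forall k,
  Expe P (fun w => p w ^+ k) =
  Expe P (fun w => p w ^+ k.+1) + nvert * Expe P (fun w => p w ^+ k * q w).

Let B : R := #|I|%:R / 2.
Let card_gt0 : (0 < #|I|)%N. Proof. by apply/card_gt0P; exists i0. Qed.
Let B_gt0 : 0 < B. Proof. by rewrite divr_gt0// ltr0n. Qed.

Let Lbounded f : bounded_mfun f -> f \in Lfun P 1. Proof. exact: bounded_mfun_Lfun1. Qed.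

Lemma unit_circle_slope (y : R) : exists2 s : R, s != 0 &
  s ^+ 2 = 1 + y ^+ 2 /\ s^-1 ^+ 2 + (y / s) ^+ 2 = 1.
Proof.
have pos : 0 < 1 + y ^+ 2 by rewrite ltr_wpDr// sqr_ge0.
have sE : Num.sqrt (1 + y ^+ 2) ^+ 2 = 1 + y ^+ 2 by rewrite sqr_sqrtr// ltW.
exists (Num.sqrt (1 + y ^+ 2)); first by rewrite gt_eqF// sqrtr_gt0.
split=> //; rewrite exprMn exprVn sE -[X in X + _]mul1r -mulrDl mulfV//.
by rewrite gt_eqF.
Qed.

Section TestFunction.
Variable phi : R -> R -> R.
Local Notation phi_pq w := (phi (p w) (q w)).
Hypothesis bphi : bounded_mfun (fun w => phi_pq w).

Lemma Expe_zeta_odd l : odd l -> Expe P (fun w => z w ^+ l * phi_pq w) = 0.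
Proof.
move=> odd_l; pose a m : R := - (m == i0)%:R.
have a1 : \sum_m a m ^+ 2 = 1.
  by rewrite (bigD1 i0)//= /a eqxx sqrrN expr1n big1 ?addr0// => m /negbTE ->; rewrite oppr0 expr0n.
have := zeta_rot l bphi a1.
rewrite (eq_Expe P (g := fun w => (-1) * (z w ^+ l * phi_pq w))); last first.
  move=> w; under eq_bigr do rewrite /a mulNr.
  by rewrite sumrN sum_indicator exprNn -signr_odd odd_l expr1 -mulrA.
rewrite ExpeZ; first by move=> h; lra.
by apply: Lbounded; apply: bounded_mfunM => //; exact: bounded_mfunX.
Qed.

Lemma Expe_zeta_slope m (y : R) l : m != i0 ->
  Expe P (fun w => (z w + y * zeta m w) ^+ l.*2 * phi_pq w) =
  (1 + y ^+ 2) ^+ l * Expe P (fun w => z w ^+ l.*2 * phi_pq w).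
Proof.
move=> m0; have [s s_neq0 [sE circle]] := unit_circle_slope y.
pose a i : R := (i == i0)%:R * s^-1 + (i == m)%:R * (y / s).
have aE F : \sum_i a i * F i = s^-1 * F i0 + y / s * F m.
  under eq_bigr do rewrite mulrDl -!mulrA.
  by rewrite big_split /= !sum_indicator mulrA.
have a1 : \sum_i a i ^+ 2 = 1.
  rewrite -circle; under eq_bigr do rewrite expr2.
  by rewrite aE /a !eqxx eq_sym (negbTE m0) !mul1r !mul0r addr0 add0r -!expr2.
rewrite -(zeta_rot l.*2 bphi a1) -ExpeZ; last first.
  apply: Lbounded; apply: bounded_mfunM => //; apply: bounded_mfunX.
  by apply: bounded_mfun_sum => i; exact: bounded_mfunZ.
apply: eq_Expe => w; rewrite aE mulrA -sE -exprM mul2n -exprMn; congr (_ ^+ _ * _).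
by field.
Qed.

(* Compare the coefficients of [y ^+ 2] in [Expe_zeta_slope]. *)
Lemma Expe_zeta_mixed m l : m != i0 ->
  (2 * l%:R + 1) * Expe P (fun w => z w ^+ l.*2 * zeta m w ^+ 2 * phi_pq w) =
  Expe P (fun w => z w ^+ l.+1.*2 * phi_pq w).
Proof.
move=> m0; set M := l.+1.*2; set zM := Expe P (fun w => z w ^+ M * _).
have bterm k : bounded_mfun (fun w => z w ^+ (M - k) * zeta m w ^+ k * phi_pq w).
  by apply: bounded_mfunM => //; apply: bounded_mfunM; exact: bounded_mfunX.
pose c k := Expe P (fun w => z w ^+ (M - k) * zeta m w ^+ k * phi_pq w).
have : \sum_(k < M.+1) ('C(M, k)%:R * c k) *: 'X^k =
    \sum_(k < l.+2) ('C(l.+1, k)%:R * zM) *: 'X^(k.*2).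
  apply: eq_horner_poly => y; rewrite !horner_sum.
  transitivity (Expe P (fun w => (z w + y * zeta m w) ^+ M * phi_pq w)).
    transitivity (Expe P (fun w => \sum_(k < M.+1) ('C(M, k)%:R * y ^+ k) *
       (z w ^+ (M - k) * zeta m w ^+ k * phi_pq w))).
      rewrite Expe_sum => [|k]; last by apply: rpredZ; exact: Lbounded.
      by apply: eq_bigr => k _; rewrite hornerZ hornerXn ExpeZ ?Lbounded// mulrAC.
    apply: eq_Expe => w; rewrite exprDn mulr_suml.
    by apply: eq_bigr => k _; rewrite -mulr_natl exprMn; ring.
  rewrite Expe_zeta_slope// -/M -/zM exprDn mulr_suml; apply: eq_bigr => k _.
  by rewrite expr1n mul1r hornerZ hornerXn -mulr_natl -exprM mul2n; ring.
move=> /(congr1 (fun f : {poly R} => f`_(1.*2))).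
rewrite (coef_sum_scaleXdouble (fun k => 'C(l.+1, k)%:R * zM))//.
rewrite (coef_sum_scaleXn (fun k => 'C(M, k)%:R * c k))// bin1 bin2 => coef2.
have <- : c 2 = Expe P (fun w => z w ^+ l.*2 * zeta m w ^+ 2 * phi_pq w).
  by apply: eq_Expe => w; rewrite /M doubleS subSS subn1.
apply: (@mulfI _ l.+1%:R); first by rewrite pnatr_eq0.
rewrite -coef2 mulrA; congr (_ * _).
have -> : (M * M.-1)./2 = (l.+1 * (l.*2).+1)%N by rewrite /M doubleS /=; lia.
by rewrite natrM -[in RHS](natr1 l.*2) -mul2n natrM.
Qed.

Lemma Expe_zeta_step l :
  (B + l%:R) * Expe P (fun w => z w ^+ l.+1.*2 * phi_pq w) =
  (2^-1 + l%:R) * Expe P (fun w => z w ^+ l.*2 * (p w * q w * phi_pq w)).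
Proof.
have bterm m : bounded_mfun (fun w => z w ^+ l.*2 * zeta m w ^+ 2 * phi_pq w).
  by apply: bounded_mfunM => //; apply: bounded_mfunM; exact: bounded_mfunX.
have -> : Expe P (fun w => z w ^+ l.*2 * (p w * q w * phi_pq w)) =
    \sum_m Expe P (fun w => z w ^+ l.*2 * zeta m w ^+ 2 * phi_pq w).
  rewrite -Expe_sum => [|m]; last exact: Lbounded.
  by apply: eq_Expe => w; rewrite pqE mulr_suml mulr_sumr; apply: eq_bigr => m _; rewrite mulrA.
rewrite (bigD1 i0)//=.
have -> : Expe P (fun w => z w ^+ l.*2 * z w ^+ 2 * phi_pq w) =
    Expe P (fun w => z w ^+ l.+1.*2 * phi_pq w).
  by apply: eq_Expe => w; rewrite -exprD addn2.
have mixed_sum : (2 * l%:R + 1) *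
    \sum_(m | m != i0) Expe P (fun w => z w ^+ l.*2 * zeta m w ^+ 2 * phi_pq w) =
    #|I|.-1%:R * Expe P (fun w => z w ^+ l.+1.*2 * phi_pq w).
  rewrite mulr_sumr (eq_bigr _ (fun m m0 => Expe_zeta_mixed l m0)) sumr_const mulr_natl.
  by congr (_ *+ _); rewrite -(cardC1 i0); apply: eq_card.
have -> : 2^-1 + l%:R = (2 * l%:R + 1) / 2 :> R by field.
by rewrite mulrDr [(_ / 2) * \sum_(m | _) _]mulrAC mixed_sum /B -(prednK card_gt0) -natr1; field.
Qed.

End TestFunction.

Lemma Expe_zeta_even (phi : R -> R -> R) l : bounded_mfun (fun w => phi (p w) (q w)) ->
  Expe P (fun w => z w ^+ l.*2 * phi (p w) (q w)) =
  rising 2^-1 l / rising B l * Expe P (fun w => (p w * q w) ^+ l * phi (p w) (q w)).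
Proof.
elim: l phi => [|l IHl] phi bphi; first by rewrite !rising0 divr1 mul1r.
have Bl_neq0 : B + l%:R != 0 by rewrite gt_eqF// ltr_wpDr.
apply: (mulfI Bl_neq0); rewrite Expe_zeta_step//.
rewrite (IHl (fun x y => x * y * phi x y)); last first.
  by apply: bounded_mfunM => //; exact: bounded_mfunM.
rewrite (eq_Expe P (g := fun w => (p w * q w) ^+ l.+1 * phi (p w) (q w))); last first.
  by move=> w; rewrite exprSr mulrA.
by rewrite !risingSr; field; rewrite Bl_neq0 rising_neq0.
Qed.

Lemma Expe_add_zeta_power (a phi : R -> R -> R) (c : R) k :
  bounded_mfun (fun w => a (p w) (q w)) -> bounded_mfun (fun w => phi (p w) (q w)) ->
  Expe P (fun w => (a (p w) (q w) + c * z w) ^+ k * phi (p w) (q w)) =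
  Expe P (fun w => \sum_(l < k.+1) 'C(k, l.*2)%:R * (c ^+ 2) ^+ l * (rising 2^-1 l / rising B l) *
    ((p w * q w) ^+ l * a (p w) (q w) ^+ (k - l.*2)) * phi (p w) (q w)).
Proof.
move=> ba bphi; pose psi i x y := a x y ^+ (k - i) * phi x y.
have bpsi i : bounded_mfun (fun w => psi i (p w) (q w)).
  by apply: bounded_mfunM => //; exact: bounded_mfunX.
have bz_psi i : bounded_mfun (fun w => z w ^+ i * psi i (p w) (q w)).
  by apply: bounded_mfunM => //; exact: bounded_mfunX.
have bpq_psi l : bounded_mfun (fun w => (p w * q w) ^+ l * psi l.*2 (p w) (q w)).
  by apply: bounded_mfunM => //; apply: bounded_mfunX; exact: bounded_mfunM.
pose term i := ('C(k, i)%:R * c ^+ i) * Expe P (fun w => z w ^+ i * psi i (p w) (q w)).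
transitivity (\sum_(i < k.+1) term i).
  transitivity (Expe P (fun w => \sum_(i < k.+1)
      ('C(k, i)%:R * c ^+ i) * (z w ^+ i * psi i (p w) (q w)))).
    apply: eq_Expe => w; rewrite exprDn mulr_suml; apply: eq_bigr => i _.
    by rewrite -mulr_natl exprMn /psi; ring.
  rewrite Expe_sum => [|i]; last by apply: rpredZ; exact: Lbounded.
  by apply: eq_bigr => i _; rewrite ExpeZ ?Lbounded.
rewrite (sum_even (f := term)); last 2 first.
- by move=> i odd_i; rewrite /term Expe_zeta_odd// mulr0.
- by move=> i lt_ki; rewrite /term bin_small// !mul0r.
transitivity (Expe P (fun w => \sum_(l < k.+1) ('C(k, l.*2)%:R * (c ^+ 2) ^+ l *
    (rising 2^-1 l / rising B l)) * ((p w * q w) ^+ l * psi l.*2 (p w) (q w)))).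
  rewrite Expe_sum => [|l]; last by apply: rpredZ; exact: Lbounded.
  apply: eq_bigr => l _; rewrite ExpeZ ?Lbounded// /term Expe_zeta_even// !mulrA.
  by rewrite -exprM mul2n.
by apply: eq_Expe => w; apply: eq_bigr => l _; rewrite /psi !mulrA.
Qed.

Definition pq_moment i j := Expe P (fun w => p w ^+ i * q w ^+ j).

Lemma Expe_line_power (X Y : R) i k :
  Expe P (fun w => p w ^+ i * (X ^+ 2 * p w + Y ^+ 2 * q w + 2 * X * Y * z w) ^+ k) =
  \sum_(j < k.+1) 'C(k, j)%:R * (rising (B + (k - j)%:R) j / rising B j) *
    (X ^+ 2) ^+ (k - j) * (Y ^+ 2) ^+ j * pq_moment (i + (k - j)) j.
Proof.
have bpq i' j : bounded_mfun (fun w => p w ^+ i' * q w ^+ j).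
  by apply: bounded_mfunM; exact: bounded_mfunX.
rewrite (eq_Expe P (fun w => mulrC (p w ^+ i) _)).
rewrite (@Expe_add_zeta_power (fun x y => X ^+ 2 * x + Y ^+ 2 * y) (fun x _ => x ^+ i));
  last 2 first.
- by apply: bounded_mfunD; exact: bounded_mfunZ.
- exact: bounded_mfunX.
transitivity (Expe P (fun w => \sum_(j < k.+1) ('C(k, j)%:R *
    (rising (B + (k - j)%:R) j / rising B j) * (X ^+ 2) ^+ (k - j) * (Y ^+ 2) ^+ j) *
    (p w ^+ (i + (k - j)) * q w ^+ j))).
  apply: eq_Expe => w; rewrite -mulr_suml.
  transitivity ((\sum_(l < k.+1) 'C(k, l.*2)%:R * 4 ^+ l * (rising 2^-1 l / rising B l) *
      ((X ^+ 2 * p w * (Y ^+ 2 * q w)) ^+ l *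
       (X ^+ 2 * p w + Y ^+ 2 * q w) ^+ (k - l.*2))) * p w ^+ i).
    congr (_ * _); apply: eq_bigr => l _.
    have -> : (2 * X * Y) ^+ 2 = 4 * X ^+ 2 * Y ^+ 2 by ring.
    by rewrite !exprMn; ring.
  rewrite trinomial_rearrangement// mulr_suml; apply: eq_bigr => j _.
  by rewrite !exprMn exprD; ring.
rewrite Expe_sum => [|j]; last by apply: rpredZ; exact: Lbounded.
by apply: eq_bigr => j _; rewrite ExpeZ ?Lbounded.
Qed.

Lemma Expe_line_slope (y : R) k :
  Expe P (fun w => (p w + y ^+ 2 * q w + 2 * y * z w) ^+ k) = (1 + y ^+ 2) ^+ k * pq_moment k 0.
Proof.
have [s s_neq0 [sE circle]] := unit_circle_slope y.
have -> : pq_moment k 0 = Expe P (fun w => p w ^+ k) by apply: eq_Expe => w; rewrite mulr1.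
rewrite -(p_rot k circle) -ExpeZ; last first.
  apply: Lbounded; apply: bounded_mfunX; apply: bounded_mfunD; last exact: bounded_mfunZ.
  by apply: bounded_mfunD; exact: bounded_mfunZ.
by apply: eq_Expe => w; rewrite -exprMn -sE; congr (_ ^+ _); field.
Qed.

(* Compare the coefficients of [y ^+ j.*2] in [Expe_line_slope] and [Expe_line_power]. *)
Lemma pq_moment_homogeneous i j :
  rising B (i + j) * pq_moment i j = rising B i * rising B j * pq_moment (i + j) 0.
Proof.
set k := (i + j)%N; have lt_jk : (j < k.+1)%N by rewrite ltnS leq_addl.
pose c a : R := rising (B + (k - a)%:R) a / rising B a * pq_moment (k - a) a.
have : \sum_(a < k.+1) ('C(k, a)%:R * c a) *: 'X^(a.*2) =
    \sum_(a < k.+1) ('C(k, a)%:R * pq_moment k 0) *: 'X^(a.*2).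
  apply: eq_horner_poly => y; rewrite !horner_sum.
  transitivity (Expe P (fun w => (p w + y ^+ 2 * q w + 2 * y * z w) ^+ k)).
    rewrite (eq_Expe P (g := fun w =>
      p w ^+ 0 * (1 ^+ 2 * p w + y ^+ 2 * q w + 2 * 1 * y * z w) ^+ k)); last first.
      by move=> w; rewrite expr1n !mul1r mulr1.
    rewrite Expe_line_power; apply: eq_bigr => a _.
    by rewrite hornerZ hornerXn !expr1n mulr1 add0n /c -exprM mul2n; ring.
  rewrite Expe_line_slope exprDn mulr_suml; apply: eq_bigr => a _.
  by rewrite expr1n mul1r hornerZ hornerXn -mulr_natl -exprM mul2n; ring.
move=> /(congr1 (fun f : {poly R} => f`_(j.*2))).
rewrite (coef_sum_scaleXdouble (fun a => 'C(k, a)%:R * c a))//.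
rewrite (coef_sum_scaleXdouble (fun a => 'C(k, a)%:R * pq_moment k 0))//.
have binkj_neq0 : 'C(k, j)%:R != 0 :> R by rewrite pnatr_eq0 -lt0n bin_gt0 leq_addl.
move=> /(mulfI binkj_neq0) <-; rewrite /c /k addnK risingD.
by field; rewrite rising_neq0.
Qed.

Let AB : R := B + nvert * B.
Let AB_gt0 : 0 < AB. Proof. by rewrite addr_gt0// mulr_gt0. Qed.

Lemma p_moment k : pq_moment k 0 = rising B k / rising AB k.
Proof.
have p_momentE l : Expe P (fun w => p w ^+ l) = pq_moment l 0.
  by apply: eq_Expe => w; rewrite mulr1.
elim: k => [|k IHk].
  rewrite !rising0 divr1 -[RHS](Expe_cst P 1).
  by apply: eq_Expe => w; rewrite mulr1.
have ABk_neq0 : AB + k%:R != 0 by rewrite gt_eqF// ltr_wpDr.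
have Bk_neq0 : B + k%:R != 0 by rewrite gt_eqF// ltr_wpDr.
have pk1 : (B + k%:R) * pq_moment k 1 = B * pq_moment k.+1 0.
  have := pq_moment_homogeneous k 1.
  rewrite addn1 !risingSr rising0 mul1r addr0 -!mulrA.
  exact: (mulfI (rising_neq0 k B_gt0)).
have := p_sum k; rewrite !p_momentE.
have -> : Expe P (fun w => p w ^+ k * q w) = B * pq_moment k.+1 0 / (B + k%:R).
  by rewrite -pk1 mulrC mulKf.
rewrite IHk !risingSr => pk; apply: (mulIf ABk_neq0).
transitivity (rising B k / rising AB k * (B + k%:R)); last first.
  by field; rewrite ABk_neq0 rising_neq0.
by rewrite pk /AB; field.
Qed.

Lemma pq_momentE i j : pq_moment i j = rising B i * rising B j / rising AB (i + j).
Proof.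
apply: (mulfI (rising_neq0 (i + j) B_gt0)); rewrite pq_moment_homogeneous p_moment.
by field; rewrite rising_neq0.
Qed.

Lemma Expe_standard_pair (al be c : R) i k :
  be + 1 = B -> al + 1 = nvert * B -> 0 <= c <= 1 ->
  Expe P (fun w => p w ^+ i *
    (c * p w + (1 - c) * q w + 2 * Num.sqrt c * Num.sqrt (1 - c) * z w) ^+ k) =
  beta_moment al be ('X^i * cond_moment al be c k).
Proof.
move=> beE alE /andP[c_ge0 c_le1].
have := Expe_line_power (Num.sqrt c) (Num.sqrt (1 - c)) i k.
rewrite !sqr_sqrtr ?subr_ge0// => ->.
have al_gt0 : 0 < al + 1 by rewrite alE mulr_gt0.
have ABE : al + be + 2 = AB by rewrite /AB -alE -beE; ring.
rewrite mulr_sumr linear_sum; apply: eq_bigr => j _ /=; have le_jk : (j <= k)%N by rewrite -ltnS.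
rewrite -[in RHS]scalerAr [RHS]linearZ /= ['X^i * _]mulrA -exprD.
rewrite beta_momentXn_1subXn ?ABE// pq_momentE beE.
by field; rewrite !rising_neq0.
Qed.

End IsotropicCoordinates.

(** * Uniform points of a metric space *)

(* A copy of [M] carrying the point needed by [g_sigma_algebraType]. *)
Definition pointed_copy (M : Type) (x0 : M) : Type := M.

HB.instance Definition _ (M : Type) (x0 : M) := gen_eqMixin (pointed_copy x0).
HB.instance Definition _ (M : Type) (x0 : M) := gen_choiceMixin (pointed_copy x0).
HB.instance Definition _ (M : Type) (x0 : M) := isPointed.Build (pointed_copy x0) x0.

Definition borel_type {M : Type} {R : realType} (dist : M -> M -> R) (x0 : M) :=
  g_sigma_algebraType (ball_sets dist : set (set (pointed_copy x0))).

Section Isometry.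
Context {R : realType} {M : Type} (dist : M -> M -> R).

Lemma isometry_comp g h : isometry dist g -> isometry dist h -> isometry dist (g \o h).
Proof.
move=> [bij_g isom_g] [bij_h isom_h]; split; first exact: bij_comp.
by move=> x y; rewrite /= isom_g isom_h.
Qed.

Lemma isometry_inv g : isometry dist g ->
  exists2 h, isometry dist h & cancel g h /\ cancel h g.
Proof.
move=> [[h gK hK] isom_g]; exists h => //; split; first by exists g.
by move=> x y; rewrite -{2}(hK x) -{2}(hK y) isom_g.
Qed.

Definition half_cos (x y : M) : R := (1 + cos (dist x y)) / 2.

Lemma half_cos_itv x y : 0 <= half_cos x y <= 1.
Proof.
by have := cos_geN1 (dist x y); have := cos_le1 (dist x y); rewrite /half_cos; lra.
Qed.

Lemma cos_half_cos x y : cos (dist x y) = 2 * half_cos x y - 1.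
Proof. by rewrite /half_cos; field. Qed.

Lemma half_cos_isometry g x y : isometry dist g -> half_cos (g x) (g y) = half_cos x y.
Proof. by case=> _ isom_g; rewrite /half_cos isom_g. Qed.

End Isometry.

Section BorelSpace.
Context {R : realType} {M : Type} (dist : M -> M -> R) (x0 : M).
Local Notation borelM := (borel_type dist x0).
Local Notation t := (half_cos dist).

Lemma measurable_dist x : measurable_fun setT (dist x : borelM -> R).
Proof.
apply: (@measurability _ _ borelM R setT (dist x) (@RGenInftyO.G R)).
  exact: RGenInftyO.measurableE.
move=> _ [_ [r ->] <-]; apply: sub_gen_smallest; exists x, r.
by rewrite setTI; apply/seteqP; split => y /=; rewrite in_itv/=.
Qed.

Lemma measurable_isometry g : isometry dist g -> measurable_fun setT (g : borelM -> borelM).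
Proof.
move=> [[h gK hK] isom_g]; apply: (@measurability _ _ borelM borelM setT g (ball_sets dist)) => //.
move=> _ [_ [x [r ->]] <-]; apply: sub_gen_smallest; exists (h x), r.
have dist_g y : dist x (g y) = dist (h x) y by rewrite -{1}(hK x) isom_g.
by rewrite setTI; apply/seteqP; split => y /=; rewrite dist_g.
Qed.

Lemma bounded_mfun_half_cos x : bounded_mfun (half_cos dist x : borelM -> R).
Proof.
split; last by exists 1 => y; have /andP[? ?] := half_cos_itv dist x y; rewrite ger0_norm.
apply: measurable_funM => //; apply: measurable_funD => //.
apply: measurableT_comp (measurable_dist x).
by apply: continuous_measurable_fun; exact: continuous_cos.
Qed.

Definition isometry_invariant (mu : set borelM -> \bar R) :=
  forall g (A : set borelM), isometry dist g -> measurable A -> mu (g @^-1` A) = mu A.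

Lemma Expe_isometry (mu : probability borelM R) g (f : borelM -> R) :
  isometry_invariant mu -> isometry dist g -> bounded_mfun f -> Expe mu (f \o g) = Expe mu f.
Proof.
move=> mu_inv isom_g bf.
pose g' : {RV mu >-> borelM} := mfun_Sub (mem_set (measurable_isometry isom_g)).
pose id' : {RV mu >-> borelM} := mfun_Sub (mem_set (@measurable_id _ borelM setT)).
by apply: (Expe_same_law (X := g') (Y := id')) => // A mA; exact: mu_inv.
Qed.

Lemma Expe_move_points (mu : probability borelM R) g (F : (M -> R) -> R) :
  isometry_invariant mu -> isometry dist g -> bounded_mfun (fun u : borelM => F (t ^~ u)) ->
  Expe mu (fun u => F (fun x => t (g x) u)) = Expe mu (fun u => F (t ^~ u)).
Proof.
move=> mu_inv isom_g bF; have [h isom_h [_ hK]] := isometry_inv isom_g.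
rewrite -(Expe_isometry mu_inv isom_h bF); apply: eq_Expe => u /=; congr F.
by apply/funext => x; rewrite -{1}(hK u) half_cos_isometry.
Qed.

End BorelSpace.

Section UniformElement.
Context {R : realType} {M : Type} (dist : M -> M -> R) (x0 : M).
Context {dT : measure_display} {T : measurableType dT} (P : probability T R) (U : T -> M).
Hypotheses (Uel : random_element dist U) (Uunif : uniform_el P dist U).
Local Notation borelM := (borel_type dist x0).

Lemma measurable_random_element : measurable_fun setT (U : T -> borelM).
Proof. by move=> _ A mA; rewrite setTI; exact: Uel. Qed.

Let U' : {RV P >-> borelM} := mfun_Sub (mem_set measurable_random_element).

Definition law : probability borelM R := distribution P U'.

Lemma law_isometry_invariant : isometry_invariant law.
Proof. by move=> g A isom_g mA; exact: esym (Uunif isom_g mA). Qed.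

Lemma Expe_law (f : borelM -> R) : bounded_mfun f -> Expe law f = Expe P (f \o U).
Proof. by move=> bf; exact: Expe_distribution. Qed.

End UniformElement.

(** * Reproducing formula in an isotropic frame *)

Section IsotropicFrame.
Context {R : realType} {M : Type} (dist : M -> M -> R) {I : finType} (i0 : I) {n : nat}.
Local Notation t := (half_cos dist).

Definition edge_coord (x y e u : M) : R := t e u - (t x u + t y u) / 2.

(* In a projective space the vertices are the coordinate points other than [apex], and [edges m] is
   the point [(1, e_m, 0, ..., 0)], up to scaling, for the [m]-th basis vector [e_m] of the division
   algebra. A sphere is treated as a projective line: [apex] and [vertices ord0] are antipodal,
   [n = 0], and the edges are the basis vectors orthogonal to them. *)
Record isotropic_frame (apex : M) (vertices : 'I_n.+1 -> M) (edges : I -> M) : Prop := {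
  frame_product u : t apex u * t (vertices ord0) u =
    \sum_m edge_coord apex (vertices ord0) (edges m) u ^+ 2;
  frame_rotate (a : I -> R) : \sum_m a m ^+ 2 = 1 -> exists2 h, isometry dist h &
    [/\ h apex = apex, h (vertices ord0) = vertices ord0 &
      forall u, edge_coord apex (vertices ord0) (h (edges i0)) u =
        \sum_m a m * edge_coord apex (vertices ord0) (edges m) u];
  frame_line (x y : R) : x ^+ 2 + y ^+ 2 = 1 -> exists2 h, isometry dist h &
    forall u, t (h apex) u = x ^+ 2 * t apex u + y ^+ 2 * t (vertices ord0) u +
      2 * x * y * edge_coord apex (vertices ord0) (edges i0) u;
  frame_sum u : t apex u + \sum_l t (vertices l) u = 1;
  frame_swap l : exists2 h, isometry dist h &
    h apex = apex /\ h (vertices ord0) = vertices l;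
  frame_pair (x y : M) : exists2 h, isometry dist h & h apex = x /\ exists2 y0, h y0 = y &
    forall u, t y0 u = t x y * t apex u + (1 - t x y) * t (vertices ord0) u +
      2 * Num.sqrt (t x y) * Num.sqrt (1 - t x y) *
      edge_coord apex (vertices ord0) (edges i0) u
}.

Section InvariantLaw.
Variables (apex : M) (vertices : 'I_n.+1 -> M) (edges : I -> M).
Hypothesis frame : isotropic_frame apex vertices edges.
Variable mu : probability (borel_type dist apex) R.
Hypothesis mu_inv : isometry_invariant mu.

Local Notation borelM := (borel_type dist apex).
Local Notation p := (t apex : borelM -> R).
Local Notation q := (t (vertices ord0) : borelM -> R).
Local Notation zeta := (fun m => edge_coord apex (vertices ord0) (edges m) : borelM -> R).

Lemma bounded_mfun_edge_coord x y e : bounded_mfun (edge_coord x y e : borelM -> R).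
Proof.
apply: bounded_mfunB; first exact: bounded_mfun_half_cos.
under [X in bounded_mfun X]eq_fun do rewrite mulrC.
by apply: bounded_mfunZ; apply: bounded_mfunD; exact: bounded_mfun_half_cos.
Qed.

Lemma Expe_rotate (phi : R -> R -> R) (a : I -> R) l :
  bounded_mfun (fun u => phi (p u) (q u)) -> \sum_m a m ^+ 2 = 1 ->
  Expe mu (fun u => (\sum_m a m * zeta m u) ^+ l * phi (p u) (q u)) =
  Expe mu (fun u => zeta i0 u ^+ l * phi (p u) (q u)).
Proof.
move=> bphi a1; have [h isom_h [h_apex h_vertex hE]] := frame_rotate frame a1.
rewrite -(Expe_move_points (F := fun f => (f (edges i0) - (f apex + f (vertices ord0)) / 2) ^+ l *
    phi (f apex) (f (vertices ord0))) mu_inv isom_h).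
  by apply: eq_Expe => u; rewrite -hE h_apex h_vertex.
by apply: bounded_mfunM => //; apply: bounded_mfunX; exact: bounded_mfun_edge_coord.
Qed.

Lemma Expe_line (x y : R) k : x ^+ 2 + y ^+ 2 = 1 ->
  Expe mu (fun u => (x ^+ 2 * p u + y ^+ 2 * q u + 2 * x * y * zeta i0 u) ^+ k) =
  Expe mu (fun u => p u ^+ k).
Proof.
move=> xy1; have [h isom_h hE] := frame_line frame xy1.
rewrite -(Expe_move_points (F := fun f => f apex ^+ k) mu_inv isom_h).
  by apply: eq_Expe => u; rewrite hE.
by apply: bounded_mfunX; exact: bounded_mfun_half_cos.
Qed.

Lemma Expe_vertex l k :
  Expe mu (fun u => p u ^+ k * t (vertices l) u) = Expe mu (fun u => p u ^+ k * q u).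
Proof.
have [h isom_h [h_apex h_vertex]] := frame_swap frame l.
rewrite -(Expe_move_points (F := fun f => f apex ^+ k * f (vertices ord0)) mu_inv isom_h).
  by apply: eq_Expe => u; rewrite h_apex h_vertex.
by apply: bounded_mfunM; [apply: bounded_mfunX|]; exact: bounded_mfun_half_cos.
Qed.

Lemma Expe_apex_power k : Expe mu (fun u => p u ^+ k) =
  Expe mu (fun u => p u ^+ k.+1) + n.+1%:R * Expe mu (fun u => p u ^+ k * q u).
Proof.
have Lp i : (fun u => p u ^+ i) \in Lfun mu 1.
  by apply: bounded_mfun_Lfun1; apply: bounded_mfunX; exact: bounded_mfun_half_cos.
have Lvertex l : (fun u => p u ^+ k * t (vertices l) u) \in Lfun mu 1.
  apply: bounded_mfun_Lfun1; apply: bounded_mfunM; last exact: bounded_mfun_half_cos.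
  by apply: bounded_mfunX; exact: bounded_mfun_half_cos.
transitivity (Expe mu (fun u => p u ^+ k.+1 + \sum_l p u ^+ k * t (vertices l) u)).
  by apply: eq_Expe => u; rewrite -mulr_sumr exprSr -mulrDr (frame_sum frame) mulr1.
rewrite ExpeD//; last exact: Lfun_sum.
rewrite Expe_sum// (eq_bigr _ (fun l _ => Expe_vertex l k)) sumr_const card_ord.
by rewrite mulr_natl.
Qed.

Variables al be : R.
Hypotheses (beE : be + 1 = #|I|%:R / 2) (alE : al + 1 = n.+1%:R * (#|I|%:R / 2)).

Lemma Expe_half_cos_powers x y i k :
  Expe mu (fun u => t x u ^+ i * t y u ^+ k) =
  beta_moment al be ('X^i * cond_moment al be (t x y) k).
Proof.
have [h isom_h [<- [y0 <- y0E]]] := frame_pair frame x y.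
rewrite (Expe_move_points (F := fun f => f apex ^+ i * f y0 ^+ k) mu_inv isom_h); last first.
  by apply: bounded_mfunM; apply: bounded_mfunX; exact: bounded_mfun_half_cos.
rewrite half_cos_isometry//.
transitivity (Expe mu (fun u => p u ^+ i * (t apex y0 * p u + (1 - t apex y0) * q u +
    2 * Num.sqrt (t apex y0) * Num.sqrt (1 - t apex y0) * zeta i0 u) ^+ k)).
  by apply: eq_Expe => u; rewrite y0E half_cos_isometry.
apply: (Expe_standard_pair (zeta := zeta) (nvert := n.+1%:R)) => //.
- exact: bounded_mfun_half_cos.
- exact: bounded_mfun_half_cos.
- by move=> m; exact: bounded_mfun_edge_coord.
- exact: frame_product frame.
- exact: Expe_rotate.
- exact: Expe_line.
- exact: Expe_apex_power.
- exact: half_cos_itv.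
Qed.

Lemma Expe_jacobi_invariant x y m :
  Expe mu (fun u => jacobiP m al be (cos (dist x u)) * jacobiP m al be (cos (dist y u))) =
  jacobi_const al be m * jacobiP m al be (cos (dist x y)).
Proof.
have card_gt0 : (0 < #|I|)%N by apply/card_gt0P; exists i0.
have be_gt0 : 0 < be + 1 by rewrite beE divr_gt0// ltr0n.
have al_gt0 : 0 < al + 1 by rewrite alE mulr_gt0// -beE.
have albe_gt0 : 0 < al + be + 2 by have := addr_gt0 al_gt0 be_gt0; lra.
rewrite cos_half_cos jacobiP_horner -jacobi_reproducing//.
under [X in Expe mu X]eq_fun do rewrite !cos_half_cos !jacobiP_horner.
rewrite (Expe_horner2 mu (bounded_mfun_half_cos dist apex x) (bounded_mfun_half_cos dist apex y)
  (size_jacobi_poly _ _ _) (size_jacobi_poly _ _ _)).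
by apply: eq_bigr => k _; congr (_ * _); apply: eq_bigr => i _; rewrite Expe_half_cos_powers.
Qed.

End InvariantLaw.
End IsotropicFrame.

Lemma bounded_mfun_jacobi (R : realType) (M : Type) (dist : M -> M -> R) (x0 x : M) (al be : R) m :
  bounded_mfun (fun u : borel_type dist x0 => jacobiP m al be (cos (dist x u))).
Proof.
under [X in bounded_mfun X]eq_fun do rewrite cos_half_cos jacobiP_horner.
by apply: bounded_mfun_horner; exact: bounded_mfun_half_cos.
Qed.

Lemma Expe_jacobi_uniform (R : realType) (M : Type) (dist : M -> M -> R) (I : finType) (i0 : I)
    (n : nat) (apex : M) (vertices : 'I_n.+1 -> M) (edges : I -> M)
    (dT : measure_display) (T : measurableType dT) (P : probability T R) (U : T -> M)
    (al be : R) x y m :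
  isotropic_frame dist i0 apex vertices edges ->
  be + 1 = #|I|%:R / 2 -> al + 1 = n.+1%:R * (#|I|%:R / 2) ->
  random_element dist U -> uniform_el P dist U ->
  Expe P (fun w => jacobiP m al be (cos (dist x (U w))) * jacobiP m al be (cos (dist y (U w)))) =
  jacobi_const al be m * jacobiP m al be (cos (dist x y)).
Proof.
move=> frame beE alE Uel Uunif.
rewrite -(Expe_jacobi_invariant frame (law_isometry_invariant (x0 := apex) Uel Uunif) beE alE).
rewrite (Expe_law P (x0 := apex) Uel)//.
by apply: bounded_mfunM; exact: bounded_mfun_jacobi.
Qed.

(** * Cayley-Dickson algebras *)

Local Notation "a ** b" := (cd_mul a b) (at level 40, left associativity).
Local Notation "a ^conj" := (cd_conj a) (at level 2, format "a ^conj").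

Section CayleyDickson.
Variable R : realType.

Fixpoint cd_scale (j : nat) (r : R) : CD R j -> CD R j :=
  match j return CD R j -> CD R j with
  | 0 => fun a => r * a
  | j'.+1 => fun a => (cd_scale r a.1, cd_scale r a.2)
  end.

Fixpoint cd_one (j : nat) : CD R j :=
  match j return CD R j with 0 => 1 | j'.+1 => (cd_one j', cd_zero j') end.

Fixpoint cdot (j : nat) : CD R j -> CD R j -> R :=
  match j return CD R j -> CD R j -> R with
  | 0 => fun a b => a * b
  | j'.+1 => fun a b => cdot a.1 b.1 + cdot a.2 b.2
  end.

Lemma cd_addA j : associative (@cd_add R j).
Proof. by elim: j => [|j IHj] a b c /=; rewrite ?addrA// !IHj. Qed.

Lemma cd_addC j : commutative (@cd_add R j).
Proof. by elim: j => [|j IHj] a b /=; [rewrite addrC|rewrite (IHj a.1) (IHj a.2)]. Qed.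

Lemma cd_add0 j : left_id (cd_zero j) (@cd_add R j).
Proof. by elim: j => [|j IHj] a /=; [rewrite add0r|rewrite !IHj; case: a]. Qed.

Lemma cd_addN j : left_inverse (cd_zero j) (@cd_opp R j) (@cd_add R j).
Proof. by elim: j => [|j IHj] a /=; [rewrite addNr|rewrite !IHj]. Qed.

HB.instance Definition _ j := gen_eqMixin (CD R j).
HB.instance Definition _ j := gen_choiceMixin (CD R j).
HB.instance Definition _ j :=
  GRing.isZmodule.Build (CD R j) (@cd_addA j) (@cd_addC j) (@cd_add0 j) (@cd_addN j).

Lemma cd_scaleA j r s (a : CD R j) : cd_scale r (cd_scale s a) = cd_scale (r * s) a.
Proof. by elim: j a => [|j IHj] a /=; rewrite ?mulrA// !IHj. Qed.

Lemma cd_scale1 j : left_id 1 (@cd_scale j).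
Proof. by elim: j => [|j IHj] a /=; [rewrite mul1r|rewrite !IHj; case: a]. Qed.

Lemma cd_scaleDr j : right_distributive (@cd_scale j) +%R.
Proof. by elim: j => [|j IHj] r a b; [exact: mulrDr|rewrite /= !IHj]. Qed.

Lemma cd_scaleDl j (a : CD R j) : {morph @cd_scale j ^~ a : r s / r + s}.
Proof. by elim: j a => [|j IHj] a r s; [exact: mulrDl|rewrite /= !IHj]. Qed.

HB.instance Definition _ j := GRing.Zmodule_isLmodule.Build R (CD R j)
  (@cd_scaleA j) (@cd_scale1 j) (@cd_scaleDr j) (@cd_scaleDl j).

(* Rewriting with these equations keeps the module operations folded, unlike [/=]. *)
Lemma cdS_oneE j : cd_one j.+1 = (cd_one j, (0 : CD R j)).
Proof. by []. Qed.

Lemma cdS_addE j (a b : CD R j.+1) :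
  a + b = ((a.1 : CD R j) + b.1, (a.2 : CD R j) + b.2) :> CD R j.+1.
Proof. by []. Qed.

Lemma cdS_scaleE j r (a : CD R j.+1) :
  r *: a = (r *: (a.1 : CD R j), r *: (a.2 : CD R j)) :> CD R j.+1.
Proof. by []. Qed.

Lemma cdS_mulE j (a b : CD R j.+1) : a ** b =
  ((a.1 : CD R j) ** b.1 - (b.2 : CD R j)^conj ** a.2,
   (b.2 : CD R j) ** a.1 + a.2 ** (b.1 : CD R j)^conj) :> CD R j.+1.
Proof. by []. Qed.

Lemma cdS_conjE j (a : CD R j.+1) :
  a^conj = ((a.1 : CD R j)^conj, - (a.2 : CD R j)) :> CD R j.+1.
Proof. by []. Qed.

Lemma cdS_dotE j (a b : CD R j.+1) : cdot a b = cdot (a.1 : CD R j) b.1 + cdot (a.2 : CD R j) b.2.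
Proof. by []. Qed.

Lemma cdotC j (a b : CD R j) : cdot a b = cdot b a.
Proof. by elim: j a b => [|j IHj] a b /=; [rewrite mulrC|rewrite (IHj a.1) (IHj a.2)]. Qed.

Lemma cdot_is_biscalar j : bilinear_for *%R *%R (@cdot j).
Proof.
have cdot_linl c : linear_for *%R ((@cdot j) ^~ c).
  elim: j c => [|j IHj] c r a b; first by rewrite /cdot mulrDl mulrA.
  by rewrite cdS_scaleE cdS_addE !cdS_dotE /= !IHj mulrDr addrACA.
by split=> c r a b; rewrite ?(cdotC c) cdot_linl ?(cdotC _ c).
Qed.

HB.instance Definition _ j := bilinear_isBilinear.Build R (CD R j) (CD R j) R *%R *%R (@cdot j)
  (cdot_is_biscalar j).

Lemma cdotDl j (a b c : CD R j) : cdot (a + b) c = cdot a c + cdot b c.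
Proof. exact: linearDl. Qed.

Lemma cdotDr j (a b c : CD R j) : cdot c (a + b) = cdot c a + cdot c b.
Proof. exact: linearDr. Qed.

Lemma cdotZl j r (a c : CD R j) : cdot (r *: a) c = r * cdot a c.
Proof. exact: linearZl_LR. Qed.

Lemma cdotZr j r (a c : CD R j) : cdot c (r *: a) = r * cdot c a.
Proof. exact: linearZr_LR. Qed.

Lemma cdotNl j (a c : CD R j) : cdot (- a) c = - cdot a c.
Proof. exact: linearNl. Qed.

Lemma cdotNr j (a c : CD R j) : cdot c (- a) = - cdot c a.
Proof. exact: linearNr. Qed.

Lemma cdot0l j (c : CD R j) : cdot 0 c = 0.
Proof. exact: linear0l. Qed.

Lemma cdot_neq0 j (a c : CD R j) : cdot a c != 0 -> a != 0.
Proof. by apply: contra_neq => ->; exact: cdot0l. Qed.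

Lemma cdot_suml j I (s : seq I) (F : I -> CD R j) c :
  cdot (\sum_(i <- s) F i) c = \sum_(i <- s) cdot (F i) c.
Proof. exact: linear_sumlz. Qed.

Lemma cdot_ge0 j (a : CD R j) : 0 <= cdot a a.
Proof. by elim: j a => [|j IHj] a /=; [rewrite -expr2 sqr_ge0|rewrite addr_ge0]. Qed.

Lemma cdot_eq0 j (a : CD R j) : cdot a a = 0 -> a = 0.
Proof.
elim: j a => [|j IHj] a; first by move/eqP; rewrite mulf_eq0 orbb => /eqP.
rewrite cdS_dotE => /eqP; rewrite paddr_eq0 ?cdot_ge0// => /andP[/eqP/IHj a1_0 /eqP/IHj a2_0].
by rewrite [a]surjective_pairing a1_0 a2_0.
Qed.

Lemma cdot_ext j (a b : CD R j) : (forall c, cdot a c = cdot b c) -> a = b.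
Proof.
move=> ab; apply/eqP; rewrite -subr_eq0; apply/eqP/cdot_eq0.
by rewrite cdotDl cdotNl ab subrr.
Qed.

Lemma cdot_one j : cdot (cd_one j) (cd_one j) = 1.
Proof.
by elim: j => [|j IHj]; [exact: mulr1|rewrite cdS_dotE IHj /= -/(0 : CD R j) cdot0l addr0].
Qed.

Lemma cdot1l j (a : CD R j) : cdot (cd_one j) a = cd_re a.
Proof.
elim: j a => [|j IHj] a; first exact: mul1r.
by rewrite cdS_dotE IHj /= -/(0 : CD R j) cdot0l addr0.
Qed.

Lemma cd_reZ1 j r : cd_re (r *: cd_one j) = r.
Proof. by rewrite -cdot1l cdotZr cdot_one mulr1. Qed.

Lemma cd_conjK j : involutive (@cd_conj R j).
Proof. by elim: j => [|j IHj] // [a b]; rewrite !cdS_conjE /= IHj opprK. Qed.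

Lemma cd_conj_is_linear j : linear (@cd_conj R j).
Proof.
elim: j => [|j IHj] // r a b.
by rewrite !cdS_conjE cdS_scaleE !cdS_addE cdS_scaleE /= IHj opprD scalerN.
Qed.

HB.instance Definition _ j := GRing.isLinear.Build R (CD R j) (CD R j) *:%R (@cd_conj R j)
  (@cd_conj_is_linear j).

Lemma cd_conjZ j r (a : CD R j) : (r *: a)^conj = r *: a^conj.
Proof. exact: linearZ. Qed.

Lemma cd_conj1 j : (cd_one j)^conj = cd_one j.
Proof. by elim: j => [|j IHj] //; rewrite cdS_oneE cdS_conjE /= IHj oppr0. Qed.

Lemma cdot_conj j (a b : CD R j) : cdot a^conj b^conj = cdot a b.
Proof. by elim: j a b => [|j IHj] // a b; rewrite !cdS_dotE /= IHj cdotNl cdotNr opprK. Qed.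

Lemma cd_mul_is_bilinear j : bilinear_for *:%R *:%R (@cd_mul R j).
Proof.
elim: j => [|j [mul_linl mul_linr]].
  split=> c r a b; rewrite /cd_mul ?mulrDl ?mulrDr; congr (_ + _); [exact/esym/mulrA|exact: mulrCA].
by split=> c r a b; rewrite !cdS_scaleE !cdS_addE !cdS_mulE /= ?linearP ?mul_linl ?mul_linr;
  congr (_, _); rewrite ?opprD -[cd_scale _ _]/(r *: _) ?(scalerBr, scalerDr) addrACA.
Qed.

HB.instance Definition _ j := bilinear_isBilinear.Build R (CD R j) (CD R j) (CD R j) *:%R *:%R
  (@cd_mul R j) (cd_mul_is_bilinear j).

Lemma cd_mulDl j (a b c : CD R j) : (a + b) ** c = a ** c + b ** c.
Proof. exact: linearDl. Qed.

Lemma cd_mulDr j (a b c : CD R j) : c ** (a + b) = c ** a + c ** b.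
Proof. exact: linearDr. Qed.

Lemma cd_mulZl j r (a b : CD R j) : (r *: a) ** b = r *: (a ** b).
Proof. exact: linearZl_LR. Qed.

Lemma cd_mulZr j r (a b : CD R j) : a ** (r *: b) = r *: (a ** b).
Proof. exact: linearZr_LR. Qed.

Lemma cd_mulNl j (a b : CD R j) : (- a) ** b = - (a ** b).
Proof. exact: linearNl. Qed.

Lemma cd_mulNr j (a b : CD R j) : a ** (- b) = - (a ** b).
Proof. exact: linearNr. Qed.

Lemma cd_mul0l j (b : CD R j) : 0 ** b = 0.
Proof. exact: linear0l. Qed.

Lemma cd_mul0r j (b : CD R j) : b ** 0 = 0.
Proof. exact: linear0r. Qed.

Lemma cd_mul1_id j : left_id (cd_one j) (@cd_mul R j) /\ right_id (cd_one j) (@cd_mul R j).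
Proof.
elim: j => [|j [mul1a mula1]]; first by split=> a; [exact: mul1r|exact: mulr1].
by split=> -[a1 a2]; rewrite cdS_mulE cdS_oneE /= ?linear0 ?cd_conj1 ?mul1a ?mula1
  ?cd_mul0l ?cd_mul0r ?subr0 ?addr0 ?add0r.
Qed.

Lemma cd_mul1l j (a : CD R j) : cd_one j ** a = a.
Proof. by case: (cd_mul1_id j). Qed.

Lemma cd_mul1r j (a : CD R j) : a ** cd_one j = a.
Proof. by case: (cd_mul1_id j). Qed.

Lemma cd_conjM j (a b : CD R j) : (a ** b)^conj = b^conj ** a^conj.
Proof.
elim: j a b => [|j IHj] a b; first exact: mulrC.
rewrite !cdS_mulE !cdS_conjE /= linearB /= !IHj !cd_conjK [(- _)^conj]linearN /=.
rewrite !cd_mulNl !cd_mulNr opprK.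
by congr (_, _); rewrite opprD addrC.
Qed.

Lemma cd_mul_conj j (a : CD R j) : a ** a^conj = cdot a a *: cd_one j.
Proof.
suff [] : a ** a^conj = cdot a a *: cd_one j /\ a^conj ** a = cdot a a *: cd_one j by [].
elim: j a => [|j IHj] a; first by split; exact/esym/mulr1.
have [[a1r a1l] [_ a2l]] := (IHj a.1, IHj a.2).
rewrite !cdS_mulE !cdS_conjE cdS_oneE cdS_scaleE cdS_dotE /= cd_conjK linearN !cd_mulNl !cd_mulNr.
by rewrite opprK a1r a1l a2l addNr subrr scaler0 -scalerDl.
Qed.

Lemma cd_conj_mul j (a : CD R j) : a^conj ** a = cdot a a *: cd_one j.
Proof. by rewrite -{2}(cd_conjK a) cd_mul_conj cdot_conj. Qed.

Lemma cd_re_mul j (a b : CD R j) : cd_re (a ** b) = cdot a b^conj.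
Proof.
elim: j a b => [|j IHj] // a b.
rewrite cdS_mulE cdS_conjE cdS_dotE -[LHS]cdot1l cdS_oneE cdS_dotE /=.
by rewrite cdot0l addr0 cdot1l -cdot1l cdotDr cdotNr !cdot1l !IHj cdot_conj cdotNr (cdotC b.2).
Qed.

Lemma cd_self_conj j (a : CD R j) : a^conj = a -> a = cd_re a *: cd_one j.
Proof.
elim: j a => [|j IHj] a; first by move=> _; exact/esym/mulr1.
rewrite cdS_conjE cdS_scaleE => a_conj; rewrite [LHS]surjective_pairing; congr (_, _).
  by apply: IHj; exact: (congr1 fst a_conj).
have a2N : - (a.2 : CD R j) = a.2 by exact: (congr1 snd a_conj).
have : (2 : R) *: (a.2 : CD R j) = 0 by rewrite scaler_nat mulr2n -[X in X + _]a2N addNr.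
by move/eqP; rewrite scaler_eq0 pnatr_eq0 /= => /eqP ->; rewrite scaler0.
Qed.

Lemma cd_reM_comm j (a b : CD R j) : cd_re (a ** b) = cd_re (b ** a).
Proof. by rewrite !cd_re_mul cdotC -cdot_conj cd_conjK. Qed.

Lemma cd_re_conj j (a : CD R j) : cd_re a^conj = cd_re a.
Proof. by rewrite -!cdot1l -[in LHS]cd_conj1 cdot_conj. Qed.

Lemma cd_conjE j (a : CD R j) : a^conj = (2 * cd_re a) *: cd_one j - a.
Proof.
have /cd_self_conj : (a + a^conj)^conj = a + a^conj by rewrite linearD /= cd_conjK addrC.
rewrite -cdot1l cdotDr !cdot1l cd_re_conj => trace_a.
by rewrite mulr_natl mulr2n -trace_a addrC addKr.
Qed.

Fixpoint cd_index (j : nat) : finType :=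
  match j with 0 => unit | j'.+1 => (cd_index j' + cd_index j')%type end.

Fixpoint cd_index0 (j : nat) : cd_index j :=
  match j with 0 => tt | j'.+1 => inl (cd_index0 j') end.

Fixpoint cd_basis (j : nat) : cd_index j -> CD R j :=
  match j with
  | 0 => fun=> 1
  | j'.+1 => fun i =>
    match i with inl k => (cd_basis k, cd_zero j') | inr k => (cd_zero j', cd_basis k) end
  end.

Lemma card_cd_index j : #|cd_index j| = (2 ^ j)%N.
Proof. by elim: j => [|j IHj]; [exact: card_unit|rewrite card_sum IHj expnS mul2n addnn]. Qed.

Lemma cd_basis0 j : cd_basis (cd_index0 j) = cd_one j.
Proof. by elim: j => //= j ->. Qed.

Lemma cd_basis_dot j (i k : cd_index j) : cdot (cd_basis i) (cd_basis k) = (i == k)%:R.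
Proof.
elim: j i k => [|j IHj]; first by case=> -[]; exact: mulr1.
by case=> i [] k; rewrite cdS_dotE /= -/(0 : CD R j) ?cdot0l ?IHj ?addr0 ?add0r// cdotC cdot0l.
Qed.

Lemma cd_basis_parseval j (a : CD R j) : \sum_i cdot (cd_basis i) a ^+ 2 = cdot a a.
Proof.
elim: j a => [|j IHj] a; first by rewrite (big_pred1 tt) => [|[]//]; rewrite /= mul1r expr2.
rewrite big_sumType cdS_dotE -!IHj /=; congr (_ + _); apply: eq_bigr => i _.
  by rewrite -/(0 : CD R j) cdot0l addr0.
by rewrite -/(0 : CD R j) cdot0l add0r.
Qed.

Lemma cd_basis_comb_dot j (a : cd_index j -> R) :
  cdot (\sum_i a i *: cd_basis i) (\sum_i a i *: cd_basis i) = \sum_i a i ^+ 2.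
Proof.
rewrite -cd_basis_parseval; apply: eq_bigr => k _; congr (_ ^+ 2).
rewrite cdotC cdot_suml (bigD1 k)//= cdotZl cd_basis_dot eqxx mulr1 big1 ?addr0// => i ik.
by rewrite cdotZl cd_basis_dot (negbTE ik) mulr0.
Qed.

Definition cd_norm j (a : CD R j) : R := Num.sqrt (cdot a a).

Lemma cd_norm_sqr j (a : CD R j) : cd_norm a ^+ 2 = cdot a a.
Proof. by rewrite sqr_sqrtr// cdot_ge0. Qed.

Lemma cd_norm0 j : cd_norm (0 : CD R j) = 0.
Proof. by rewrite /cd_norm cdot0l sqrtr0. Qed.

Lemma cd_norm_neq0 j (a : CD R j) : a != 0 -> cd_norm a != 0.
Proof.
by apply: contra => /eqP a0; apply/eqP/cdot_eq0; rewrite -cd_norm_sqr a0 expr0n.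
Qed.

Lemma exists_unit_phase j (a : CD R j) : exists2 u, cdot u u = 1 & u ** a = cd_norm a *: cd_one j.
Proof.
have [->|a_neq0] := eqVneq a 0.
  by exists (cd_one j); rewrite ?cdot_one// cd_mul0r cd_norm0 scale0r.
have norm_neq0 := cd_norm_neq0 a_neq0.
exists ((cd_norm a)^-1 *: a^conj).
  by rewrite cdotZl cdotZr cdot_conj -cd_norm_sqr; field.
by rewrite cd_mulZl cd_conj_mul scalerA -cd_norm_sqr expr2 mulKf.
Qed.

Lemma cd_mulA j : (j <= 2)%N -> associative (@cd_mul R j).
Proof.
case: j => [|[|[|//]]] _ a b c; first exact: mulrA.
  by case: a b c => [a1 a2] [b1 b2] [c1 c2]; rewrite /cd_mul /=; congr (_, _); ring.
case: a b c => [[a1 a2] [a3 a4]] [[b1 b2] [b3 b4]] [[c1 c2] [c3 c4]].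
by rewrite /cd_mul /=; congr ((_, _), (_, _)); ring.
Qed.

End CayleyDickson.

Section CompositionAlgebra.
Variables (R : realType) (j : nat).
Hypothesis j_le3 : (j <= 3)%N.
Implicit Types a b c d t u x y z : CD R j.

Lemma cd_norm_mul_assoc k (a b : CD R k) : associative (@cd_mul R k) ->
  cdot (a ** b) (a ** b) = cdot a a * cdot b b.
Proof.
move=> mulA; rewrite -{2}[a ** b]cd_conjK -cd_re_mul cd_conjM mulA -(mulA a) cd_mul_conj.
by rewrite cd_mulZr cd_mul1r cd_mulZl cd_mul_conj scalerA cd_reZ1 mulrC.
Qed.

(* A Cayley-Dickson double of an associative algebra with multiplicative norm has multiplicative
   norm: associativity makes the two cross terms equal. *)
Lemma cd_norm_mul a b : cdot (a ** b) (a ** b) = cdot a a * cdot b b.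
Proof.
move: j_le3 a b; case: j => [|k] k_lt3 a b; first by rewrite /=; ring.
have mulA := @cd_mulA R k k_lt3.
have cross : cdot ((a.1 : CD R k) ** b.1) ((b.2 : CD R k)^conj ** a.2) =
    cdot ((b.2 : CD R k) ** a.1) (a.2 ** (b.1 : CD R k)^conj).
  rewrite -[_ ** a.2]cd_conjK -cd_re_mul -[a.2 ** _]cd_conjK -cd_re_mul !cd_conjM !cd_conjK.
  by rewrite !mulA cd_reM_comm !mulA.
rewrite !cdS_dotE !cdS_mulE /= !(cdotDl, cdotDr, cdotNl, cdotNr) !cd_norm_mul_assoc// !cdot_conj.
rewrite (cdotC _ ((a.1 : CD R k) ** b.1)) (cdotC (a.2 ** _)) cross.
by ring.
Qed.

Lemma cdot_mul2r u a b : cdot (a ** u) (b ** u) = cdot u u * cdot a b.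
Proof.
have := cd_norm_mul (a + b) u.
rewrite cd_mulDl !(cdotDl, cdotDr) !cd_norm_mul (cdotC (b ** u)) (cdotC b a); lra.
Qed.

Lemma cd_exchange a b c d :
  cdot (a ** b) (c ** d) + cdot (a ** d) (c ** b) = 2 * cdot a c * cdot b d.
Proof.
have := cdot_mul2r (b + d) a c.
rewrite !cd_mulDr !(cdotDl, cdotDr) !cdot_mul2r (cdotC d b); lra.
Qed.

Lemma cdot_mul2l u a b : cdot (u ** a) (u ** b) = cdot u u * cdot a b.
Proof. have := cd_exchange u a u b; rewrite (cdotC (u ** b)); lra. Qed.

Lemma cdot_mulr a b d : cdot b (a ** d) = cdot (a^conj ** b) d.
Proof.
have := cd_exchange a b (cd_one R j) d; rewrite !cd_mul1l (cdotC a) cdot1l => exch.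
rewrite cd_conjE cd_mulDl cd_mulNl cd_mulZl cd_mul1l cdotDl cdotNl cdotZl -exch cdotC.
by ring.
Qed.

Lemma cdot_mull a b d : cdot a (d ** b) = cdot (a ** b^conj) d.
Proof. by rewrite -cdot_conj cd_conjM cdot_mulr cd_conjK -cdot_conj cd_conjM !cd_conjK. Qed.

Lemma cd_mulKl u a : u^conj ** (u ** a) = cdot u u *: a.
Proof. by apply: cdot_ext => t; rewrite -cdot_mulr cdot_mul2l cdotZl. Qed.

Lemma cd_mulKr u a : (a ** u) ** u^conj = cdot u u *: a.
Proof. by apply: cdot_ext => t; rewrite -cdot_mull cdot_mul2r cdotZl. Qed.

Lemma cd_mulVKl u a : u ** (u^conj ** a) = cdot u u *: a.
Proof. by rewrite -{1}(cd_conjK u) cd_mulKl cdot_conj. Qed.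

Lemma cd_mulVKr u a : (a ** u^conj) ** u = cdot u u *: a.
Proof. by rewrite -{2}(cd_conjK u) cd_mulKr cdot_conj. Qed.

Lemma cd_sandwich u x : (u ** x) ** u = (2 * cdot x u^conj) *: u - cdot u u *: x^conj.
Proof.
apply: cdot_ext => t; rewrite cdotC cdot_mull cdotC.
have := cd_exchange u x t u^conj; rewrite cd_mul_conj cdotZl cdot1l cd_re_mul => exch.
by rewrite cdotDl cdotNl !cdotZl (cdotC x^conj); lra.
Qed.

Lemma moufang_left u x y : ((u ** x) ** u) ** y = u ** (x ** (u ** y)).
Proof.
apply: cdot_ext => t; rewrite cd_sandwich cd_mulDl cd_mulNl !cd_mulZl cdotDl cdotNl !cdotZl.
rewrite [RHS]cdotC cdot_mulr [RHS]cdotC -cdot_mulr.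
have := cd_exchange x (u ** y) u^conj t.
by rewrite cd_mulKl cdotZr (cdotC (x ** t) y) cdot_mulr; lra.
Qed.

End CompositionAlgebra.

(** * Projective spaces *)

Section RowCombination.
Variables (R : comNzRingType) (n : nat).
Implicit Types (Q : 'M[R]_n).

Definition row_comb (V : lmodType R) Q (v : 'I_n -> V) i : V := \sum_a Q i a *: v a.

Lemma eq_row_comb (V : lmodType R) Q (v w : 'I_n -> V) i :
  v =1 w -> row_comb Q v i = row_comb Q w i.
Proof. by move=> vw; apply: eq_bigr => a _; rewrite vw. Qed.

Lemma linear_row_comb (V W : lmodType R) (f : {linear V -> W}) Q (v : 'I_n -> V) i :
  f (row_comb Q v i) = row_comb Q (f \o v) i.
Proof. by rewrite linear_sum; apply: eq_bigr => a _; rewrite linearZ. Qed.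

Lemma row_comb_exchange (V : lmodType R) Q Q' (F : 'I_n -> 'I_n -> V) i k :
  row_comb Q (fun a => row_comb Q' (F a) k) i = row_comb Q' (fun b => row_comb Q (F ^~ b) i) k.
Proof.
rewrite /row_comb; under eq_bigr do rewrite scaler_sumr.
rewrite exchange_big /=; apply: eq_bigr => b _; rewrite scaler_sumr.
by apply: eq_bigr => a _; rewrite !scalerA mulrC.
Qed.

Lemma row_comb_comp (V : lmodType R) Q Q' (v : 'I_n -> V) i :
  row_comb Q (row_comb Q' v) i = row_comb (Q *m Q') v i.
Proof.
rewrite /row_comb; under eq_bigr do rewrite scaler_sumr.
rewrite exchange_big /=; apply: eq_bigr => a _; rewrite mxE scaler_suml.
by apply: eq_bigr => b _; rewrite scalerA.
Qed.

Lemma row_comb1 (V : lmodType R) (v : 'I_n -> V) i : row_comb 1%:M v i = v i.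
Proof.
rewrite /row_comb (bigD1 i)//= mxE eqxx scale1r big1 ?addr0// => a ai.
by rewrite mxE eq_sym (negbTE ai) scale0r.
Qed.

Lemma row_comb_sum (V : lmodType R) (I : finType) Q (F : I -> 'I_n -> V) i :
  \sum_l row_comb Q (F l) i = row_comb Q (fun a => \sum_l F l a) i.
Proof. by rewrite exchange_big; apply: eq_bigr => a _; rewrite scaler_sumr. Qed.

Section Bilinear.
Variables (U V W : lmodType R) (B : {bilinear U -> V -> W}).
Variables (Q : 'M[R]_n) (v : 'I_n -> U) (w : 'I_n -> V).

Lemma bilinear_row_comb i k :
  B (row_comb Q v i) (row_comb Q w k) =
  row_comb Q (fun a => row_comb Q (fun b => B (v a) (w b)) k) i.
Proof.
rewrite linear_sumlz; apply: eq_bigr => a _; rewrite linearZl_LR linear_sumr; congr (_ *: _).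
by apply: eq_bigr => b _; rewrite linearZr_LR.
Qed.

Lemma bilinear_row_comb_orthogonal : Q^T *m Q = 1%:M ->
  \sum_l B (row_comb Q v l) (row_comb Q w l) = \sum_a B (v a) (w a).
Proof.
move=> QQ; have Q_col a b : \sum_l Q l a * Q l b = (a == b)%:R.
  have /matrixP/(_ a b) := QQ; rewrite !mxE => <-.
  by apply: eq_bigr => l _; rewrite mxE.
under eq_bigr do rewrite bilinear_row_comb.
rewrite exchange_big /=; apply: eq_bigr => a _.
under eq_bigr do rewrite scaler_sumr.
rewrite exchange_big /= (bigD1 a)//= [X in _ + X]big1 => [|b ba].
  by under eq_bigr do rewrite scalerA; rewrite -scaler_suml Q_col eqxx scale1r addr0.
by under eq_bigr do rewrite scalerA; rewrite -scaler_suml Q_col eq_sym (negbTE ba) scale0r.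
Qed.

End Bilinear.

End RowCombination.

Section ProjectiveSpace.
Variables (R : realType) (j n : nat).
Local Notation pmx := (proj_mx R j n).
Local Notation pt := (proj_pt R j n).
Local Notation one := (cd_one R j).
Implicit Types (P : pmx) (x y u : pt) (v w : 'cV[R]_n.+1) (Q : 'M[R]_n.+1).

Definition entry x i k : CD R j := proj1_sig x i k.
Arguments entry : simpl never.

Definition diag x i : R := cd_re (entry x i i).

Definition inner x y : R := proj_inner (proj1_sig x) (proj1_sig y).

Lemma proj_innerE P P' : proj_inner P P' = \sum_i \sum_k cdot (P i k) (P' i k).
Proof. by apply: eq_bigr => i _; apply: eq_bigr => k _; rewrite cd_re_mul cd_conjK. Qed.

Lemma innerE x y : inner x y = \sum_i \sum_k cdot (entry x i k) (entry y i k).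
Proof. exact: proj_innerE. Qed.

Lemma proj_pt_ext x y : (forall i k, entry x i k = entry y i k) -> x = y.
Proof.
case: x y => [P ptP] [P' ptP'] PP'.
have {}PP' : P = P' by apply/funext => i; apply/funext => k; exact: PP'.
by subst P'; congr exist; exact: Prop_irrelevance.
Qed.

Lemma entry_conj x i k : entry x k i = (entry x i k)^conj.
Proof. by case: x => P []. Qed.

Lemma entry_idem x i k : \sum_l entry x i l ** entry x l k = entry x i k.
Proof. by case: x => P []. Qed.

Lemma entry_diag x i : entry x i i = diag x i *: one.
Proof. by apply: cd_self_conj; rewrite -entry_conj. Qed.

Lemma diag_sum x : \sum_i diag x i = 1.
Proof. by case: x => P []. Qed.

Lemma diag_norm x i : diag x i = \sum_l cdot (entry x i l) (entry x i l).
Proof.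
rewrite /diag -entry_idem -cdot1l cdotC cdot_suml; apply: eq_bigr => l _.
by rewrite cdotC cdot1l cd_re_mul -entry_conj.
Qed.

Lemma diag_ge0 x i : 0 <= diag x i.
Proof. by rewrite diag_norm sumr_ge0// => l _; exact: cdot_ge0. Qed.

Lemma diag_le1 x i : diag x i <= 1.
Proof. by rewrite -(diag_sum x) (bigD1 i)//= lerDl sumr_ge0// => k _; exact: diag_ge0. Qed.

Lemma exists_diag_gt0 x : exists i, 0 < diag x i.
Proof.
apply: contrapT => /forallNP diag_le0.
have : \sum_i diag x i = 0.
  by apply: big1 => i _; apply/eqP; rewrite eq_le diag_ge0 andbT leNgt; exact/negP.
by rewrite diag_sum => /eqP; rewrite oner_eq0.
Qed.

Lemma inner_self x : inner x x = 1.
Proof. by rewrite innerE -(diag_sum x); apply: eq_bigr => i _; rewrite diag_norm. Qed.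

Lemma is_proj_pt_norm P : (forall i k, P k i = (P i k)^conj) ->
  (forall i k, \sum_l P i l ** P l k = P i k) -> proj_inner P P = 1 -> is_proj_pt P.
Proof.
move=> P_conj P_idem P_norm; split=> //; rewrite -[RHS]P_norm proj_innerE.
apply: eq_bigr => i _; rewrite -[in LHS]P_idem -cdot1l cdotC cdot_suml; apply: eq_bigr => l _.
by rewrite cdotC cdot1l cd_re_mul (P_conj i l) cd_conjK.
Qed.

Lemma is_proj_pt_rank1 P (d : 'I_n.+1 -> R) : (forall i k, P k i = (P i k)^conj) ->
  (forall i k l, P i k ** P k l = d k *: P i l) -> (forall i, P i i = d i *: one) ->
  \sum_i d i = 1 -> is_proj_pt P.
Proof.
move=> P_conj P_rank1 P_diag d_sum; split=> // [i k|].
  rewrite -[LHS]/(\sum_l (P i l ** P l k)).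
  by under eq_bigr do rewrite P_rank1; rewrite -scaler_suml d_sum scale1r.
by under eq_bigr do rewrite P_diag cd_reZ1.
Qed.

Lemma isometry_inner g : isometry inner g -> isometry (@proj_rho R j n) g.
Proof. by move=> [bij_g isom_g]; split=> // x y; rewrite /proj_rho -!/(inner _ _) isom_g. Qed.

Section RankOne.
Hypothesis j_le3 : (j <= 3)%N.
Variables (x : pt) (k : 'I_n.+1).
Let r := diag x k.
Let minor i l := r *: entry x i l - entry x i k ** entry x k l.

Lemma sum_row_norm : \sum_l cdot (entry x k l) (entry x k l) = r.
Proof. by rewrite -diag_norm. Qed.

Lemma sum_col_norm : \sum_i cdot (entry x i k) (entry x i k) = r.
Proof. by rewrite -sum_row_norm; apply: eq_bigr => i _; rewrite (entry_conj x k i) cdot_conj. Qed.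

Lemma sum_minor_cross :
  \sum_i \sum_l cdot (entry x i l) (entry x i k ** entry x k l) = r.
Proof.
rewrite -sum_col_norm; apply: eq_bigr => i _.
transitivity (\sum_l cdot (entry x i l ** entry x l k) (entry x i k)).
  by apply: eq_bigr => l _; rewrite cdot_mull// -entry_conj.
by rewrite -cdot_suml entry_idem.
Qed.

Lemma sum_minor_norm : \sum_i \sum_l cdot (minor i l) (minor i l) = 0.
Proof.
transitivity (\sum_i \sum_l (r ^+ 2 * cdot (entry x i l) (entry x i l)
    - 2 * r * cdot (entry x i l) (entry x i k ** entry x k l)
    + cdot (entry x i k) (entry x i k) * cdot (entry x k l) (entry x k l))).
  apply: eq_bigr => i _; apply: eq_bigr => l _; rewrite -cd_norm_mul// /minor.
  rewrite !(cdotDl, cdotDr, cdotNl, cdotNr, cdotZl, cdotZr).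
  by rewrite (cdotC (_ ** _) (entry x i l)); ring.
under eq_bigr do rewrite big_split sumrB /= -!mulr_sumr.
rewrite big_split sumrB /= -!mulr_sumr -mulr_suml sum_minor_cross sum_row_norm sum_col_norm.
by rewrite -innerE inner_self; ring.
Qed.

(* No associativity is needed: the squared norms of the minors through the pivot sum to zero. *)
Lemma entry_mul i l : entry x i k ** entry x k l = diag x k *: entry x i l.
Proof.
have minor_row_ge0 i' : true -> 0 <= \sum_l cdot (minor i' l) (minor i' l).
  by move=> _; apply: sumr_ge0 => l' _; exact: cdot_ge0.
have minor_ge0 l' : true -> 0 <= cdot (minor i l') (minor i l') by move=> _; exact: cdot_ge0.
have minor_row0 := psumr_eq0P minor_row_ge0 sum_minor_norm (i := i) isT.
have /cdot_eq0/eqP := psumr_eq0P minor_ge0 minor_row0 (i := l) isT.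
by rewrite subr_eq0 => /eqP.
Qed.

End RankOne.

Lemma entry_norm x i k : (j <= 3)%N -> cdot (entry x i k) (entry x i k) = diag x i * diag x k.
Proof.
move=> j_le3; have := entry_mul j_le3 x k i i; rewrite (entry_conj x i k) cd_mul_conj entry_diag.
by rewrite scalerA => /(congr1 (@cd_re R j)); rewrite !cd_reZ1 mulrC.
Qed.

Lemma cd_norm_entry x i k : (j <= 3)%N ->
  cd_norm (entry x i k) = Num.sqrt (diag x i) * Num.sqrt (diag x k).
Proof. by move=> j_le3; rewrite /cd_norm entry_norm// sqrtrM// diag_ge0. Qed.

Definition orthogonal_act Q P : pmx :=
  fun i k => row_comb Q (fun a => row_comb Q (P a) k) i.

Section OrthogonalAction.
Variable Q : 'M[R]_n.+1.
Hypothesis QQ : Q^T *m Q = 1%:M.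

Lemma orthogonal_act_inner P P' :
  proj_inner (orthogonal_act Q P) (orthogonal_act Q P') = proj_inner P P'.
Proof.
have cdot_row_comb (p q : 'I_n.+1 -> CD R j) :
    \sum_l cdot (row_comb Q p l) (row_comb Q q l) = \sum_a cdot (p a) (q a).
  exact (bilinear_row_comb_orthogonal (@cdot R j : {bilinear CD R j -> CD R j -> R^o}) p q QQ).
rewrite !proj_innerE exchange_big /=.
under eq_bigr do rewrite cdot_row_comb.
by rewrite exchange_big; apply: eq_bigr => a _; exact: cdot_row_comb.
Qed.

Lemma orthogonal_act_pt P : is_proj_pt P -> is_proj_pt (orthogonal_act Q P).
Proof.
move=> ptP; pose x : pt := exist _ P ptP; apply: is_proj_pt_norm.
- move=> i k; rewrite /orthogonal_act linear_row_comb row_comb_exchange; apply: eq_row_comb => a.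
  by rewrite /= linear_row_comb; apply: eq_row_comb => b; exact: (entry_conj x).
- move=> i k; rewrite /orthogonal_act.
  under eq_bigr do rewrite row_comb_exchange.
  rewrite (bilinear_row_comb_orthogonal (@cd_mul R j))//.
  under eq_bigr do rewrite (bilinear_row_comb (@cd_mul R j)).
  rewrite row_comb_sum; apply: eq_row_comb => a; rewrite row_comb_sum; apply: eq_row_comb => b.
  exact: (entry_idem x).
- by rewrite orthogonal_act_inner; exact: (inner_self x).
Qed.

End OrthogonalAction.

Definition outer_mx (w : 'I_n.+1 -> CD R j) : pmx := fun i k => w i ** (w k)^conj.

Lemma outer_mx_pt (w : 'I_n.+1 -> CD R j) :
  (forall i k l, outer_mx w i k ** outer_mx w k l = cdot (w k) (w k) *: outer_mx w i l) ->
  \sum_i cdot (w i) (w i) = 1 -> is_proj_pt (outer_mx w).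
Proof.
move=> w_assoc w_norm; apply: (is_proj_pt_rank1 (d := fun i => cdot (w i) (w i))) => //.
  by move=> i k; rewrite /outer_mx cd_conjM cd_conjK.
by move=> i; exact: cd_mul_conj.
Qed.

Lemma real_outer_mx v i k :
  outer_mx (fun l => v l 0 *: one) i k = (v i 0 * v k 0) *: one.
Proof. by rewrite /outer_mx cd_conjZ cd_conj1 cd_mulZl cd_mulZr cd_mul1l scalerA. Qed.

Lemma real_outer_mx_pt v : dot v v = 1 -> is_proj_pt (outer_mx (fun i => v i 0 *: one)).
Proof.
move=> v1; apply: outer_mx_pt => [i k l|].
  rewrite !real_outer_mx cdotZl cdotZr cdot_one cd_mulZl cd_mulZr cd_mul1l !scalerA.
  by congr (_ *: _); ring.
by rewrite -v1; apply: eq_bigr => i _; rewrite cdotZl cdotZr cdot_one mulr1.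
Qed.

Definition ray v (v1 : dot v v = 1) : pt := exist _ _ (real_outer_mx_pt v1).

Lemma entry_ray v (v1 : dot v v = 1) i k : entry (ray v1) i k = (v i 0 * v k 0) *: one.
Proof. exact: real_outer_mx. Qed.

Lemma orthogonal_actK Q P i k : Q *m Q = 1%:M ->
  orthogonal_act Q (orthogonal_act Q P) i k = P i k.
Proof.
move=> QQ; transitivity (row_comb Q (row_comb Q (P ^~ k)) i).
  apply: eq_row_comb => a; rewrite -row_comb_exchange; apply: eq_row_comb => b.
  by rewrite row_comb_comp QQ row_comb1.
by rewrite row_comb_comp QQ row_comb1.
Qed.

Lemma orthogonal_act_outer_mx Q v i k : orthogonal_act Q (outer_mx (fun l => v l 0 *: one)) i k =
  outer_mx (fun l => (Q *m v) l 0 *: one) i k.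
Proof.
have row_comb_real l : row_comb Q (fun a => v a 0 *: one) l = (Q *m v) l 0 *: one.
  by rewrite mxE scaler_suml; apply: eq_bigr => a _; rewrite scalerA.
rewrite /outer_mx -!row_comb_real linear_row_comb (bilinear_row_comb (@cd_mul R j)).
by [].
Qed.

Lemma exists_isometry_reflection Q : reflection_mx Q ->
  exists2 g, isometry inner g & forall v w (v1 : dot v v = 1) (w1 : dot w w = 1),
    Q *m v = w -> g (ray v1) = ray w1.
Proof.
move=> [QT QQ]; have QtQ : Q^T *m Q = 1%:M by rewrite QT.
pose g x : pt := exist _ _ (orthogonal_act_pt QtQ (proj2_sig x)).
have gK : involutive g by move=> x; apply: proj_pt_ext => i k; exact: orthogonal_actK.
exists g; first by split; [exists g|move=> x y; exact: orthogonal_act_inner].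
by move=> v w v1 w1 Qv; apply: proj_pt_ext => i k; rewrite /entry /= orthogonal_act_outer_mx Qv.
Qed.

Lemma exists_isometry_ray v w (v1 : dot v v = 1) (w1 : dot w w = 1) :
  exists2 g, isometry inner g & g (ray v1) = ray w1 /\
    forall v' (v1' : dot v' v' = 1), dot (v - w) v' = 0 -> g (ray v1') = ray v1'.
Proof.
have [Q [Q_refl Qv Q_fix]] := exists_reflection (etrans v1 (esym w1)).
have [g isom_g gray] := exists_isometry_reflection Q_refl.
by exists g => //; split=> [|v' v1' v'_orth]; apply: gray => //; exact: Q_fix.
Qed.

Definition vertex l : pt := ray (dot_delta_self R l).

Lemma entry_vertex l i k : entry (vertex l) i k = ((i == l) && (k == l))%:R *: one.
Proof. by rewrite entry_ray !mxE eqxx !andbT -natrM mulnb. Qed.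

Lemma inner_vertex l u : inner (vertex l) u = diag u l.
Proof.
have entry0 i k : (i != l) || (k != l) -> entry (vertex l) i k = 0.
  by rewrite entry_vertex -negb_and => /negbTE ->; rewrite scale0r.
rewrite innerE (bigD1 l)//= [X in _ + X]big1 ?addr0 => [|i il]; last first.
  by rewrite big1// => k _; rewrite entry0 ?il// cdot0l.
rewrite (bigD1 l)//= big1 ?addr0 => [|k kl]; last by rewrite entry0 ?kl ?orbT// cdot0l.
by rewrite entry_vertex eqxx scale1r cdot1l.
Qed.

Definition root_diag x : 'cV[R]_n.+1 := \col_i Num.sqrt (diag x i).

Lemma root_diag_dot x : dot (root_diag x) (root_diag x) = 1.
Proof.
by rewrite -(diag_sum x); apply: eq_bigr => i _; rewrite mxE -expr2 sqr_sqrtr// diag_ge0.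
Qed.

Lemma real_row_ray x k : (j <= 3)%N -> 0 < diag x k ->
  (forall l, exists2 r, 0 <= r & entry x k l = r *: one) -> x = ray (root_diag_dot x).
Proof.
move=> j_le3 dk_gt0 row_real.
have rowE l : entry x k l = (Num.sqrt (diag x k) * Num.sqrt (diag x l)) *: one.
  have [r r_ge0 xE] := row_real l.
  by rewrite -cd_norm_entry// xE /cd_norm cdotZl cdotZr cdot_one mulr1 -expr2 sqrtr_sqr ger0_norm.
apply: proj_pt_ext => i l; apply: (@scalerI _ _ (diag x k)); first by rewrite gt_eqF.
rewrite -entry_mul// entry_conj !rowE cd_conjZ cd_conj1 cd_mulZl cd_mulZr cd_mul1l.
rewrite entry_ray !mxE !scalerA; congr (_ *: _).
by rewrite -[X in _ = X * _]sqr_sqrtr ?diag_ge0//; ring.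
Qed.

Definition vertex_isometry g := isometry inner g /\ forall l, g (vertex l) = vertex l.

Lemma vertex_isometry_comp g h : vertex_isometry g -> vertex_isometry h -> vertex_isometry (g \o h).
Proof.
move=> [isom_g fix_g] [isom_h fix_h]; split; first exact: isometry_comp.
by move=> l; rewrite /= fix_h fix_g.
Qed.

Lemma vertex_isometry_diag g x : vertex_isometry g -> diag (g x) =1 diag x.
Proof. by move=> [isom_g fix_g] l; rewrite -!inner_vertex -{1}fix_g isom_g.2. Qed.

Lemma vertex_isometry_ray g x k : (j <= 3)%N -> vertex_isometry g -> 0 < diag x k ->
  (forall l, exists2 r, 0 <= r & entry (g x) k l = r *: one) -> g x = ray (root_diag_dot x).
Proof.
move=> j_le3 vert_g dk_gt0 row_real; have diag_g := vertex_isometry_diag x vert_g.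
rewrite (real_row_ray (x := g x) (k := k)) ?diag_g//; apply: proj_pt_ext => i l.
by rewrite !entry_ray !mxE !diag_g.
Qed.

Definition straightenable :=
  forall x, exists2 g, vertex_isometry g & g x = ray (root_diag_dot x).

End ProjectiveSpace.

Section ProjectiveFrame.
Variables (R : realType) (j n : nat).
Local Notation pt := (proj_pt R j n.+1).
Local Notation one := (cd_one R j).
Local Notation dist := (@proj_rho R j n.+1).
Local Notation vertex := (@vertex R j n.+1).
Local Notation i0 := (ord0 : 'I_n.+2).
Local Notation i1 := (lift ord0 ord0 : 'I_n.+2).
Implicit Types (x y u : pt) (a b : R) (c : CD R j).

Lemma sum_plane (V : nmodType) (F : 'I_n.+2 -> V) :
  (forall i, i != i0 -> i != i1 -> F i = 0) -> \sum_i F i = F i0 + F i1.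
Proof.
move=> F0; rewrite (bigD1 i0)//= (bigD1 i1)//= big1 ?addr0// => i /andP[i_neq0 i_neq1].
exact: F0.
Qed.

(* The conjugate makes [a *: c] the entry at [(i0, i1)]. *)
Definition plane_coord a c (i : 'I_n.+2) : CD R j :=
  if i == i0 then a *: one else if i == i1 then c^conj else 0.

Lemma plane_coord0 a c i : i != i0 -> i != i1 -> plane_coord a c i = 0.
Proof. by rewrite /plane_coord => /negbTE -> /negbTE ->. Qed.

Lemma plane_coord_cases a c i :
  [\/ plane_coord a c i = a *: one, plane_coord a c i = c^conj | plane_coord a c i = 0].
Proof.
rewrite /plane_coord; case: (i == i0); first by constructor 1.
by case: (i == i1); [constructor 2|constructor 3].
Qed.

Hypothesis j_le3 : (j <= 3)%N.

Lemma plane_coord_rank1 a c i k l : let w := plane_coord a c in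
  outer_mx w i k ** outer_mx w k l = cdot (w k) (w k) *: outer_mx w i l.
Proof.
rewrite /outer_mx /=; have [wk|wk|wk] := plane_coord_cases a c k; rewrite wk.
- rewrite cd_conjZ cd_conj1 cd_mulZr cd_mul1r !cd_mulZl cd_mul1l cd_mulZr scalerA.
  by rewrite cdotZl cdotZr cdot_one mulr1.
- rewrite cd_conjK cdot_conj; have [wi|wi|wi] := plane_coord_cases a c i; rewrite wi.
  + by rewrite !cd_mulZl !cd_mul1l cd_mulVKl// scalerA mulrC -scalerA.
  + by rewrite cd_conj_mul cd_mulZl cd_mul1l.
  + by rewrite !cd_mul0l scaler0.
- by rewrite cd_mul0l cd_mul0r cdot0l scale0r.
Qed.

Lemma plane_coord_norm a c :
  \sum_i cdot (plane_coord a c i) (plane_coord a c i) = a ^+ 2 + cdot c c.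
Proof.
rewrite sum_plane => [|i i_neq0 i_neq1]; last by rewrite plane_coord0// cdot0l.
by rewrite /plane_coord /= cdotZl cdotZr cdot_one cdot_conj mulr1.
Qed.

Lemma plane_mx_pt a c : a ^+ 2 + cdot c c = 1 -> is_proj_pt (outer_mx (plane_coord a c)).
Proof.
move=> ac1; apply: outer_mx_pt; last by rewrite plane_coord_norm.
by move=> i k l; exact: plane_coord_rank1.
Qed.

Definition plane_pt a c (ac1 : a ^+ 2 + cdot c c = 1) : pt := exist _ _ (plane_mx_pt ac1).

Lemma entry_plane a c (ac1 : a ^+ 2 + cdot c c = 1) i k :
  entry (plane_pt ac1) i k = plane_coord a c i ** (plane_coord a c k)^conj.
Proof. by []. Qed.

Lemma inner_plane a c (ac1 : a ^+ 2 + cdot c c = 1) u : inner (plane_pt ac1) u =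
  a ^+ 2 * diag u i0 + cdot c c * diag u i1 + 2 * a * cdot c (entry u i0 i1).
Proof.
rewrite innerE sum_plane => [|i i_neq0 i_neq1]; last first.
  by rewrite big1// => k _; rewrite entry_plane plane_coord0// cd_mul0l cdot0l.
have sum_row i : \sum_k cdot (entry (plane_pt ac1) i k) (entry u i k) =
    cdot (entry (plane_pt ac1) i i0) (entry u i i0) +
    cdot (entry (plane_pt ac1) i i1) (entry u i i1).
  apply: sum_plane => k k_neq0 k_neq1.
  by rewrite entry_plane [plane_coord a c k]plane_coord0// linear0 cd_mul0r cdot0l.
rewrite !sum_row !entry_plane.
rewrite /plane_coord /= (entry_conj u i0 i1) !entry_diag.
rewrite !cd_conjZ cd_conj1 cd_conjK !(cd_mulZl, cd_mulZr, cd_mul1l, cd_mul1r) cd_conj_mul.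
by rewrite !(cdotZl, cdotZr) cdot_conj !cdot_one; ring.
Qed.

Lemma diag_plane a c (ac1 : a ^+ 2 + cdot c c = 1) i :
  diag (plane_pt ac1) i = cdot (plane_coord a c i) (plane_coord a c i).
Proof. by rewrite /diag entry_plane cd_mul_conj cd_reZ1. Qed.

Lemma plane_vec_coord a b i : plane_vec a b i 0 *: one = plane_coord a (b *: one) i.
Proof.
rewrite plane_vecE /plane_coord cd_conjZ cd_conj1.
by case: (eqVneq i i0) => [->|_] /=; [rewrite mulr1 mulr0 addr0|rewrite mulr0 add0r];
  case: (i == i1); rewrite ?mulr1 ?mulr0 ?scale0r.
Qed.

Lemma inner_ray_plane a b (ab1 : a ^+ 2 + b ^+ 2 = 1) u : inner (ray j (plane_vec_dot ab1)) u =
  a ^+ 2 * diag u i0 + b ^+ 2 * diag u i1 + 2 * a * b * cdot one (entry u i0 i1).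
Proof.
have bE : cdot (b *: one) (b *: one) = b ^+ 2 by rewrite cdotZl cdotZr cdot_one mulr1.
have ac1 : a ^+ 2 + cdot (b *: one) (b *: one) = 1 by rewrite bE.
have -> : ray j (plane_vec_dot ab1) = plane_pt ac1.
  by apply: proj_pt_ext => i k; rewrite entry_plane -!plane_vec_coord.
by rewrite inner_plane bE cdotZl mulrA.
Qed.

Lemma edge_pt_subproof c : cdot c c = 1 ->
  Num.sqrt 2^-1 ^+ 2 + cdot (Num.sqrt 2^-1 *: c) (Num.sqrt 2^-1 *: c) = 1.
Proof. by move=> c1; rewrite cdotZl cdotZr c1 mulr1 -expr2 sqr_sqrtr ?invr_ge0//; field. Qed.

Definition edge_pt c (c1 : cdot c c = 1) : pt := plane_pt (edge_pt_subproof c1).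

Lemma inner_edge c (c1 : cdot c c = 1) u :
  inner (edge_pt c1) u = (diag u i0 + diag u i1) / 2 + cdot c (entry u i0 i1).
Proof.
have half : Num.sqrt 2^-1 ^+ 2 = 2^-1 :> R by rewrite sqr_sqrtr ?invr_ge0.
rewrite inner_plane !(cdotZl, cdotZr) c1 mulr1 -[_ * Num.sqrt _]expr2 half.
have -> : 2 * Num.sqrt 2^-1 * (Num.sqrt 2^-1 * cdot c (entry u i0 i1)) =
    2 * Num.sqrt 2^-1 ^+ 2 * cdot c (entry u i0 i1) by ring.
by rewrite half; field.
Qed.

Lemma diag_edge c c' (c1 : cdot c c = 1) (c'1 : cdot c' c' = 1) :
  diag (edge_pt c1) =1 diag (edge_pt c'1).
Proof.
move=> i; rewrite !diag_plane /plane_coord; case: (i == i0) => //; case: (i == i1) => //.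
by rewrite !cdot_conj !(cdotZl, cdotZr) c1 c'1.
Qed.

Hypothesis straight : straightenable R j n.+1.

Lemma exists_vertex_isometry_edge c c' (c1 : cdot c c = 1) (c'1 : cdot c' c' = 1) :
  exists2 g, vertex_isometry g & g (edge_pt c1) = edge_pt c'1.
Proof.
have [g [isom_g fix_g] gE] := straight (edge_pt c1).
have [h [isom_h fix_h] hE] := straight (edge_pt c'1).
have [h' isom_h' [hK _]] := isometry_inv isom_h.
exists (h' \o g); first split; first exact: isometry_comp.
  by move=> l /=; rewrite fix_g -{1}fix_h hK.
rewrite /= gE -[RHS]hK hE; congr h'; apply: proj_pt_ext => i k.
by rewrite !entry_ray !mxE !(diag_edge c1 c'1).
Qed.

Lemma sqrt_circle a : 0 <= a <= 1 -> Num.sqrt a ^+ 2 + Num.sqrt (1 - a) ^+ 2 = 1.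
Proof. by case/andP=> a_ge0 a_le1; rewrite !sqr_sqrtr ?subr_ge0// addrC subrK. Qed.

(* Straighten [x], reflect it to the first vertex, straighten the image of [y], and reflect the
   result into the plane of the first two coordinates. *)
Lemma standard_position x y : 0 <= inner x y <= 1 /\
  exists2 g, isometry (@inner R j n.+1) g & g x = vertex i0 /\
    forall ab1 : Num.sqrt (inner x y) ^+ 2 + Num.sqrt (1 - inner x y) ^+ 2 = 1,
    g y = ray j (plane_vec_dot ab1).
Proof.
have [straight_x [isom_sx _] sxE] := straight x.
have [to_vertex isom_tv [tvE _]] := exists_isometry_ray j (root_diag_dot x) (dot_delta_self R i0).
pose y' := to_vertex (straight_x y).
have x'E : to_vertex (straight_x x) = vertex i0 by rewrite sxE tvE.
have [straight_y [isom_sy fix_sy] syE] := straight y'.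
have innerE' : inner x y = diag y' i0 by rewrite -inner_vertex -x'E isom_tv.2 isom_sx.2.
have inner_itv : 0 <= inner x y <= 1 by rewrite innerE' diag_ge0 diag_le1.
split=> //; have circle := sqrt_circle inner_itv.
have [to_plane isom_tp [tpE tp_fix]] :=
  exists_isometry_ray j (root_diag_dot y') (plane_vec_dot circle).
exists (to_plane \o (straight_y \o (to_vertex \o straight_x))).
  by do 3! apply: isometry_comp => //.
split=> [|ab1] /=; last by rewrite -/y' syE tpE (Prop_irrelevance ab1 circle).
rewrite x'E fix_sy; apply: tp_fix.
rewrite dotBl !(dotC _ (delta_mx _ _)) !dot_delta plane_vecE mxE innerE' /=.
by rewrite mulr1 mulr0 addr0 subrr.
Qed.

Lemma half_cos_proj x y : half_cos dist x y = inner x y.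
Proof.
have [/andP[inner_ge0 inner_le1] _] := standard_position x y.
rewrite /half_cos /proj_rho -/(inner x y) acosK; first by field.
by rewrite in_itv/=; apply/andP; split; lra.
Qed.

Lemma edge_coord_proj c (c1 : cdot c c = 1) u :
  edge_coord dist (vertex i0) (vertex i1) (edge_pt c1) u = cdot c (entry u i0 i1).
Proof. by rewrite /edge_coord !half_cos_proj inner_edge !inner_vertex addrC addKr. Qed.

Lemma cd_basis_unit (m : cd_index j) : cdot (cd_basis R m) (cd_basis R m) = 1.
Proof. by rewrite cd_basis_dot eqxx. Qed.

Definition basis_edge (m : cd_index j) : pt := edge_pt (cd_basis_unit m).

Lemma edge_coord_basis_edge m u :
  edge_coord dist (vertex i0) (vertex i1) (basis_edge m) u = cdot (cd_basis R m) (entry u i0 i1).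
Proof. exact: edge_coord_proj. Qed.

Lemma proj_frame_product u : half_cos dist (vertex i0) u * half_cos dist (vertex i1) u =
  \sum_m edge_coord dist (vertex i0) (vertex i1) (basis_edge m) u ^+ 2.
Proof.
under eq_bigr do rewrite edge_coord_basis_edge.
by rewrite cd_basis_parseval entry_norm// !half_cos_proj !inner_vertex.
Qed.

Lemma proj_frame_rotate (a : cd_index j -> R) : \sum_m a m ^+ 2 = 1 ->
  exists2 h, isometry dist h & [/\ h (vertex i0) = vertex i0, h (vertex i1) = vertex i1 &
    forall u, edge_coord dist (vertex i0) (vertex i1) (h (basis_edge (cd_index0 j))) u =
      \sum_m a m * edge_coord dist (vertex i0) (vertex i1) (basis_edge m) u].
Proof.
move=> a1; have c1 := cd_basis_comb_dot a; rewrite a1 in c1.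
have [h [isom_h fix_h] hE] := exists_vertex_isometry_edge (cd_basis_unit (cd_index0 j)) c1.
exists h; first exact: isometry_inner.
split=> // u; rewrite hE edge_coord_proj cdot_suml.
by apply: eq_bigr => m _; rewrite cdotZl edge_coord_basis_edge.
Qed.

Lemma proj_frame_line a b : a ^+ 2 + b ^+ 2 = 1 -> exists2 h, isometry dist h & forall u,
  half_cos dist (h (vertex i0)) u =
  a ^+ 2 * half_cos dist (vertex i0) u + b ^+ 2 * half_cos dist (vertex i1) u +
  2 * a * b * edge_coord dist (vertex i0) (vertex i1) (basis_edge (cd_index0 j)) u.
Proof.
move=> ab1.
have [h isom_h [hE _]] := exists_isometry_ray j (dot_delta_self R i0) (plane_vec_dot ab1).
exists h => [|u]; first exact: isometry_inner.
by rewrite !half_cos_proj edge_coord_basis_edge cd_basis0 hE inner_ray_plane !inner_vertex.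
Qed.

Lemma proj_frame_sum u :
  half_cos dist (vertex i0) u + \sum_l half_cos dist (vertex (lift ord0 l)) u = 1.
Proof.
rewrite half_cos_proj inner_vertex -[RHS](diag_sum u) [RHS]big_ord_recl; congr (_ + _).
by apply: eq_bigr => l _; rewrite half_cos_proj inner_vertex.
Qed.

Lemma proj_frame_swap l : exists2 h, isometry dist h &
  h (vertex i0) = vertex i0 /\ h (vertex i1) = vertex (lift ord0 l).
Proof.
have [h isom_h [hE h_fix]] :=
  exists_isometry_ray j (dot_delta_self R i1) (dot_delta_self R (lift ord0 l)).
exists h; first exact: isometry_inner.
by split=> //; apply: h_fix; rewrite dotBl !dot_delta !mxE /= subr0.
Qed.

Lemma proj_frame_pair x y : exists2 h, isometry dist h & h (vertex i0) = x /\
  exists2 y0, h y0 = y & forall u, half_cos dist y0 u =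
    half_cos dist x y * half_cos dist (vertex i0) u +
    (1 - half_cos dist x y) * half_cos dist (vertex i1) u +
    2 * Num.sqrt (half_cos dist x y) * Num.sqrt (1 - half_cos dist x y) *
    edge_coord dist (vertex i0) (vertex i1) (basis_edge (cd_index0 j)) u.
Proof.
have [inner_itv [g isom_g [gx gy]]] := standard_position x y.
have circle := sqrt_circle inner_itv; have /andP[inner_ge0 inner_le1] := inner_itv.
have [h isom_h [gK _]] := isometry_inv isom_g.
exists h; first exact: isometry_inner.
split; first by rewrite -gx gK.
exists (ray j (plane_vec_dot circle)) => [|u]; first by rewrite -gy gK.
rewrite !half_cos_proj edge_coord_basis_edge cd_basis0 !inner_vertex inner_ray_plane.
by rewrite !sqr_sqrtr ?subr_ge0.
Qed.

Lemma proj_isotropic_frame :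
  isotropic_frame dist (cd_index0 j) (vertex i0) (fun l => vertex (lift ord0 l)) basis_edge.
Proof.
split; [exact: proj_frame_product|exact: proj_frame_rotate|exact: proj_frame_line|
  exact: proj_frame_sum|exact: proj_frame_swap|exact: proj_frame_pair].
Qed.

End ProjectiveFrame.

Section AssociativeStraightening.
Variables (R : realType) (j n : nat).
Hypothesis j_le2 : (j <= 2)%N.
Local Notation pt := (proj_pt R j n).
Local Notation one := (cd_one R j).
Let j_le3 : (j <= 3)%N. Proof. exact: leq_trans j_le2 _. Qed.
Let mulA := @cd_mulA R j j_le2.

Definition phase_mx (a : 'I_n.+1 -> CD R j) (P : proj_mx R j n) : proj_mx R j n :=
  fun i k => (a i ** P i k) ** (a k)^conj.

Section UnitPhases.
Variable a : 'I_n.+1 -> CD R j.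
Hypothesis a1 : forall i, cdot (a i) (a i) = 1.

Lemma phase_mx_inner P P' : proj_inner (phase_mx a P) (phase_mx a P') = proj_inner P P'.
Proof.
rewrite !proj_innerE; apply: eq_bigr => i _; apply: eq_bigr => k _.
by rewrite cdot_mul2r// cdot_mul2l// cdot_conj !a1 !mul1r.
Qed.

Lemma phase_mx_pt P : is_proj_pt P -> is_proj_pt (phase_mx a P).
Proof.
move=> ptP; pose x : pt := exist _ P ptP; apply: is_proj_pt_norm => [i k|i k|].
- by rewrite /phase_mx !cd_conjM cd_conjK -(entry_conj x) mulA.
- rewrite /phase_mx -[P i k]/(entry x i k) -entry_idem linear_sumr linear_sumlz /=.
  apply: eq_bigr => l _.
  rewrite -!mulA; congr (_ ** (_ ** _)).
  by rewrite !mulA cd_conj_mul a1 scale1r cd_mul1l.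
- by rewrite phase_mx_inner; exact: (inner_self x).
Qed.

Lemma phase_mxK P i k : phase_mx (fun l => (a l)^conj) (phase_mx a P) i k = P i k.
Proof.
rewrite /phase_mx cd_conjK -!mulA cd_conj_mul a1 scale1r cd_mul1r.
by rewrite mulA cd_conj_mul a1 scale1r cd_mul1l.
Qed.

End UnitPhases.

Lemma exists_vertex_isometry_phase (a : 'I_n.+1 -> CD R j) : (forall i, cdot (a i) (a i) = 1) ->
  exists2 g, @vertex_isometry R j n g &
    forall x i k, entry (g x) i k = (a i ** entry x i k) ** (a k)^conj.
Proof.
move=> a1; pose a' i := (a i)^conj; have a'1 i : cdot (a' i) (a' i) = 1 by rewrite cdot_conj.
pose g (x : pt) : pt := exist _ _ (phase_mx_pt a1 (proj2_sig x)).
pose g' (x : pt) : pt := exist _ _ (phase_mx_pt a'1 (proj2_sig x)).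
exists g => //; split; first split.
- exists g' => x; apply: proj_pt_ext => i k; first exact: phase_mxK.
  rewrite -[RHS](phase_mxK a'1) /entry /=.
  by congr (phase_mx _ _ i k); apply/funext => l; rewrite /a' cd_conjK.
- by move=> x y; exact: phase_mx_inner.
move=> l; apply: proj_pt_ext => i k; rewrite -[LHS]/((a i ** entry _ i k) ** _) entry_vertex.
have [/andP[/eqP -> /eqP ->]|_] := boolP ((i == l) && (k == l)).
  by rewrite scale1r cd_mul1r cd_mul_conj a1 scale1r.
by rewrite scale0r cd_mul0r cd_mul0l.
Qed.

Lemma associative_straightenable : straightenable R j n.
Proof.
move=> x; have [k dk_gt0] := exists_diag_gt0 x.
have /choice[a /all_and2[a1 aE]] : forall i, exists a : CD R j, cdot a a = 1 /\
    a ** entry x i k = cd_norm (entry x i k) *: one.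
  by move=> i; have [a a1 aE] := exists_unit_phase (entry x i k); exists a.
have ak1 : a k = one.
  apply: (@scalerI _ _ (diag x k)); first by rewrite gt_eqF.
  have := aE k; rewrite cd_norm_entry// -expr2 sqr_sqrtr ?diag_ge0// entry_diag.
  by rewrite cd_mulZr cd_mul1r.
have [g vert_g gE] := exists_vertex_isometry_phase a1.
exists g => //; apply: (vertex_isometry_ray (k := k)) => // l.
exists (cd_norm (entry x l k)); first exact: sqrtr_ge0.
by rewrite (entry_conj (g x) l k) gE aE ak1 cd_conj1 cd_mul1r cd_conjZ cd_conj1.
Qed.

End AssociativeStraightening.

(** * Triality and the Cayley plane *)

Section ThreeIndices.
Implicit Types i k : 'I_3.

Lemma ord3_addr11 i : i + 1 + 1 = i - 1.
Proof. by rewrite -addrA; congr (_ + _); exact: val_inj. Qed.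

Lemma ord3_subr11 i : i - 1 - 1 = i + 1.
Proof. by rewrite -addrA; congr (_ + _); exact: val_inj. Qed.

Lemma ord3_cases i k : [\/ k = i, k = i + 1 | k = i - 1].
Proof.
by case: i k => [[|[|[|//]]] ?] [[|[|[|//]]] ?];
  solve [constructor 1; exact: val_inj|constructor 2; exact: val_inj|constructor 3; exact: val_inj].
Qed.

Lemma ord3_ind (Pr : 'I_3 -> Prop) : Pr 0 -> Pr 1 -> Pr (- 1) -> forall i, Pr i.
Proof. by move=> Pr0 Pr1 PrN1 i; case: (ord3_cases 0 i) => ->; rewrite ?add0r. Qed.

Lemma ord3_addr1_neq i : (i + 1 == i) = false.
Proof. by rewrite -subr_eq0 addrC addKr. Qed.

Lemma ord3_subr1_neq i : (i - 1 == i) = false.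
Proof. by rewrite -subr_eq0 addrC addKr. Qed.

Lemma ord3_subr1_neq_addr1 i : (i - 1 == i + 1) = false.
Proof. by rewrite -ord3_addr11 ord3_addr1_neq. Qed.

Lemma sum_ord3 (V : nmodType) (F : 'I_3 -> V) i : \sum_k F k = F i + F (i + 1) + F (i - 1).
Proof.
rewrite (bigD1 i)//= (bigD1 (i + 1)) ?ord3_addr1_neq//= (bigD1 (i - 1)) /=; last first.
  by rewrite ord3_subr1_neq ord3_subr1_neq_addr1.
rewrite big1 ?addr0 ?addrA// => k /andP[/andP[/negP k_neq /negP k_neq1] /negP k_neq2].
by case: (ord3_cases i k) => ki; rewrite ki eqxx in k_neq k_neq1 k_neq2.
Qed.

End ThreeIndices.

Section Octonions.
Variable R : realType.
Local Notation O := (CD R 3).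
Local Notation pt := (proj_pt R 3 2).
Local Notation one := (cd_one R 3).
Implicit Types (x y : pt) (i k l : 'I_3) (a b c u z : O).

Definition offdiag x i : O := entry x (i + 1) (i - 1).

Lemma entry_succ x i : entry x i (i + 1) = offdiag x (i - 1).
Proof. by rewrite /offdiag subrK ord3_subr11. Qed.

Lemma entry_pred x i : entry x i (i - 1) = (offdiag x (i + 1))^conj.
Proof. by rewrite -entry_conj /offdiag addrK ord3_addr11. Qed.

Lemma offdiag_mul x i :
  offdiag x i ** offdiag x (i + 1) = diag x (i - 1) *: (offdiag x (i - 1))^conj.
Proof.
by rewrite /offdiag addrK ord3_addr11 entry_mul// subrK ord3_subr11 -entry_conj.
Qed.

Lemma offdiag_norm x i : cdot (offdiag x i) (offdiag x i) = diag x (i + 1) * diag x (i - 1).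
Proof. exact: entry_norm. Qed.

Lemma offdiag_ext x y : diag x =1 diag y -> offdiag x =1 offdiag y -> x = y.
Proof.
move=> diagE offE; apply: proj_pt_ext => i k.
by case: (ord3_cases i k) => ->; rewrite ?entry_diag ?entry_succ ?entry_pred ?diagE ?offE.
Qed.

Lemma inner_offdiag x y :
  inner x y = \sum_i diag x i * diag y i + 2 * \sum_i cdot (offdiag x i) (offdiag y i).
Proof.
transitivity (\sum_i (diag x i * diag y i + cdot (offdiag x (i - 1)) (offdiag y (i - 1)) +
    cdot (offdiag x (i + 1)) (offdiag y (i + 1)))).
  rewrite innerE; apply: eq_bigr => i _; rewrite (sum_ord3 _ i).
  by rewrite !entry_diag !entry_succ !entry_pred cdot_conj cdotZl cdotZr cdot_one mulr1.
rewrite big_split [X in X + _ = _]big_split -addrA; congr (_ + _).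
rewrite mulr_natl mulr2n; congr (_ + _).
  by rewrite [RHS](reindex_inj (addIr (- 1))).
by rewrite [RHS](reindex_inj (addIr 1)).
Qed.

Definition cayley_mx (d : 'I_3 -> R) (e : 'I_3 -> O) : proj_mx R 3 2 := fun i k =>
  if k == i then d i *: one else if k == i + 1 then e (i - 1) else (e (i + 1))^conj.

Section CayleyPoint.
Variables (d : 'I_3 -> R) (e : 'I_3 -> O).

Lemma cayley_mx_diag i : cayley_mx d e i i = d i *: one.
Proof. by rewrite /cayley_mx eqxx. Qed.

Lemma cayley_mx_succ i : cayley_mx d e i (i + 1) = e (i - 1).
Proof. by rewrite /cayley_mx ord3_addr1_neq eqxx. Qed.

Lemma cayley_mx_pred i : cayley_mx d e i (i - 1) = (e (i + 1))^conj.
Proof. by rewrite /cayley_mx ord3_subr1_neq ord3_subr1_neq_addr1. Qed.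

Lemma cayley_mx_conj i k : cayley_mx d e k i = (cayley_mx d e i k)^conj.
Proof.
case: (ord3_cases i k) => ->.
- by rewrite cayley_mx_diag cd_conjZ cd_conj1.
- by rewrite cayley_mx_succ -[X in cayley_mx _ _ _ X](addrK 1 i) cayley_mx_pred ord3_addr11.
- rewrite cayley_mx_pred cd_conjK -[X in cayley_mx _ _ _ X](subrK 1 i) cayley_mx_succ.
  by rewrite ord3_subr11.
Qed.

Hypothesis e_mul : forall i, e i ** e (i + 1) = d (i - 1) *: (e (i - 1))^conj.
Hypothesis e_norm : forall i, cdot (e i) (e i) = d (i + 1) * d (i - 1).

Lemma cayley_mx_norm k i : i != k -> cdot (cayley_mx d e i k) (cayley_mx d e i k) = d i * d k.
Proof.
case: (ord3_cases i k) => ->; first by rewrite eqxx.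
  by rewrite cayley_mx_succ e_norm subrK ord3_subr11.
by rewrite cayley_mx_pred cdot_conj e_norm addrK ord3_addr11 mulrC.
Qed.

Lemma cayley_mx_pred_succ k :
  cayley_mx d e (k - 1) k ** cayley_mx d e k (k + 1) = d k *: cayley_mx d e (k - 1) (k + 1).
Proof.
rewrite -[X in cayley_mx _ _ _ X ** _](subrK 1 k) !cayley_mx_succ -ord3_subr11 cayley_mx_pred subrK.
by rewrite -[X in _ ** e X](ord3_addr11 k) ord3_subr11 e_mul addrK.
Qed.

Lemma cayley_mx_rank1 i k l :
  cayley_mx d e i k ** cayley_mx d e k l = d k *: cayley_mx d e i l.
Proof.
have [->|ik] := eqVneq i k; first by rewrite cayley_mx_diag cd_mulZl cd_mul1l.
have [->|lk] := eqVneq l k; first by rewrite cayley_mx_diag cd_mulZr cd_mul1r.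
have [->|il] := eqVneq i l.
  rewrite (cayley_mx_conj l k) cd_mul_conj cayley_mx_norm// cayley_mx_diag scalerA.
  by rewrite mulrC.
case: (ord3_cases k i) ik il => ->; rewrite ?eqxx//;
  case: (ord3_cases k l) lk => ->; rewrite ?eqxx// => _ _ _.
  apply: (can_inj (@cd_conjK R 3)); rewrite cd_conjM cd_conjZ -!cayley_mx_conj.
  by rewrite cayley_mx_pred_succ.
exact: cayley_mx_pred_succ.
Qed.

Lemma cayley_mx_pt : \sum_i d i = 1 -> is_proj_pt (cayley_mx d e).
Proof.
move=> d_sum; apply: (is_proj_pt_rank1 (d := d)) => //.
- exact: cayley_mx_conj.
- exact: cayley_mx_rank1.
- exact: cayley_mx_diag.
Qed.

End CayleyPoint.

Lemma cdot_mul_cyclic a b c : cdot (a ** b) c^conj = cdot (c ** a) b^conj.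
Proof. by rewrite cdotC cdot_mulr// -cd_conjM -[in RHS]cdot_conj cd_conjK. Qed.

(* The last clause preserves the trilinear form [Re ((a b) c)]. *)
Definition triality (F : 'I_3 -> O -> O) :=
  [/\ forall i, bijective (F i), forall i a b, cdot (F i a) (F i b) = cdot a b
    & forall i a b c,
        cdot (F i a ** F (i + 1) b) (F (i - 1) c)^conj = cdot (a ** b) c^conj].

Lemma triality_comp F G : triality F -> triality G -> triality (fun i => F i \o G i).
Proof.
move=> [bijF normF cycF] [bijG normG cycG]; split=> [i|i a b|i a b c].
- exact: bij_comp.
- by rewrite -[RHS](normG i) -[RHS](normF i).
- by rewrite -[RHS](cycG i) -[RHS](cycF i).
Qed.

Lemma triality_shift F k : triality F -> triality (fun i => F (i - k)).
Proof.
move=> [bijF normF cycF]; split=> [i|i a b|i a b c]; rewrite ?normF//.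
by rewrite [i + 1 - k]addrAC [i - 1 - k]addrAC cycF.
Qed.

Lemma triality_inv F : triality F ->
  exists2 G, triality G & forall i, cancel (F i) (G i) /\ cancel (G i) (F i).
Proof.
move=> [bijF normF cycF].
have /choice[G FG] : forall i, exists g, cancel (F i) g /\ cancel g (F i).
  by move=> i; have [g FK gK] := bijF i; exists g.
have GK i : cancel (G i) (F i) by case: (FG i).
exists G => //; split=> [i|i a b|i a b c].
- by exists (F i); case: (FG i).
- by rewrite -(normF i) !GK.
- by rewrite -(cycF i) !GK.
Qed.

Lemma triality_mul F i a b c r : triality F ->
  a ** b = r *: c^conj -> F i a ** F (i + 1) b = r *: (F (i - 1) c)^conj.
Proof.
move=> [bijF normF cycF] abc; apply: cdot_ext => t; have [g _ FK] := bijF (i - 1).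
rewrite -(cd_conjK t) -(FK t^conj) cycF abc !cdotZl !cdot_conj.
by rewrite normF.
Qed.

Lemma exists_vertex_isometry_triality F : triality F ->
  exists2 G, @vertex_isometry R 3 2 G & forall x i, offdiag (G x) i = F i (offdiag x i).
Proof.
have act H : triality H -> exists G : pt -> pt, forall x,
    diag (G x) =1 diag x /\ forall i, offdiag (G x) i = H i (offdiag x i).
  move=> triH; have [_ normH _] := triH.
  have ptG x : is_proj_pt (cayley_mx (diag x) (fun i => H i (offdiag x i))).
    apply: cayley_mx_pt; last exact: diag_sum.
      by move=> i; apply: triality_mul => //; exact: offdiag_mul.
    by move=> i; rewrite normH offdiag_norm.
  exists (fun x => exist _ _ (ptG x)) => x; split=> i.
    by rewrite /diag -[entry _ i i]/(cayley_mx _ _ i i) cayley_mx_diag cd_reZ1.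
  rewrite /offdiag -[LHS]/(cayley_mx _ _ (i + 1) (i - 1)) -ord3_addr11 cayley_mx_succ.
  by rewrite addrK ord3_addr11.
move=> triF; have [G' triG' FG'] := triality_inv triF; have [_ normF _] := triF.
have [G GE] := act F triF; have [H HE] := act G' triG'.
exists G; last by move=> x; case: (GE x).
split; first split.
- exists H => x; apply: offdiag_ext => i.
  + by rewrite (HE _).1 (GE _).1.
  + by rewrite (HE _).2 (GE _).2 (FG' i).1.
  + by rewrite (GE _).1 (HE _).1.
  + by rewrite (GE _).2 (HE _).2 (FG' i).2.
- move=> x y; rewrite !inner_offdiag; congr (_ + _ * _); apply: eq_bigr => i _.
    by rewrite !(GE _).1.
  by rewrite !(GE _).2 normF.
move=> l; apply: offdiag_ext => i; first by rewrite (GE _).1.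
have off0 : offdiag (vertex R 3 l) i = 0.
  rewrite /offdiag entry_vertex; case: eqP => [<-|_] /=; last by rewrite scale0r.
  by rewrite ord3_subr1_neq_addr1 scale0r.
by rewrite (GE _).2 off0; apply: cdot_eq0; rewrite normF cdot0l.
Qed.

Lemma trialityP F : (forall i, bijective (F i)) ->
  (forall i a b, cdot (F i a) (F i b) = cdot a b) ->
  (forall a b c, cdot (F 0 a ** F 1 b) (F (- 1) c)^conj = cdot (a ** b) c^conj) -> triality F.
Proof.
move=> bijF normF cyc0; split=> // i a b c.
case: (ord3_cases 0 i) => ->.
- by rewrite add0r sub0r cyc0.
- by rewrite ord3_addr11 addrK sub0r add0r cdot_mul_cyclic cyc0 [RHS]cdot_mul_cyclic.
- rewrite subrK ord3_subr11 sub0r add0r 2!cdot_mul_cyclic cyc0.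
  by rewrite [RHS]cdot_mul_cyclic [RHS]cdot_mul_cyclic.
Qed.

Definition phase_triality u i : O -> O :=
  if i == 0 then fun a => (u ** a) ** u else
  if i == 1 then fun a => u^conj ** a else fun a => a ** u^conj.

Lemma phase_triality0 u a : phase_triality u 0 a = (u ** a) ** u.
Proof. by []. Qed.

Lemma phase_triality1 u a : phase_triality u 1 a = u^conj ** a.
Proof. by []. Qed.

Lemma phase_trialityN1 u a : phase_triality u (- 1) a = a ** u^conj.
Proof. by []. Qed.

Definition phase_trialityE := (phase_triality0, phase_triality1, phase_trialityN1).

Lemma phase_triality_bij u i : cdot u u = 1 -> bijective (phase_triality u i).
Proof.
move=> u1; apply: (ord3_ind (Pr := fun i => bijective (phase_triality u i))).
- by exists (fun a => u^conj ** (a ** u^conj)) => a; rewrite phase_trialityE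
    ?cd_mulKr ?cd_mulVKl// u1 scale1r ?cd_mulKl ?cd_mulVKr// u1 scale1r.
- by exists (fun a => u ** a) => a; rewrite phase_trialityE ?cd_mulVKl ?cd_mulKl// u1 scale1r.
- by exists (fun a => a ** u) => a; rewrite phase_trialityE ?cd_mulVKr ?cd_mulKr// u1 scale1r.
Qed.

Lemma phase_triality_dot u i a b : cdot u u = 1 ->
  cdot (phase_triality u i a) (phase_triality u i b) = cdot a b.
Proof.
move=> u1; move: i; apply: ord3_ind; rewrite !phase_trialityE.
- by rewrite cdot_mul2r// cdot_mul2l// u1 !mul1r.
- by rewrite cdot_mul2l// cdot_conj u1 mul1r.
- by rewrite cdot_mul2r// cdot_conj u1 mul1r.
Qed.

Lemma phase_trialityP u : cdot u u = 1 -> triality (phase_triality u).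
Proof.
move=> u1; apply: trialityP => [i|i a b|a b c].
- exact: phase_triality_bij.
- exact: phase_triality_dot.
rewrite !phase_trialityE moufang_left// cd_mulVKl// u1 scale1r cd_conjM cd_conjK.
by rewrite cdot_mul2l// u1 mul1r.
Qed.

Definition imag_unit u := cdot u u = 1 /\ u^conj = - u.

Lemma imag_conj a : cd_re a = 0 -> a^conj = - a.
Proof. by move=> a0; rewrite cd_conjE a0 mulr0 scale0r add0r. Qed.

Lemma cd_re_basis (i : cd_index 3) : i != cd_index0 3 -> cd_re (cd_basis R i) = 0.
Proof. by move=> i_neq0; rewrite -cdot1l -cd_basis0 cd_basis_dot eq_sym (negbTE i_neq0). Qed.

Lemma imag_unit_normalize a : a != 0 -> cd_re a = 0 -> imag_unit ((cd_norm a)^-1 *: a).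
Proof.
move=> a_neq0 a_imag; split; last by rewrite cd_conjZ imag_conj// scalerN.
by rewrite cdotZl cdotZr -cd_norm_sqr; field; exact: cd_norm_neq0.
Qed.

Lemma exists_imag_orth z : exists2 u, imag_unit u & cdot u z = 0.
Proof.
pose i : cd_index 3 := inr (cd_index0 2); pose i' : cd_index 3 := inl (inr (cd_index0 1)).
pose r := cdot (cd_basis R i) z.
suff [v v_neq0 [v_imag vz]] : exists2 v : O, v != 0 & cd_re v = 0 /\ cdot v z = 0.
  exists ((cd_norm v)^-1 *: v); first exact: imag_unit_normalize.
  by rewrite cdotZl vz mulr0.
have [r0|r_neq0] := eqVneq r 0.
  exists (cd_basis R i); last by rewrite cd_re_basis.
  by apply: (cdot_neq0 (c := cd_basis R i)); rewrite cd_basis_dot oner_neq0.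
exists (cdot (cd_basis R i') z *: cd_basis R i - r *: cd_basis R i').
  apply: (cdot_neq0 (c := cd_basis R i')).
  by rewrite cdotDl cdotNl !cdotZl !cd_basis_dot eqxx mulr0 mulr1 add0r oppr_eq0.
split; last by rewrite cdotDl cdotNl !cdotZl mulrC subrr.
by rewrite -cdot1l cdotDr cdotNr !cdotZr !cdot1l !cd_re_basis// !mulr0 subr0.
Qed.

Lemma exists_imag_phase a : cd_re a = 0 -> exists2 u, imag_unit u & u ** a = cd_norm a *: one.
Proof.
move=> a_imag; have [->|a_neq0] := eqVneq a 0.
  have [u u_imag _] := exists_imag_orth 0.
  by exists u; rewrite // cd_mul0r cd_norm0 scale0r.
have Na_neq0 : - a != 0 by rewrite oppr_eq0.
exists ((cd_norm (- a))^-1 *: - a).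
  by apply: imag_unit_normalize; rewrite // -cdot1l cdotNr cdot1l a_imag oppr0.
rewrite cd_mulZl -imag_conj// cd_conj_mul scalerA /cd_norm cdot_conj -cd_norm_sqr -/(cd_norm a).
by rewrite sqrtr_sqr ger0_norm ?sqrtr_ge0// expr2 mulKf// cd_norm_neq0.
Qed.

Lemma exists_triality_imag_mul u : imag_unit u -> exists2 F, triality F &
  (forall r, F 1 (r *: one) = r *: one) /\ forall z, F (- 1) z = u ** z.
Proof.
move=> [u1 uN]; have uV1 : cdot u^conj u^conj = 1 by rewrite cdot_conj.
have phaseE a : phase_triality u^conj (1 - - 1) a = a ** u.
  by rewrite -[in RHS](cd_conjK u).
have phaseE' a : phase_triality u^conj (- 1 - - 1) a = (u^conj ** a) ** u^conj by rewrite subrr.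
exists (fun i => phase_triality u i \o phase_triality u^conj (i - - 1)).
  by apply: triality_comp; last apply: triality_shift; exact: phase_trialityP.
split=> [r|z]; rewrite /comp.
  by rewrite phaseE phase_trialityE cd_mulZl cd_mul1l cd_mulZr cd_conj_mul u1 scale1r.
rewrite phaseE' phase_trialityE [X in _ ** X = _]uN cd_mulNr cd_mulVKr// u1 scale1r.
by rewrite uN cd_mulNl opprK.
Qed.

(* The first of two imaginary units is orthogonal to [z], so that its product with [z] is again
   imaginary and a second one makes it real. *)
Lemma exists_triality_real z : exists2 F, triality F &
  (forall r, F 1 (r *: one) = r *: one) /\ F (- 1) z = cd_norm z *: one.
Proof.
have [u u_imag uz] := exists_imag_orth z; have [u1 uN] := u_imag.
have [v v_imag vE] : exists2 v, imag_unit v & v ** (u ** z) = cd_norm (u ** z) *: one.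
  by apply: exists_imag_phase; rewrite cd_re_mul -cdot_conj cd_conjK uN cdotNl uz oppr0.
have [F triF [F1 FN1]] := exists_triality_imag_mul u_imag.
have [G triG [G1 GN1]] := exists_triality_imag_mul v_imag.
exists (fun i => G i \o F i); first exact: triality_comp.
split=> [r|]; rewrite /comp; first by rewrite F1 G1.
by rewrite FN1 GN1 vE /cd_norm cd_norm_mul// u1 mul1r.
Qed.

Lemma octonion_straightenable : straightenable R 3 2.
Proof.
move=> x; have [k dk_gt0] := exists_diag_gt0 x.
have shift1 : k + 1 - k = 1 by rewrite addrAC subrr add0r.
have shiftN1 : k - 1 - k = - 1 by rewrite addrAC subrr add0r.
have [u u1 uE] := exists_unit_phase (offdiag x (k + 1)).
have uV1 : cdot u^conj u^conj = 1 by rewrite cdot_conj.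
have [g vert_g gE] := exists_vertex_isometry_triality (triality_shift k (phase_trialityP uV1)).
have [F triF [F1 FN1]] := exists_triality_real (offdiag (g x) (k - 1)).
have [h vert_h hE] := exists_vertex_isometry_triality (triality_shift k triF).
have vert_hg := vertex_isometry_comp vert_h vert_g.
exists (h \o g) => //; apply: (vertex_isometry_ray (k := k)) => // l.
have y_succ : offdiag ((h \o g) x) (k + 1) = cd_norm (offdiag x (k + 1)) *: one.
  by rewrite hE gE shift1 phase_trialityE cd_conjK uE F1.
have y_pred : offdiag ((h \o g) x) (k - 1) = cd_norm (offdiag (g x) (k - 1)) *: one.
  by rewrite hE shiftN1 FN1.
case: (ord3_cases k l) => ->.
- by exists (diag x k); rewrite ?diag_ge0// entry_diag vertex_isometry_diag.
- by exists (cd_norm (offdiag (g x) (k - 1))); rewrite ?sqrtr_ge0// entry_succ.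
- by exists (cd_norm (offdiag x (k + 1))); rewrite ?sqrtr_ge0// entry_pred y_succ cd_conjZ cd_conj1.
Qed.

End Octonions.

(** * Spheres *)

Section Sphere.
Variables (R : realType) (n : nat).
Local Notation pt := (sph_pt R n.+1).
Local Notation dist := (@sph_rho R n.+1).
Local Notation i0 := (ord0 : 'I_n.+2).
Local Notation i1 := (lift ord0 ord0 : 'I_n.+2).
Implicit Types (x y u : pt) (v w : 'cV[R]_n.+2).

Definition sph_vec x : 'cV[R]_n.+2 := \col_i proj1_sig x i.

Lemma sph_vec_dot x : dot (sph_vec x) (sph_vec x) = 1.
Proof. by case: x => x x1; rewrite -[RHS]x1; apply: eq_bigr => i _; rewrite !mxE expr2. Qed.

Lemma sph_of_vec_subproof v : dot v v = 1 -> \sum_i v i 0 ^+ 2 = 1.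
Proof. by move=> v1; rewrite -[RHS]v1; apply: eq_bigr => i _; rewrite expr2. Qed.

Definition sph_of_vec v (v1 : dot v v = 1) : pt :=
  exist _ (fun i => v i 0) (sph_of_vec_subproof v1).

Lemma sph_of_vecK v (v1 : dot v v = 1) : sph_vec (sph_of_vec v1) = v.
Proof. by apply/matrixP => i k; rewrite mxE ord1. Qed.

Lemma sph_vec_inj : injective sph_vec.
Proof.
move=> [x x1] [y y1] /matrixP xy.
have {}xy : x = y by apply/funext => i; have := xy i 0; rewrite !mxE.
by subst y; congr exist; exact: Prop_irrelevance.
Qed.

Lemma sph_rhoE x y : dist x y = acos (dot (sph_vec x) (sph_vec y)).
Proof. by congr acos; apply: eq_bigr => i _; rewrite !mxE. Qed.

Lemma sph_dot_itv x y : -1 <= dot (sph_vec x) (sph_vec y) <= 1.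
Proof.
have := dot_ge0 (sph_vec x - sph_vec y); have := dot_ge0 (sph_vec x - - sph_vec y).
rewrite !dotBl !dotBr !dotNl !(dotC _ (- _)) !dotNl !sph_vec_dot (dotC (sph_vec y)).
by move=> ? ?; apply/andP; split; lra.
Qed.

Lemma half_cos_sph x y : half_cos dist x y = (1 + dot (sph_vec x) (sph_vec y)) / 2.
Proof. by rewrite /half_cos sph_rhoE acosK// in_itv/= sph_dot_itv. Qed.

Lemma exists_isometry_sph x y : exists2 g, isometry dist g &
  g x = y /\ forall u, dot (sph_vec x - sph_vec y) (sph_vec u) = 0 -> g u = u.
Proof.
have [Q [Q_refl Qx Q_fix]] := exists_reflection (etrans (sph_vec_dot x) (esym (sph_vec_dot y))).
have Q_unit u : dot (Q *m sph_vec u) (Q *m sph_vec u) = 1 by rewrite reflection_dot ?sph_vec_dot.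
pose g u := sph_of_vec (Q_unit u).
have gK : involutive g.
  by move=> u; apply: sph_vec_inj; rewrite !sph_of_vecK mulmxA Q_refl.2 mul1mx.
exists g.
  by split=> [|u u']; [exists g|rewrite !sph_rhoE !sph_of_vecK reflection_dot].
by split=> [|u u_orth]; apply: sph_vec_inj; rewrite sph_of_vecK; [exact: Qx|exact: Q_fix].
Qed.

Lemma dot_oppr v : dot v v = 1 -> dot (- v) (- v) = 1.
Proof. by rewrite dotNl dotC dotNl opprK. Qed.

Definition north : pt := sph_of_vec (dot_delta_self R i0).

Definition south : pt := sph_of_vec (dot_oppr (dot_delta_self R i0)).

Definition equator_pt (m : 'I_n.+1) : pt := sph_of_vec (dot_delta_self R (lift ord0 m)).

Lemma half_cos_north u : half_cos dist north u = (1 + sph_vec u i0 0) / 2.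
Proof. by rewrite half_cos_sph sph_of_vecK dot_delta. Qed.

Lemma half_cos_south u : half_cos dist south u = (1 - sph_vec u i0 0) / 2.
Proof. by rewrite half_cos_sph sph_of_vecK dotNl dot_delta. Qed.

Lemma edge_coord_sph v (v1 : dot v v = 1) u :
  edge_coord dist north south (sph_of_vec v1) u = dot v (sph_vec u) / 2.
Proof. by rewrite /edge_coord half_cos_north half_cos_south half_cos_sph sph_of_vecK; field. Qed.

Lemma edge_coord_equator m u :
  edge_coord dist north south (equator_pt m) u = sph_vec u (lift ord0 m) 0 / 2.
Proof. by rewrite edge_coord_sph dot_delta. Qed.

Definition equator_vec (a : 'I_n.+1 -> R) : 'cV[R]_n.+2 := \col_i oapp a 0 (unlift ord0 i).

Lemma dot_equator_vec a w : dot (equator_vec a) w = \sum_m a m * w (lift ord0 m) 0.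
Proof.
rewrite /dot big_ord_recl mxE unlift_none mul0r add0r.
by apply: eq_bigr => m _; rewrite mxE liftK.
Qed.

Lemma equator_vec_dot a : dot (equator_vec a) (equator_vec a) = \sum_m a m ^+ 2.
Proof. by rewrite dot_equator_vec; apply: eq_bigr => m _; rewrite mxE liftK expr2. Qed.

Lemma sph_frame_product u : half_cos dist north u * half_cos dist south u =
  \sum_m edge_coord dist north south (equator_pt m) u ^+ 2.
Proof.
under eq_bigr do rewrite edge_coord_equator exprMn.
rewrite -mulr_suml half_cos_north half_cos_south.
have := sph_vec_dot u; rewrite /dot big_ord_recl; under eq_bigr do rewrite -expr2.
by move=> /eqP; rewrite addrC eq_sym -subr_eq => /eqP <-; field.
Qed.

Lemma sph_frame_rotate (a : 'I_n.+1 -> R) : \sum_m a m ^+ 2 = 1 ->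
  exists2 h, isometry dist h & [/\ h north = north, h south = south &
    forall u, edge_coord dist north south (h (equator_pt ord0)) u =
      \sum_m a m * edge_coord dist north south (equator_pt m) u].
Proof.
rewrite -equator_vec_dot => a1.
have [h isom_h [hE h_fix]] := exists_isometry_sph (equator_pt ord0) (sph_of_vec a1).
have orth : dot (sph_vec (equator_pt ord0) - sph_vec (sph_of_vec a1)) (delta_mx i0 0) = 0.
  by rewrite !sph_of_vecK dotC dotBr !dot_delta !mxE unlift_none subr0.
exists h => //; split=> [||u].
- by apply: h_fix; rewrite (sph_of_vecK (dot_delta_self R i0)).
- by apply: h_fix; rewrite (sph_of_vecK (dot_oppr _)) dotC dotNl dotC orth oppr0.
rewrite hE edge_coord_sph dot_equator_vec mulr_suml.
by apply: eq_bigr => m _; rewrite edge_coord_equator mulrA.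
Qed.

Lemma sph_frame_line (a b : R) : a ^+ 2 + b ^+ 2 = 1 -> exists2 h, isometry dist h & forall u,
  half_cos dist (h north) u = a ^+ 2 * half_cos dist north u + b ^+ 2 * half_cos dist south u +
  2 * a * b * edge_coord dist north south (equator_pt ord0) u.
Proof.
move=> ab1; have double_angle : (a ^+ 2 - b ^+ 2) ^+ 2 + (2 * a * b) ^+ 2 = 1.
  by transitivity ((a ^+ 2 + b ^+ 2) ^+ 2); [ring|rewrite ab1 expr1n].
have [h isom_h [hE _]] := exists_isometry_sph north (sph_of_vec (plane_vec_dot double_angle)).
exists h => // u.
rewrite hE half_cos_north half_cos_south edge_coord_equator half_cos_sph sph_of_vecK.
by rewrite dot_plane_vec -{1}ab1; field.
Qed.

Lemma sph_frame_pair x y : exists2 h, isometry dist h & h north = x /\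
  exists2 y0, h y0 = y & forall u, half_cos dist y0 u =
    half_cos dist x y * half_cos dist north u +
    (1 - half_cos dist x y) * half_cos dist south u +
    2 * Num.sqrt (half_cos dist x y) * Num.sqrt (1 - half_cos dist x y) *
    edge_coord dist north south (equator_pt ord0) u.
Proof.
set t := half_cos dist x y; have /andP[t_ge0 t_le1] : 0 <= t <= 1 := half_cos_itv dist x y.
have circle : (2 * t - 1) ^+ 2 + (2 * Num.sqrt t * Num.sqrt (1 - t)) ^+ 2 = 1.
  by rewrite !exprMn !sqr_sqrtr ?subr_ge0//; ring.
pose y0 := sph_of_vec (plane_vec_dot circle).
have [to_north isom_tn [tnE _]] := exists_isometry_sph x north.
have [to_plane isom_tp [tpE tp_fix]] := exists_isometry_sph (to_north y) y0.
have tp_north : to_plane north = north.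
  apply: tp_fix; rewrite dotBl !sph_of_vecK dotC !dot_delta dot_plane_vec !mxE /=.
  have := half_cos_isometry x y isom_tn; rewrite tnE half_cos_north -/t mxE => tE.
  by rewrite mulr1 mulr0 addr0; lra.
have [h isom_h [hK _]] := isometry_inv (isometry_comp isom_tp isom_tn).
exists h => //; split; first by rewrite -{1}tp_north -tnE -[RHS]hK.
exists y0 => [|u]; first by rewrite -tpE -[RHS]hK.
rewrite half_cos_sph sph_of_vecK half_cos_north half_cos_south edge_coord_equator.
by rewrite dot_plane_vec; field.
Qed.

Lemma sph_isotropic_frame :
  isotropic_frame (n := 0) dist (ord0 : 'I_n.+1) north (fun=> south) equator_pt.
Proof.
split.
- exact: sph_frame_product.
- exact: sph_frame_rotate.
- exact: sph_frame_line.
- by move=> u; rewrite big_ord1 half_cos_north half_cos_south; field.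
- by move=> l; exists id => //; split=> //; exists id.
- exact: sph_frame_pair.
Qed.

End Sphere.

(** * Two-point homogeneous spaces *)

Lemma alpha_beta_gt0 (R : realType) K d : valid_dim K d ->
  0 < beta K d + 1 :> R /\ 0 < alpha K d + beta K d + 1 :> R.
Proof.
have natr_ge k : (k <= d)%N -> k%:R <= d%:R :> R by rewrite ler_nat.
by case: K => /= [/natr_ge|/natr_ge|/andP[/natr_ge d_ge _]|/andP[/natr_ge d_ge _]|_];
  split; lra.
Qed.

Lemma rho_self (R : realType) K d (x : tph_point R K d) : rho x x = 0.
Proof.
have proj_self j n (y : proj_pt R j n) : proj_rho y y = 0.
  by rewrite /proj_rho -/(inner y y) inner_self mulr1 (_ : 2 - 1 = 1) ?acos1//; ring.
case: K x => /= x; try exact: proj_self.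
rewrite /sph_rho; case: x => x x1 /=.
by under eq_bigr do rewrite -expr2; rewrite x1 acos1.
Qed.

Section UniformElement.
Context {R : realType} {dT : measure_display} {T : measurableType dT} (P : probability T R).

Lemma Expe_jacobi_proj j n D (U : T -> proj_pt R j n.+1) (al be : R) x y m :
  (j <= 3)%N -> straightenable R j n.+1 -> #|cd_index j| = D ->
  be + 1 = D%:R / 2 -> al + 1 = n.+1%:R * (D%:R / 2) ->
  random_element (@proj_rho R j n.+1) U -> uniform_el P (@proj_rho R j n.+1) U ->
  Expe P (fun w => jacobiP m al be (cos (proj_rho x (U w))) *
                   jacobiP m al be (cos (proj_rho y (U w)))) =
  jacobi_const al be m * jacobiP m al be (cos (proj_rho x y)).
Proof.
move=> j_le3 straight <- beE alE.
exact: Expe_jacobi_uniform (proj_isotropic_frame j_le3 straight) beE alE.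
Qed.

Lemma Expe_jacobi_tph K d (U : T -> tph_point R K d) x y m :
  valid_dim K d -> random_element rho U -> uniform_el P rho U ->
  let jac u v := jacobiP m (alpha K d) (beta K d) (cos (rho u v)) in
  Expe P (fun w => jac x (U w) * jac y (U w)) =
  jacobi_const (alpha K d) (beta K d) m * jac x y.
Proof.
case: K U x y => /= U x y.
- case: d U x y => // d U x y _.
  by apply: (Expe_jacobi_uniform x y m (sph_isotropic_frame R d)); rewrite card_ord; field.
- case: d U x y => // d U x y _.
  by apply: (Expe_jacobi_proj (D := 1)); rewrite ?card_cd_index//;
    [exact: associative_straightenable|field|field].
- move=> /andP[d_ge4 even_d]; have : (d = (d %/ 2) * 2)%N by rewrite divnK// dvdn2.
  move: (d %/ 2)%N U x y => [|n] U x y dE; first by rewrite dE in d_ge4.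
  by apply: (Expe_jacobi_proj (D := 2)); rewrite ?card_cd_index//;
    [exact: associative_straightenable|field|rewrite dE natrM; field].
- move=> /andP[d_ge8 dvd_4d]; have : (d = (d %/ 4) * 4)%N by rewrite divnK.
  move: (d %/ 4)%N U x y => [|n] U x y dE; first by rewrite dE in d_ge8.
  by apply: (Expe_jacobi_proj (D := 4)); rewrite ?card_cd_index//;
    [exact: associative_straightenable|field|rewrite dE natrM; field].
- move=> /eqP dE; subst d.
  by apply: (@Expe_jacobi_proj 3 1 8); rewrite ?card_cd_index//;
    [exact: octonion_straightenable|field|field].
Qed.

End UniformElement.

(** * The random field *)

Section OrthogonalSeries.
Context {R : realType} {dT : measure_display} {T : measurableType dT}.
Variable P : probability T R.
Implicit Types (f g : nat -> T -> R) (c : nat -> R).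

Definition partial_sum f N w : R := \sum_(n < N) f n w.

Lemma partial_sum_Lfun2 f N : (forall n, f n \in Lfun P 2%:E) -> partial_sum f N \in Lfun P 2%:E.
Proof. by move=> Lf; exact: Lfun_sum. Qed.

Lemma Expe_partial_sum f N : (forall n, f n \in Lfun P 2%:E) -> (forall n, Expe P (f n) = 0) ->
  Expe P (partial_sum f N) = 0.
Proof.
move=> Lf f0; rewrite Expe_sum => [|n]; last exact: Lfun2_Lfun1.
by rewrite big1.
Qed.

Lemma Expe_partial_sum_mul f g c M N :
  (forall n, f n \in Lfun P 2%:E) -> (forall n, g n \in Lfun P 2%:E) ->
  (forall n n', Expe P (fun w => f n w * g n' w) = (n == n')%:R * c n) -> (M <= N)%N ->
  Expe P (fun w => partial_sum f M w * partial_sum g N w) = series c M.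
Proof.
move=> Lf Lg fg le_MN.
have Lfg n n' : (fun w => f n w * g n' w) \in Lfun P 1 by exact: Lfun2_mul_Lfun1.
transitivity (Expe P (fun w => \sum_(n < M) \sum_(n' < N) f n w * g n' w)).
  by apply: eq_Expe => w; rewrite mulr_suml; apply: eq_bigr => n _; rewrite mulr_sumr.
rewrite Expe_sum => [|n]; last exact: Lfun_sum.
rewrite seriesEord; apply: eq_bigr => n _; rewrite Expe_sum//.
have lt_nN : (n < N)%N by exact: leq_trans le_MN.
rewrite (bigD1 (Ordinal lt_nN))//= fg eqxx mul1r big1 ?addr0// => n' n'n.
by move: n'n; rewrite fg -val_eqE /= eq_sym => /negbTE ->; rewrite mul0r.
Qed.

Lemma norm2_partial_sum_sub f c M N : (forall n, f n \in Lfun P 2%:E) ->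
  (forall n n', Expe P (fun w => f n w * f n' w) = (n == n')%:R * c n) -> (M <= N)%N ->
  norm2 P (fun w => partial_sum f M w - partial_sum f N w) = series c N - series c M.
Proof.
move=> Lf ff le_MN; pose S := partial_sum f.
have LSS a b : (fun w => S a w * S b w) \in Lfun P 1.
  by apply: Lfun2_mul_Lfun1; exact: partial_sum_Lfun2.
transitivity (Expe P (fun w => S M w * S M w - 2 * (S M w * S N w) + S N w * S N w)).
  by apply: eq_Expe => w; rewrite /S; ring.
rewrite ExpeD//; last by apply: rpredB => //; exact: rpredZ.
rewrite ExpeB//; last exact: rpredZ.
by rewrite ExpeZ// !(Expe_partial_sum_mul Lf Lf ff)//; ring.
Qed.

Lemma orthogonal_series_cvg f c (l : R) : (forall n, f n \in Lfun P 2%:E) ->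
  (forall n n', Expe P (fun w => f n w * f n' w) = (n == n')%:R * c n) ->
  series c @ \oo --> l ->
  exists2 g, g \in Lfun P 2%:E &
    norm2 P (fun w => partial_sum f N w - g w) @[N --> \oo] --> (0 : R).
Proof.
move=> Lf ff cvg_c; have dist := norm2_partial_sum_sub Lf ff.
have c_incr : nondecreasing_seq (series c).
  by move=> M N le_MN; rewrite -subr_ge0 -dist//; exact: norm2_ge0.
have c_le N : series c N <= l.
  by have := nondecreasing_cvgn_le c_incr (cvgP _ cvg_c) N; rewrite (cvg_lim _ cvg_c).
apply: (Lfun2_complete (f := partial_sum f) (e := fun n => l - series c n)).
- by move=> n; exact: partial_sum_Lfun2.
- by rewrite -(subrr l); apply: cvgB => //; exact: cvg_cst.
- by move=> M N le_MN; rewrite dist// lerB.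
Qed.

End OrthogonalSeries.

Section Noise.
Context {R : realType} {m : nat} {dT : measure_display} {T : measurableType dT}.
Variables (P : probability T R) (V : nat -> T -> 'cV[R]_m) (s : nat -> R).
Hypothesis V_L2 : forall n, rvec_L2 P (V n).
Hypothesis V_indep : indep_family P (fun n : nat => sigma_rvec (V n)).
Hypothesis V_mean : forall n, Evec P (V n) = 0.
Hypothesis V_cov : forall n, covmx P (V n) (V n) = s n *: 1%:M.

Definition noise n i w : R := V n w i 0.

Definition noise_space := g_sigma_algebraType (\bigcup_n sigma_rvec (V n)).

Lemma noise_Lfun2 n i : noise n i \in Lfun P 2%:E.
Proof. exact/Lfun2P/V_L2. Qed.

Lemma sigma_rvec_noise n i A : measurable A -> sigma_rvec (V n) (noise n i @^-1` A).
Proof. by move=> mA; apply: sub_gen_smallest; exists i, A. Qed.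

Lemma measurable_noise n i : measurable_fun setT (noise n i : noise_space -> R).
Proof.
move=> _ A mA; rewrite setTI; apply: sub_gen_smallest; exists n => //.
exact: sigma_rvec_noise.
Qed.

Lemma Expe_noise n i : Expe P (noise n i) = 0.
Proof. by have /matrixP/(_ i 0) := V_mean n; rewrite !mxE. Qed.

Lemma indep_noise n n' i k : n != n' -> indep_fun P (noise n i) (noise n' k).
Proof.
move=> n_neq A A' mA mA'.
pose event j := if j == n then noise n i @^-1` A else noise n' k @^-1` A'.
have event_n : event n = noise n i @^-1` A by rewrite /event eqxx.
have event_n' : event n' = noise n' k @^-1` A' by rewrite /event eq_sym (negbTE n_neq).
have uniq_nn' : uniq [:: n; n'] by rewrite /= inE n_neq.
have event_sigma j : j \in [:: n; n'] -> sigma_rvec (V j) (event j).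
  by rewrite !inE => /orP[] /eqP ->; rewrite ?event_n ?event_n'; exact: sigma_rvec_noise.
have := V_indep uniq_nn' event_sigma; rewrite !big_cons big_nil mule1 event_n event_n' => <-.
congr (P _); apply/seteqP; split => w /=.
  by move=> [wA wA'] j /=; rewrite !inE => /orP[] /eqP ->; rewrite ?event_n ?event_n'.
move=> w_event; have := w_event n; have := w_event n'.
by rewrite /= !inE !eqxx orbT event_n event_n' => /(_ isT) ? /(_ isT).
Qed.

Lemma Expe_noise_mul n n' i k :
  Expe P (fun w => noise n i w * noise n' k w) = (n == n')%:R * ((i == k)%:R * s n).
Proof.
have [<-|n_neq] := eqVneq n n'.
  have /matrixP/(_ i k) := V_cov n; rewrite !mxE mul1r mulrC => <-.
  by apply: eq_Expe => w; rewrite -/(noise n i) -/(noise n k) !Expe_noise !subr0.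
rewrite mul0r (Expe_indep_mul _ _ (indep_noise i k n_neq)) ?Expe_noise ?mul0r//;
  by apply: Lfun2_Lfun1; exact: noise_Lfun2.
Qed.

Section UniformElement.
Context {M : Type} (dist : M -> M -> R) (x0 : M) (U : T -> M).
Hypothesis U_el : random_element dist U.
Hypothesis UV_indep : indep2 P (sigma_el dist U) (<<s \bigcup_n sigma_rvec (V n) >>).

Lemma Expe_uniform_noise (phi : borel_type dist x0 -> R) (g : noise_space -> R) :
  bounded_mfun phi -> measurable_fun setT g -> (g : T -> R) \in Lfun P 1 ->
  Expe P (fun w => phi (U w) * g w) = Expe P (phi \o U) * Expe P g.
Proof.
move=> bphi mg Lg; have [mphi _] := bphi; apply: Expe_indep_mul => //.
  apply: bounded_mfun_Lfun1; apply: bounded_mfun_comp bphi.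
  exact: measurable_random_element U_el.
move=> A A' mA mA'; apply: UV_indep; last by rewrite -[_ @^-1` _]setTI; exact: mg.
by exists (phi @^-1` A) => //; rewrite -[_ @^-1` _]setTI; exact: mphi.
Qed.

End UniformElement.
End Noise.

Section RandomField.
Context {R : realType} {K : tph_kind} {d m : nat}.
Context {dT : measure_display} {T : measurableType dT} (P : probability T R).
Variables (V : nat -> T -> 'cV[R]_m) (U : T -> tph_point R K d) (B : nat -> 'M[R]_m).
Local Notation al := (alpha K d).
Local Notation be := (beta K d).
Implicit Types (x y u : tph_point R K d) (Z : T -> 'cV[R]_m) (i k : 'I_m).
Hypothesis dim_valid : valid_dim K d.
Hypothesis V_L2 : forall n, rvec_L2 P (V n).
Hypothesis V_indep : indep_family P (fun n : nat => sigma_rvec (V n)).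
Hypothesis V_mean : forall n, Evec P (V n) = 0.
Hypothesis V_cov : forall n, covmx P (V n) (V n) = (a_const al be n) ^+ 2 *: 1%:M.
Hypothesis U_el : random_element rho U.
Hypothesis U_unif : uniform_el P rho U.
Hypothesis UV_indep : indep2 P (sigma_el rho U) (<<s \bigcup_n sigma_rvec (V n) >>).
Hypothesis B_nnd : forall n, sym_nnd (B n).

Definition jac n x u : R := jacobiP n al be (cos (rho x u)).

Definition field_term n x w : 'cV[R]_m := jac n x (U w) *: (msqrt (B n) *m V n w).

Definition field_entry x i n w : R := field_term n x w i 0.

Definition cov_coef x y i k n : R := B n i k * jac n x y.

Lemma bounded_mfun_jac x0 n x : bounded_mfun (jac n x : borel_type rho x0 -> R).
Proof. exact: bounded_mfun_jacobi. Qed.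

Lemma bounded_mfun_jac_uniform n x : bounded_mfun (fun w => jac n x (U w)).
Proof.
exact: bounded_mfun_comp (measurable_random_element (x0 := x) U_el) (bounded_mfun_jac x n x).
Qed.

Lemma field_entryE x i n w :
  field_entry x i n w = \sum_k msqrt (B n) i k * (jac n x (U w) * noise V n k w).
Proof. by rewrite /field_entry !mxE mulr_sumr; apply: eq_bigr => k _; rewrite mulrCA. Qed.

Lemma jac_noise_Lfun2 n x k : (fun w => jac n x (U w) * noise V n k w) \in Lfun P 2%:E.
Proof. by apply: bounded_mfunM_Lfun2 (noise_Lfun2 V_L2 n k); exact: bounded_mfun_jac_uniform. Qed.

Lemma field_entry_Lfun2 x i n : field_entry x i n \in Lfun P 2%:E.
Proof.
rewrite (funext (field_entryE x i n)); apply: Lfun_sum => // k.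
by apply: rpredZ; exact: jac_noise_Lfun2.
Qed.

Lemma Expe_field_entry x i n : Expe P (field_entry x i n) = 0.
Proof.
rewrite (eq_Expe P (field_entryE x i n)) Expe_sum => [|k]; last first.
  by apply: rpredZ; apply: Lfun2_Lfun1; exact: jac_noise_Lfun2.
apply: big1 => k _; rewrite ExpeZ; last by apply: Lfun2_Lfun1; exact: jac_noise_Lfun2.
rewrite (Expe_uniform_noise U_el UV_indep (bounded_mfun_jac x n x) (measurable_noise n k)).
  by rewrite Expe_noise// !mulr0.
by apply: Lfun2_Lfun1; exact: noise_Lfun2.
Qed.

Lemma Expe_field_entry_mul_sum n n' x y i k :
  Expe P (fun w => field_entry x i n w * field_entry y k n' w) =
  \sum_a \sum_b (msqrt (B n) i a * msqrt (B n') k b) *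
    (Expe P (fun w => jac n x (U w) * jac n' y (U w)) *
     Expe P (fun w => noise V n a w * noise V n' b w)).
Proof.
pose J (u : borel_type rho x) := jac n x u * jac n' y u.
have bJ : bounded_mfun J by apply: bounded_mfunM; exact: bounded_mfun_jac.
have Lnoise a b : (fun w => noise V n a w * noise V n' b w) \in Lfun P 1.
  by apply: Lfun2_mul_Lfun1; exact: noise_Lfun2.
have Lterm a b : (fun w => J (U w) * (noise V n a w * noise V n' b w)) \in Lfun P 1.
  apply: bounded_mfunM_Lfun1 => //.
  exact: bounded_mfun_comp (measurable_random_element (x0 := x) U_el) bJ.
transitivity (Expe P (fun w => \sum_a \sum_b (msqrt (B n) i a * msqrt (B n') k b) *
    (J (U w) * (noise V n a w * noise V n' b w)))).
  apply: eq_Expe => w; rewrite !field_entryE mulr_suml; apply: eq_bigr => a _.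
  by rewrite mulr_sumr; apply: eq_bigr => b _; rewrite /J; ring.
rewrite Expe_sum => [|a]; last by apply: Lfun_sum => // b; exact: rpredZ.
apply: eq_bigr => a _; rewrite Expe_sum => [|b]; last exact: rpredZ.
apply: eq_bigr => b _; rewrite ExpeZ//; congr (_ * _).
apply: (Expe_uniform_noise U_el UV_indep bJ) => //.
by apply: measurable_funM; exact: measurable_noise.
Qed.

Lemma Expe_field_entry_mul x y i k n n' :
  Expe P (fun w => field_entry x i n w * field_entry y k n' w) = (n == n')%:R * cov_coef x y i k n.
Proof.
rewrite Expe_field_entry_mul_sum.
under eq_bigr do under eq_bigr do rewrite (Expe_noise_mul V_L2 V_indep V_mean V_cov).
have [<-|_] := eqVneq n n'; last first.
  by rewrite mul0r big1// => a _; rewrite big1// => b _; rewrite mul0r !mulr0.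
rewrite mul1r (Expe_jacobi_tph x y n dim_valid U_el U_unif) -/(jac n x y).
have [be_gt0 albe_gt0] := alpha_beta_gt0 R dim_valid.
transitivity ((msqrt (B n) *m (msqrt (B n))^T) i k * jac n x y *
   (a_const al be n ^+ 2 * jacobi_const al be n)); last first.
  by rewrite a_const_sqr// mulr1 msqrt_mul_trmx.
rewrite mxE !mulr_suml; apply: eq_bigr => a _.
rewrite (bigD1 a)//= eqxx [X in _ + X]big1 ?addr0 ?mxE ?mul1r => [|b ba]; first by ring.
by rewrite eq_sym (negbTE ba) !(mul0r, mulr0).
Qed.

Lemma covmx_field_term n n' x y : n <> n' -> covmx P (field_term n x) (field_term n' y) = 0.
Proof.
move=> /eqP n_neq; apply/matrixP => i k; rewrite !mxE.
transitivity (Expe P (fun w => field_entry x i n w * field_entry y k n' w)).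
  apply: eq_Expe => w.
  by rewrite -/(field_entry x i n) -/(field_entry y k n') !Expe_field_entry !subr0.
by rewrite Expe_field_entry_mul (negbTE n_neq) mul0r.
Qed.

Definition partial_field N x w : 'cV[R]_m := \sum_(n < N) field_term n x w.

Lemma partial_fieldE N x w i : partial_field N x w i 0 = partial_sum (field_entry x i) N w.
Proof. exact: summxE. Qed.

Definition ms_cvg x Z := rvec_L2 P Z /\
  (fun N => \int[P]_w ((\sum_i (partial_field N x w i 0 - Z w i 0) ^+ 2)%:E))%E @ \oo --> 0%E.

Lemma integral_dist_partial_field x N Z : rvec_L2 P Z ->
  (\int[P]_w ((\sum_i (partial_field N x w i 0 - Z w i 0) ^+ 2)%:E))%E =
  (\sum_i norm2 P (fun w => partial_sum (field_entry x i) N w - Z w i 0))%:E.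
Proof.
move=> Z_L2; under eq_integral do under eq_bigr do rewrite partial_fieldE.
have Ldist i : (fun w => (partial_sum (field_entry x i) N w - Z w i 0) ^+ 2) \in Lfun P 1.
  apply: Lfun2_sqr; apply: rpredB; last exact/Lfun2P/Z_L2.
  by apply: partial_sum_Lfun2 => n; exact: field_entry_Lfun2.
by rewrite -EFin_Expe ?Expe_sum//; exact: Lfun_sum.
Qed.

Lemma ms_cvg_entry x Z i : ms_cvg x Z ->
  norm2 P (fun w => partial_sum (field_entry x i) N w - Z w i 0) @[N --> \oo] --> (0 : R).
Proof.
move=> [Z_L2]; under eq_fun do rewrite integral_dist_partial_field//.
move=> /fine_cvg; apply: (@squeeze_cvgr _ _ _ _ (fun=> 0)); last exact: cvg_cst.
apply: nearW => N; rewrite norm2_ge0 /= (bigD1 i)//= lerDl sumr_ge0// => k _.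
exact: norm2_ge0.
Qed.

Lemma ms_cvg_exists x : (forall i, cvgn (series (cov_coef x x i i))) -> exists Z, ms_cvg x Z.
Proof.
move=> diag_cvg; have /choice[g /all_and2[Lg cvg_g]] : forall i, exists g, g \in Lfun P 2%:E /\
    norm2 P (fun w => partial_sum (field_entry x i) N w - g w) @[N --> \oo] --> (0 : R).
  move=> i; have [g Lg cvg_g] := orthogonal_series_cvg (field_entry_Lfun2 x i)
    (Expe_field_entry_mul x x i i) (diag_cvg i).
  by exists g.
exists (fun w => \col_i g i w).
have Z_L2 : rvec_L2 P (fun w => \col_i g i w).
  move=> i; under eq_fun do rewrite mxE.
  by under [X in _ /\ P.-integrable _ X]eq_fun do rewrite mxE; exact/Lfun2P.
split=> //; under eq_fun do rewrite integral_dist_partial_field//.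
apply: cvg_EFin; first exact: nearW.
have cvg_sum : \sum_i norm2 P (fun w => partial_sum (field_entry x i) N w - g i w) @[N --> \oo] -->
    \sum_(i < m) (0 : R).
  by apply: cvg_big => [|i _]; [exact: add_continuous|exact: cvg_g].
rewrite big1// in cvg_sum; apply: cvg_trans cvg_sum; apply: near_eq_cvg; apply: nearW => N /=.
by apply: eq_bigr => i _; apply: eq_Expe => w; rewrite mxE.
Qed.

Lemma ms_cvg_mean x Z : ms_cvg x Z -> Evec P Z = 0.
Proof.
move=> cvg_Z; have [Z_L2 _] := cvg_Z; apply/matrixP => i k; rewrite !mxE.
have L1 : (fun=> 1) \in Lfun P 2%:E by exact: Lfun_cst.
have norm0 : norm2 P (fun=> 1 - 1) @[_ --> \oo] --> (0 : R).
  by rewrite /norm2 subrr expr0n /= Expe_cst; exact: cvg_cst.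
have ps_L2 N : partial_sum (field_entry x i) N \in Lfun P 2%:E.
  by apply: partial_sum_Lfun2 => n; exact: field_entry_Lfun2.
have Zi_L2 : (fun w => Z w i 0) \in Lfun P 2%:E by exact/Lfun2P/Z_L2.
have := cvg_Expe_mul ps_L2 (fun=> L1) Zi_L2 L1 (ms_cvg_entry i cvg_Z) norm0.
rewrite (eq_Expe P (fun w => mulr1 (Z w i 0))).
have Expe_ps N : Expe P (fun w => partial_sum (field_entry x i) N w * 1) = 0.
  rewrite (eq_Expe P (fun w => mulr1 _)) Expe_partial_sum// => n; first exact: field_entry_Lfun2.
  exact: Expe_field_entry.
under eq_fun do rewrite Expe_ps.
by move=> cvg_mean; exact: cvg_unique cvg_mean (cvg_cst _).
Qed.

Lemma ms_cvg_cov x y Z Z' i k : ms_cvg x Z -> ms_cvg y Z' ->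
  series (cov_coef x y i k) @ \oo --> covmx P Z Z' i k.
Proof.
move=> cvg_Z cvg_Z'.
have mean0 u X l : ms_cvg u X -> Expe P (fun w => X w l 0) = 0.
  by move=> /ms_cvg_mean/matrixP/(_ l 0); rewrite !mxE.
have ps_L2 u l N : partial_sum (field_entry u l) N \in Lfun P 2%:E.
  by apply: partial_sum_Lfun2 => n; exact: field_entry_Lfun2.
have entry_L2 u X l : ms_cvg u X -> (fun w => X w l 0) \in Lfun P 2%:E.
  by move=> [X_L2 _]; exact/Lfun2P/X_L2.
rewrite mxE (eq_Expe P (g := fun w => Z w i 0 * Z' w k 0)) => [|w]; last first.
  by rewrite (mean0 _ _ i cvg_Z) (mean0 _ _ k cvg_Z') !subr0.
have -> : series (cov_coef x y i k) = (fun N =>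
    Expe P (fun w => partial_sum (field_entry x i) N w * partial_sum (field_entry y k) N w)).
  apply/funext => N; apply/esym/Expe_partial_sum_mul => //; try exact: field_entry_Lfun2.
  exact: Expe_field_entry_mul.
exact: cvg_Expe_mul (ps_L2 x i) (ps_L2 y k) (entry_L2 _ _ i cvg_Z) (entry_L2 _ _ k cvg_Z')
  (ms_cvg_entry i cvg_Z) (ms_cvg_entry k cvg_Z').
Qed.

End RandomField.

Theorem theorem1 (R : realType) (K : tph_kind) (d m : nat)
  (dT : measure_display) (T : measurableType dT) (P : probability T R)
  (V : nat -> T -> 'cV[R]_m) (U : T -> tph_point R K d) (B : nat -> 'M[R]_m) :
  valid_dim K d ->
  (forall n, rvec_L2 P (V n)) ->
  indep_family P (fun n : nat => sigma_rvec (V n)) ->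
  (forall n, Evec P (V n) = 0) ->
  (forall n, covmx P (V n) (V n) = (a_const (alpha K d) (beta K d) n) ^+ 2 *: 1%:M) ->
  random_element rho U ->
  uniform_el P rho U ->
  indep2 P (sigma_el rho U) (<<s \bigcup_n sigma_rvec (V n) >>) ->
  (forall n, sym_nnd (B n)) ->
  (forall i j, exists l : R,
     series (fun n => B n i j * jacobiP n (alpha K d) (beta K d) 1) @ \oo --> l) ->
  let term := fun (n : nat) (x : tph_point R K d) (w : T) =>
    jacobiP n (alpha K d) (beta K d) (cos (rho x (U w))) *: (msqrt (B n) *m V n w) in
  let S := fun (N : nat) (x : tph_point R K d) (w : T) => \sum_(n < N) term n x w in
  let ms_limit := fun Z : tph_point R K d -> T -> 'cV[R]_m =>
    forall x, rvec_L2 P (Z x) /\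
      (fun N => \int[P]_w ((\sum_i (S N x w i 0 - Z x w i 0) ^+ 2)%:E))%E @ \oo --> 0%E in
  (exists Z, ms_limit Z) /\
  (forall Z, ms_limit Z ->
     [/\ (forall x, Evec P (Z x) = 0),
         (exists mu, forall x, Evec P (Z x) = mu)
           /\ (exists C : R -> 'M[R]_m,
                 forall x1 x2, covmx P (Z x1) (Z x2) = C (rho x1 x2))
       & forall x1 x2 i j,
           series (fun n => B n i j * jacobiP n (alpha K d) (beta K d) (cos (rho x1 x2)))
             @ \oo --> covmx P (Z x1) (Z x2) i j]) /\
  (forall i j, i <> j -> forall x1 x2,
     covmx P (term i x1) (term j x2) = 0).
Proof.
move=> dim_valid V_L2 V_indep V_mean V_cov U_el U_unif UV_indep B_nnd B_cvg term S ms_limit.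
have cov Z x y i k : ms_limit Z -> series (fun n => B n i k *
    jacobiP n (alpha K d) (beta K d) (cos (rho x y))) @ \oo --> covmx P (Z x) (Z y) i k.
  move=> cvg_Z.
  exact: (ms_cvg_cov dim_valid V_L2 V_indep V_mean V_cov U_el U_unif UV_indep B_nnd).
split; last split.
- have /choice[Z cvg_Z] : forall x, exists Z, ms_cvg P V U B x Z; last by exists Z.
  move=> x.
  apply: (ms_cvg_exists dim_valid V_L2 V_indep V_mean V_cov U_el U_unif UV_indep B_nnd) => i.
  have [l cvg_l] := B_cvg i i; apply/cvg_ex; exists l.
  by rewrite /cov_coef /jac rho_self cos0.
- move=> Z cvg_Z; have mean0 x : Evec P (Z x) = 0.
    exact: (ms_cvg_mean V_L2 V_mean U_el UV_indep (cvg_Z x)).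
  split=> // [|x y i k]; last exact: cov.
  split; first by exists 0.
  exists (fun r => \matrix_(i, k) lim (series (fun n => B n i k *
    jacobiP n (alpha K d) (beta K d) (cos r)) @ \oo)) => x y.
  by apply/matrixP => i k; rewrite [RHS]mxE; apply/esym/cvg_lim => //; exact: cov.
- move=> i j i_neq_j x y.
  exact: (covmx_field_term dim_valid V_L2 V_indep V_mean V_cov U_el U_unif UV_indep B_nnd).
Qed.
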